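(* For every even number $d\geq 4$ and every face function $F$ in dimension $\ell$, where $1\leq \ell\leq \frac{d}{2}-1$, there exists a constant $n_0$ for which the following holds. If $M$ is a flag triangulation of a homology manifold of dimension $d-1$ with $n\geq n_0$ vertices, then $$F(M)\leq F(\mathbf{J}_{\frac d2}(n)),$$ and equality holds if and only if $M$ is isomorphic to $\mathbf{J}_{\frac d2}(n)$.
   Context: All simplicial complexes are finite abstract simplicial complexes; the dimension of a face $\sigma$ is $|\sigma|-1$. $f_i(K)$ is the number of $i$-dimensional faces of $K$ (with $f_{-1}(K)=1$). All homology is with integer coefficients. A simplicial complex $K$ is flag if it is the clique complex of its $1$-skeleton, i.e. every set of vertices that are pairwise adjacent in the $1$-skeleton is a face. A simplicial complex $K$ is a homology manifold if for every point $p\in|K|$ one has $H_i(|K|,|K|-p;\mathbb{Z})=0$ for $i\neq\dim K$ and $H_{\dim K}(|K|,|K|-p;\mathbb{Z})=\mathbb{Z}$; equivalently, with $q=\dim K$, for every nonempty face $\sigma\in K$ the link $\mathrm{lk}_K(\sigma)=\{\tau\in K:\tau\cap\sigma=\emptyset,\ \tau\cup\sigma\in K\}$ has the homology of the sphere $S^{q-|\sigma|}$. A flag triangulation of a homology manifold is a flag complex that is a homology manifold. A real-valued function $F$ on simplicial complexes is a face function in dimension $\ell$ if it can be written as $F(K)=c_\ell f_\ell(K)+c_{\ell-1}f_{\ell-1}(K)+\dots+c_0f_0(K)+c_{-1}$ with fixed $c_i\in\mathbb{R}$ and $c_\ell>0$. For $r\geq1$ and $n\geq 4r$, $\mathbf{J}_r(n)$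 is the $n$-vertex flag complex which is the simplicial join of $r$ cycles (triangulated circles), each with $\lfloor\frac nr\rfloor$ or $\lceil\frac nr\rceil$ vertices (total $n$ vertices). *)

(* Defs.v *)
From HB Require Import structures.
From mathcomp Require Import all_boot all_order all_algebra.
From mathcomp Require Import boolp reals.

Set Implicit Arguments.
Unset Strict Implicit.
Unset Printing Implicit Defensive.

Import Order.TTheory GRing.Theory Num.Theory.
Local Open Scope ring_scope.

(* The elements of [T] need not all be vertices: the vertices of [K] are the
   [v] with [[set v] \in K].  The empty set is a face of every complex. *)
Record complex (T : finType) := Complex {
  faces :> {set {set T}};
  complex0 : set0 \in faces;
  complexS : forall s t : {set T}, t \subset s -> s \in faces -> t \in faces
}.

Definition vertices (T : finType) (K : {set {set T}}) : {set T} :=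
  [set v | [set v] \in K].

(* Number of [i]-dimensional faces, for [i >= 0]. *)
Definition fnum (T : finType) (K : {set {set T}}) (i : nat) : nat :=
  #|[set s in K | #|s| == i.+1]|.

Definition complex_dim (T : finType) (K : {set {set T}}) : int :=
  (\max_(s in K) #|s|)%N%:Z - 1.

Definition flag (T : finType) (K : {set {set T}}) : Prop :=
  forall s : {set T}, s \subset vertices K ->
    {in s &, forall u v, u != v -> [set u; v] \in K} -> s \in K.

Definition isomorphic (T T' : finType) (K : {set {set T}})
    (L : {set {set T'}}) : Prop :=
  exists f : T -> T',
    {in vertices K &, injective f} /\ [set f @: s | s : {set T} in K] = L.

Definition link (T : finType) (K : {set {set T}}) (s : {set T}) :
    {set {set T}} :=
  [set t in K | (t :&: s == set0) && (t :|: s \in K)].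

(* Augmented simplicial chain complex with integer coefficients, graded by
   cardinality: degree [k] is spanned by the faces with [k] elements, i.e. of
   dimension [k - 1], and the empty face spans degree 0.  Every face is
   oriented by the enumeration order of [T]. *)
Section Homology.
Variable T : finType.

Notation chain := {ffun {set T} -> int}.

(* In the boundary of [v |: t], where [v \notin t], the face [t] has the sign
   given by the position of [v]. *)
Definition boundary (c : chain) : chain :=
  [ffun t : {set T} => \sum_(v | v \notin t)
     (-1) ^+ #|[set w in t | (enum_rank w < enum_rank v)%N]| * c (v |: t)].

Variables (K : {set {set T}}) (k : nat).

Definition chains (j : nat) : {pred chain} :=
  fun c => [forall s, (c s != 0) ==> (s \in K) && (#|s| == j)].

Definition cycles : {pred chain} :=
  fun c => (c \in chains k) && (boundary c == 0).

Lemma boundaryB : {morph boundary : c d / c - d}.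
Proof.
move=> c d; apply/ffunP=> t; rewrite !ffunE -sumrB.
by apply: eq_bigr => v _; rewrite !ffunE mulrBr.
Qed.

Lemma boundary0 : boundary 0 = 0.
Proof. by rewrite -[in LHS](subrr 0) boundaryB subrr. Qed.

Lemma chains_zmod_closed j : zmod_closed (chains j).
Proof.
split=> [|c d /forallP cP /forallP dP]; apply/forallP => s.
  by rewrite ffunE eqxx.
apply/implyP; rewrite !ffunE.
have [cs0|cs _] := eqVneq (c s) 0; last exact: (implyP (cP s) cs).
by rewrite cs0 sub0r oppr_eq0; exact: (implyP (dP s)).
Qed.

Lemma cycles_zmod_closed : zmod_closed cycles.
Proof.
have [ch0 chB] := chains_zmod_closed k.
split=> [|c d /andP[cC /eqP bc] /andP[dC /eqP bd]]; apply/andP; split.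
- exact: ch0.
- by rewrite boundary0.
- exact: chB.
- by rewrite boundaryB bc bd subrr.
Qed.

HB.instance Definition _ :=
  GRing.isZmodClosed.Build chain cycles cycles_zmod_closed.

Record cycle_group := Cycle {
  cycle_chain :> chain;
  _ : cycle_chain \in cycles
}.

HB.instance Definition _ := [isSub for cycle_chain].
HB.instance Definition _ := [Choice of cycle_group by <:].
HB.instance Definition _ := [SubChoice_isSubZmodule of cycle_group by <:].

Definition boundaries : {pred cycle_group} :=
  fun z => `[< exists2 c, c \in chains k.+1 & val z = boundary c >].

Lemma boundaries_zmod_closed : zmod_closed boundaries.
Proof.
have [ch0 chB] := chains_zmod_closed k.+1.
split=> [|z t /asboolP[c cC zc] /asboolP[d dC td]]; apply/asboolP.
  by exists 0; rewrite ?boundary0 // raddf0.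
by exists (c - d); [exact: chB | rewrite raddfB /= zc td boundaryB].
Qed.

HB.instance Definition _ :=
  GRing.isZmodClosed.Build cycle_group boundaries boundaries_zmod_closed.

(* The reduced homology group of [K] in dimension [k - 1]. *)
Definition homology : zmodType := Quotient.quot boundaries.

End Homology.

(* [K] has the integral homology of the [m]-sphere, [m >= -1]: reduced
   homology is Z in dimension [m] and 0 in all other dimensions, the sphere of
   dimension -1 being the empty space (the complex [[set set0]]).  A power
   Z^b is represented by the row vectors of length [b], here [b <= 1]. *)
Definition homology_sphere (T : finType) (K : {set {set T}}) (m : int) : Prop :=
  forall k : nat,
    exists f : {additive homology K k -> 'rV[int]_(k%:Z - 1 == m)}, bijective f.

Definition homology_manifold (T : finType) (K : {set {set T}}) : Prop :=
  forall s : {set T}, s \in K -> s != set0 ->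
    homology_sphere (link K s) (complex_dim K - #|s|%:Z).

(* [cm1] is the coefficient of [f_(-1) = 1]. *)
Definition face_function (R : realType) (l : nat)
    (F : forall T : finType, complex T -> R) : Prop :=
  exists (c : nat -> R) (cm1 : R), 0 < c l /\
    forall (T : finType) (K : complex T),
      F T K = \sum_(i < l.+1) c i * (fnum K i)%:R + cm1.

(* A triangulated circle for [m >= 3]. *)
Definition cycle_faces (m : nat) : {set {set 'I_m}} :=
  [set s : {set 'I_m} | (s == set0) || [exists j, s \subset [set j; ordS j]]].

Fact cycle_faces0 m : set0 \in cycle_faces m.
Proof. by rewrite inE eqxx. Qed.

Fact cycle_facesS m (s t : {set 'I_m}) :
  t \subset s -> s \in cycle_faces m -> t \in cycle_faces m.
Proof.
rewrite !inE => ts /orP[/eqP s0|/existsP[j sj]].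
  by rewrite -subset0 -s0 ts.
by apply/orP; right; apply/existsP; exists j; exact: subset_trans sj.
Qed.

Definition cycle_complex (m : nat) : complex 'I_m :=
  Complex (cycle_faces0 m) (@cycle_facesS m).

(* Simplicial join: the vertex sets are made disjoint by tagging, and a set is
   a face iff its trace on each factor is a face. *)
Section Join.
Variables (I : finType) (T_ : I -> finType) (K_ : forall i, complex (T_ i)).

Definition join_faces : {set {set {i : I & T_ i}}} :=
  [set s : {set {i : I & T_ i}} |
     [forall i, [set x : T_ i | Tagged T_ x \in s] \in K_ i]].

Fact join_faces0 : set0 \in join_faces.
Proof.
rewrite inE; apply/forallP => i.
rewrite (_ : [set x | _] = set0) ?complex0 //.
by apply/setP => x; rewrite !inE.
Qed.

Fact join_facesS (s t : {set {i : I & T_ i}}) :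
  t \subset s -> s \in join_faces -> t \in join_faces.
Proof.
rewrite !inE => /subsetP ts /forallP sK; apply/forallP => i.
by apply: complexS (sK i); apply/subsetP => x; rewrite !inE; exact: ts.
Qed.

Definition join_complex : complex {i : I & T_ i} :=
  Complex join_faces0 join_facesS.

End Join.

(* The first [n %% r] cycles have [n %/ r + 1] vertices, the others
   [n %/ r].  Meaningful for [1 <= r] and [4 * r <= n]. *)
Definition Jcomplex (r n : nat) :
    complex {i : 'I_r & 'I_(n %/ r + (i < n %% r))} :=
  join_complex (fun i : 'I_r => cycle_complex (n %/ r + (i < n %% r))).

(* Main.v *)
From HB Require Import structures.
Require Import Defs.
From mathcomp Require Import all_boot all_order all_algebra reals.
From mathcomp Require Import perm boolp zify ring lra.
Set Implicit Arguments.
Unset Strict Implicit.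
Unset Printing Implicit Defensive.
Import Order.TTheory GRing.Theory Num.Theory.
Local Open Scope ring_scope.

(** Let [r = d / 2], let [G] be the 1-skeleton of [M] and [n] its number of vertices. As [M]
    is flag, its faces are the cliques of [G], and [F] is a linear functional of the face
    polynomial of [M], the sum of ['X^#|s|] over the faces [s] ([face_functional]). On
    the complexes that matter the number of cliques grows by a factor of order [n] with
    each additional vertex, so the leading coefficient of [F] decides: [F] mainly counts
    [l.+1]-cliques, and the join of [r] balanced cycles has about as many of these as the
    Turan graph with [r] parts. The proof is a stability argument around this graph.

    Topology enters through four properties of [G], which follow from the homology of
    links. The link of a vertex has at most [C * n ^ r.-1] cliques of every size, since the
    Dehn-Sommerville equations determine all its face numbers from the lower half of them
    ([vertex_link_bound]). Every clique lies in one with [2 r] vertices, and there are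
    none larger ([clique_pure], [card_clique_max]). A clique with [2 r - 1] vertices has
    exactly two common neighbours ([card_ext_ridge]). The common neighbourhood of a
    clique with [2 r - 2] vertices is connected ([ext_connected]).

    Suppose that [F M] is at least the value at the join of cycles. Then [G] has almost as
    many [l.+1]-cliques as the Turan graph, up to [O(n ^ l)]. The Moon-Moser
    inequalities carry this up to cliques with [r] vertices ([moon_moser_stability]), and
    averaging over these cliques yields one that cuts [G] into [r] large parts with only
    [O(n)] nonadjacent cross pairs ([typical_clique]). The bound on vertex links forces every
    vertex to be nonadjacent to nearly all of some part, which completes the parts to a
    partition with few bad vertices ([near_turan_stability]).

    Some facet avoids the bad vertices ([good_facet]). It has two vertices in each part, and
    the count of common neighbours of ridges shows that the good vertices of each part
    induce a graph of maximal degree 2 without triangles ([goodpart_degree],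
    [goodpart_triangle_free]). Now compare [G] with the graph in which all cross pairs are
    adjacent and bad vertices have no neighbours in their own part: this increases [F]
    unless nothing changes ([completed_compare]). The face polynomial of the new graph is
    a product of factors [1 + a X + b X^2] with [b <= a], one for each part. Raising [b] to
    [a] and balancing the numbers [a] increases [F] further, up to its value at the
    join of balanced cycles ([quad_prod_raise], [cycles_poly_balance]). Hence [F M] is
    not larger than that value, and in the case of equality all cross pairs are adjacent
    and the parts are 2-regular, of balanced sizes and, being links of codimension 2,
    connected. They are cycles ([two_regular_cycle]), and [M] is their join
    ([isomorphic_join]). *)

(** * Rational chains and the Euler characteristic of a homology sphere *)

Section RationalChains.
Variable T : finType.
Notation chainQ := {ffun {set T} -> rat^o}.

Definition incidence (t : {set T}) (v : T) : nat :=
  #|[set w in t | (enum_rank w < enum_rank v)%N]|.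

(** Homology is compared with face numbers over the rationals, where cycles and
    boundaries are subspaces and have dimensions. *)
Definition boundaryQ (c : chainQ) : chainQ :=
  [ffun t : {set T} => \sum_(v | v \notin t)
     (-1) ^+ incidence t v * (c (v |: t) : rat)].

Lemma boundaryQ_linear : linear boundaryQ.
Proof.
move=> a c d; apply/ffunP=> t; rewrite !ffunE scaler_sumr -big_split /=.
by apply: eq_bigr => v _; rewrite !ffunE mulrDr mulrCA.
Qed.

HB.instance Definition boundaryQ_isLinear :=
  GRing.isLinear.Build rat chainQ chainQ *:%R boundaryQ boundaryQ_linear.

Lemma incidenceU (t : {set T}) (v w : T) : v \notin t ->
  incidence (v |: t) w = (incidence t w + (enum_rank v < enum_rank w))%N.
Proof.
move=> vt; rewrite /incidence !setIdE setIUl cardsU.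
have -> : [set v] :&: [set x | (enum_rank x < enum_rank w)%N] :&:
   (t :&: [set x | (enum_rank x < enum_rank w)%N]) = set0.
  apply/setP => x; rewrite !inE; case: eqP => // ->.
  by rewrite (negbTE vt) andbF.
rewrite cards0 subn0 addnC; congr addn.
case: ltnP => h.
  by apply/eqP/cards1P; exists v; apply/setP => x; rewrite !inE; case: eqP => // ->.
by apply/eqP; rewrite cards_eq0; apply/eqP/setP => x; rewrite !inE;
   case: eqP => //= ->; rewrite ltnNge h.
Qed.

(** Removing two vertices in either order contributes twice with opposite signs. *)
Lemma boundaryQK (c : chainQ) : boundaryQ (boundaryQ c) = 0.
Proof.
apply/ffunP => t; rewrite !ffunE.
pose F v w := (-1) ^+ incidence t v * ((-1) ^+ incidence (v |: t) w *
   (c (w |: (v |: t)) : rat)).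
pose S := \sum_(v | v \notin t) \sum_(w | (w \notin t) && (v != w)) F v w.
have -> : \sum_(v | v \notin t) (-1) ^+ incidence t v * (boundaryQ c (v |: t) : rat) = S.
  apply: eq_bigr => v vt; rewrite ffunE mulr_sumr.
  by apply: eq_bigl => w; rewrite !inE negb_or eq_sym andbC.
suff SN : S = - S by clearbody S; lra.
rewrite {1}/S (exchange_big_dep (fun w => w \notin t)) /=; last by move=> v w _ /andP[].
rewrite -sumrN; apply: eq_bigr => w wt; rewrite -sumrN.
apply: eq_big => [v|v /andP[vt /andP[_ vw]]]; first by rewrite wt eq_sym.
rewrite /F !incidenceU // !exprD setUCA.
have : (enum_rank v < enum_rank w)%N = ~~ (enum_rank w < enum_rank v)%N.
  rewrite -leqNgt ltn_neqAle; case: eqP => // /val_inj/enum_rank_inj e.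
  by rewrite e eqxx in vw.
by move=> ->; case: ltnP => _; rewrite ?expr0 ?expr1 /=; ring.
Qed.

Definition face1 (s : {set T}) : chainQ := [ffun t => (t == s)%:R].

Lemma face1_span (E : seq {set T}) (c : chainQ) :
  reflect (forall s, c s != 0 -> s \in E) (c \in <<map face1 E>>%VS).
Proof.
apply: (iffP idP) => [|cE]; last first.
  have -> : c = \sum_s (c s : rat) *: face1 s.
    apply/ffunP => t; rewrite sum_ffunE (bigD1 t) //= !ffunE eqxx.
    rewrite /GRing.scale /= mulr1 big1 ?addr0 //.
    by move=> s st; rewrite !ffunE eq_sym (negbTE st) scaler0.
  apply: rpred_sum => s _; case: (eqVneq (c s) 0) => [->|/cE sE].
    by rewrite scale0r mem0v.
  by rewrite memvZ // memv_span // map_f.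
elim: E c => [|s0 E IH] c /=.
  by rewrite span_nil memv0 => /eqP -> s; rewrite ffunE eqxx.
rewrite span_cons => /memv_addP[_ /vlineP[k ->] [x /IH xE ->]] s.
rewrite !ffunE inE; have [//|_ /=] := eqVneq s s0.
by rewrite scaler0 add0r; exact: xE.
Qed.

Lemma face1_free (E : seq {set T}) : uniq E -> free (map face1 E).
Proof.
elim: E => [|s E IH] /=; first by rewrite nil_free.
case/andP=> sE uE; rewrite free_cons IH // andbT.
apply/negP => /face1_span /(_ s); rewrite ffunE eqxx => /(_ isT).
by rewrite (negbTE sE).
Qed.

Variable K : complex T.

Definition facesn (k : nat) : {set {set T}} := [set s in faces K | #|s| == k].

Definition chainsQ k : {vspace chainQ} := <<map face1 (enum (facesn k))>>%VS.
Definition cyclesQ k := (chainsQ k :&: lker (linfun boundaryQ))%VS.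
Definition boundariesQ k := (linfun boundaryQ @: chainsQ k.+1)%VS.

Lemma chainsQP k (c : chainQ) :
  reflect (forall s, c s != 0 -> s \in faces K /\ #|s| = k) (c \in chainsQ k).
Proof.
apply: (iffP (face1_span _ _)) => h s /h; rewrite mem_enum inE.
  by case/andP=> -> /eqP.
by case=> -> /eqP.
Qed.

Lemma dim_chainsQ k : \dim (chainsQ k) = #|facesn k|.
Proof.
have /eqP -> : free (map face1 (enum (facesn k))) by apply/face1_free/enum_uniq.
by rewrite size_map -cardE.
Qed.

Lemma boundaryQ_chains k (c : chainQ) : c \in chainsQ k.+1 -> boundaryQ c \in chainsQ k.
Proof.
move/chainsQP=> cK; apply/chainsQP => t; rewrite ffunE => tn0.
have [v vt cv] : exists2 v, v \notin t & c (v |: t) != 0.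
  apply: contrapT => h; case/eqP: tn0; rewrite big1 // => v vt.
  by apply: contrapT => /eqP cv; apply: h; exists v => //; apply: contraNN cv => /eqP ->; rewrite mulr0.
have [vK] := cK _ cv; rewrite cardsU1 vt => -[<-]; split => //.
exact: complexS (subsetUr _ _) vK.
Qed.

Lemma boundariesQ_sub k : (boundariesQ k <= cyclesQ k)%VS.
Proof.
apply/subvP => _ /memv_imgP[c cC ->]; rewrite memv_cap lfunE /= boundaryQ_chains //.
by rewrite memv_ker lfunE /= boundaryQK.
Qed.

Lemma card_facesnS k : #|facesn k.+1| = (\dim (cyclesQ k.+1) + \dim (boundariesQ k))%N.
Proof. by rewrite -dim_chainsQ; exact: (esym (limg_ker_dim _ _)). Qed.

Lemma card_facesn0 : #|facesn 0| = \dim (cyclesQ 0).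
Proof.
rewrite -dim_chainsQ; congr (\dim _); apply/eqP; rewrite eqEsubv capvSl andbT.
rewrite subv_cap subvv; apply/subvP => c /chainsQP cC; rewrite memv_ker lfunE /=.
apply/eqP/ffunP => t; rewrite !ffunE big1 // => v vt.
case: (eqVneq (c (v |: t)) 0) => [->|/cC[_]]; first by rewrite mulr0.
by rewrite cardsU1 vt.
Qed.

(** Rank-nullity in every degree, telescoped up to a finite degree; the extra term
    is the rank of the boundary map entering the top degree. *)
Lemma euler_poincare N :
  \sum_(k < N.+1) (-1) ^+ k * #|facesn k|%:R + (-1) ^+ N * (\dim (boundariesQ N))%:R * (-1) =
  \sum_(k < N.+1) (-1) ^+ k * ((\dim (cyclesQ k))%:R - (\dim (boundariesQ k))%:R) :> int.
Proof.
elim: N => [|N IH].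
  by rewrite !big_ord1 card_facesn0; ring.
rewrite [RHS]big_ord_recr -IH [in LHS]big_ord_recr /= card_facesnS natrD exprS; ring.
Qed.

End RationalChains.

Lemma int_row_generator (b : nat) : b = 1%N ->
  (forall u : 'rV[int]_b, exists N, u = const_mx 1 *~ N) /\
  (forall N, (const_mx 1 : 'rV[int]_b) *~ N = 0 -> N = 0).
Proof.
have mxMz p (N : int) (i : 'I_p) : ((const_mx 1 : 'rV[int]_p) *~ N) 0 i = N.
  case: N => N; rewrite ?NegzE ?mulrNz -pmulrn; rewrite ?mxE ?mulmxnE mxE; lia.
move=> ->; split=> [u|N].
  by exists (u 0 0); apply/rowP => i; rewrite mxMz ord1.
by move/rowP/(_ 0); rewrite mxMz mxE.
Qed.

Section IntegralHomology.
Local Open Scope quotient_scope.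
Variables (T : finType) (K : {set {set T}}) (k : nat) (m : int).
Notation chain := {ffun {set T} -> int}.
Hypothesis sphere : homology_sphere K m.

(** What the isomorphism with a trivial group says about chains: cycles bound. *)
Lemma homology_sphere_trivial (c : chain) : k%:Z - 1 != m -> c \in cycles K k ->
  exists2 b, b \in chains K k.+1 & c = boundary b.
Proof.
move=> km cZ; have [f [g fK _]] := sphere k.
have rv0 (u v : 'rV[int]_(k%:Z - 1 == m)) : u = v.
  by move: u v; rewrite (negbTE km) => u v; apply/rowP => -[].
pose z : cycle_group K k := Cycle cZ.
have /eqP : \pi_(homology K k) z = \pi_(homology K k) 0.
  by rewrite -[LHS]fK -[RHS]fK; congr g; exact: rv0.
by rewrite -Quotient.idealrBE subr0 => /asboolP[b bC /= zb]; exists b.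
Qed.

(** What the isomorphism with Z says about chains: some cycle generates homology
    and no nonzero multiple of it bounds. *)
Lemma homology_sphere_generator : k%:Z - 1 = m ->
  exists2 z : chain, z \in cycles K k &
    (forall N b, b \in chains K k.+1 -> z *~ N = boundary b -> N = 0) /\
    (forall c, c \in cycles K k -> exists2 b, b \in chains K k.+1 &
       exists N, c = boundary b + z *~ N).
Proof.
move=> km; have [f [g fK gK]] := sphere k.
have k1 : (k%:Z - 1 == m) = 1%N :> nat by rewrite km eqxx.
pose one : 'rV[int]_(k%:Z - 1 == m) := const_mx 1.
pose z : cycle_group K k := repr (g one).
have fz : f (\pi_(homology K k) z) = one by rewrite reprK gK.
have [gen free1] := int_row_generator k1.
have zE : f (\pi_(homology K k) z) = const_mx 1 by exact: fz.
have pi0 : \pi_(homology K k) 0 = 0 by exact: raddf0.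
have bd (x : cycle_group K k) : f (\pi_(homology K k) x) = 0 -> exists2 b, b \in chains K k.+1 & val x = boundary b.
  move=> fx; have /eqP : \pi_(homology K k) x = \pi_(homology K k) 0.
    by apply: (can_inj fK); rewrite fx pi0 raddf0.
  by rewrite -Quotient.idealrBE subr0 => /asboolP[b bC /= zb]; exists b.
exists (val z); first by case: (z).
split=> [N b bC zN|c cZ].
  have zN0 : \pi_(homology K k) z *~ N = 0.
    rewrite -raddfMz -[RHS]pi0 /=; apply/eqP; rewrite -Quotient.idealrBE subr0.
    by apply/asboolP; exists b => //; rewrite raddfMz.
  by apply: free1; rewrite -zE -raddfMz zN0 raddf0.
have [N fN] := gen (f (\pi_(homology K k) (Cycle cZ))).
have [|b bC bE] := bd (Cycle cZ - z *~ N).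
  by rewrite !raddfB !raddfMz /= mulNrz; apply/eqP; rewrite subr_eq0; apply/eqP; rewrite -zE in fN.
by exists b => //; exists N; rewrite -bE raddfB raddfMz subrK.
Qed.

End IntegralHomology.

Section Euler.
Variables (T : finType) (K : complex T).
Notation chain := {ffun {set T} -> int}.
Notation chainQ := {ffun {set T} -> rat^o}.

Definition ratr_chain (c : chain) : chainQ := [ffun s => (c s)%:~R].

Lemma ratr_chain_boundary c : boundaryQ (ratr_chain c) = ratr_chain (boundary c).
Proof.
apply/ffunP => t; rewrite !ffunE rmorph_sum /=; apply: eq_bigr => v _.
by rewrite ffunE rmorphM rmorphXn rmorphN1.
Qed.

Lemma ratr_chain_zmod : zmod_morphism ratr_chain.
Proof. by move=> c d; apply/ffunP => s; rewrite !ffunE intrB. Qed.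

HB.instance Definition ratr_chain_additive :=
  GRing.isZmodMorphism.Build chain chainQ ratr_chain ratr_chain_zmod.

Lemma ratr_chainMz c N : ratr_chain (c *~ N) = N%:~R *: ratr_chain c.
Proof. by rewrite scaler_int raddfMz. Qed.

Lemma ratr_chain_inj : injective ratr_chain.
Proof.
move=> c d /ffunP cd; apply/ffunP => s; have := cd s.
by rewrite !ffunE => /intr_inj.
Qed.

Lemma ratr_chain_in k c : (ratr_chain c \in chainsQ K k) = (c \in chains K k).
Proof.
apply/chainsQP/forallP => [h s|h s].
  apply/implyP => cs; have [|-> ->] := h s; last by rewrite eqxx.
  by rewrite ffunE intr_eq0.
by rewrite ffunE intr_eq0 => cs; have /implyP/(_ cs)/andP[-> /eqP] := h s.
Qed.

(** Clearing denominators moves questions about rational cycles to integral ones. *)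
Lemma common_denominator (c : chainQ) :
  exists2 N : int, N != 0 & exists c0, N%:~R *: c = ratr_chain c0.
Proof.
pose N := \prod_(s : {set T}) denq (c s).
exists N; first by apply/prodf_neq0 => s _; exact: denq_neq0.
exists [ffun s => numq (c s) * \prod_(t | t != s) denq (c t)].
apply/ffunP => s; rewrite !ffunE /N (bigD1 s) //= /GRing.scale /= !intrM.
rewrite -[X in _ * X = _](divq_num_den (c s)).
have : (denq (c s))%:~R != 0 :> rat by rewrite intr_eq0 denq_neq0.
by move=> d0; field.
Qed.

Lemma boundariesQP k (c : chainQ) :
  reflect (exists2 b, b \in chainsQ K k.+1 & c = boundaryQ b) (c \in boundariesQ K k).
Proof.
apply: (iffP memv_imgP) => -[b bC e]; exists b => //; move: e; rewrite lfunE //.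
Qed.

Lemma cycles_ratr k c : (ratr_chain c \in cyclesQ K k) = (c \in cycles K k).
Proof.
rewrite memv_cap memv_ker lfunE /= ratr_chain_in ratr_chain_boundary.
congr (_ && _); apply/eqP/eqP => [h|->]; last by apply/ffunP => s; rewrite !ffunE.
by apply: ratr_chain_inj; rewrite h; apply/ffunP => s; rewrite !ffunE.
Qed.

Lemma cyclesQ_integral k (c : chainQ) : c \in cyclesQ K k ->
  exists2 N : int, N != 0 & exists2 c0, c0 \in cycles K k & N%:~R *: c = ratr_chain c0.
Proof.
move=> cZ; have [N N0 [c0 e]] := common_denominator c.
by exists N => //; exists c0 => //; rewrite -cycles_ratr -e memvZ.
Qed.

(** Integral homology determines the rational Betti numbers: a rational cycle has an
    integral multiple, which bounds modulo the generating cycle. *)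
Lemma betti_homology_sphere m k : homology_sphere K m ->
  \dim (cyclesQ K k) = (\dim (boundariesQ K k) + nat_of_bool (k%:Z - 1 == m)%R)%N.
Proof.
move=> sphere; case: eqP => km; last first.
  rewrite addn0; congr (\dim _); apply/eqP; rewrite eqEsubv boundariesQ_sub andbT.
  apply/subvP => c /cyclesQ_integral[N N0 [c0 c0Z e]].
  have [b bC c0E] := homology_sphere_trivial sphere (introN eqP km) c0Z.
  have : ratr_chain c0 \in boundariesQ K k.
    by apply/boundariesQP; exists (ratr_chain b); rewrite ?ratr_chain_in // ratr_chain_boundary c0E.
  by rewrite -e rpredZeq intr_eq0 (negbTE N0).
have [z zZ [zfree zgen]] := homology_sphere_generator sphere km.
have zn0 : ratr_chain z \notin boundariesQ K k.
  apply/negP => /boundariesQP[b bC zb]; have [N N0 [b0 be]] := common_denominator b.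
  suff /zfree : z *~ N = boundary b0.
    by move=> N00; rewrite N00 ?eqxx // -ratr_chain_in -be memvZ in N0.
  apply: ratr_chain_inj; rewrite -ratr_chain_boundary -be linearZ /= -zb.
  by rewrite ratr_chainMz.
have -> : cyclesQ K k = (boundariesQ K k + <[ratr_chain z]>)%VS.
  apply/eqP; rewrite eqEsubv subv_add boundariesQ_sub /= -memvE cycles_ratr zZ andbT.
  apply/subvP => c /cyclesQ_integral[N N0 [c0 c0Z e]].
  have [b bC [M c0E]] := zgen _ c0Z.
  have : ratr_chain c0 \in (boundariesQ K k + <[ratr_chain z]>)%VS.
    rewrite c0E raddfD /= ratr_chainMz -ratr_chain_boundary memv_add ?memvZ ?memv_line //.
    by apply/boundariesQP; exists (ratr_chain b); rewrite ?ratr_chain_in.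
  by rewrite -e rpredZeq intr_eq0 (negbTE N0).
rewrite dimv_disjoint_sum ?dim_vline; last first.
  apply/eqP; rewrite -subv0; apply/subvP => x; rewrite memv_cap => /andP[xB /vlineP[a xE]].
  move: xB; rewrite xE rpredZeq (negbTE zn0) orbF => /eqP->; rewrite scale0r mem0v.
  by [].
by congr addn; rewrite (_ : _ != 0) //; apply: contraNneq zn0 => ->; rewrite mem0v.
Qed.

(** The alternating count of faces is the alternating sum of Betti numbers, of which
    a homology sphere has exactly one. *)
Lemma euler_homology_sphere (j : nat) : homology_sphere K (j%:Z - 1) -> (j <= #|T|)%N ->
  \sum_(s in faces K) (-1) ^+ #|s| = (-1) ^+ j :> int.
Proof.
move=> sphere jT.
have := euler_poincare K #|T|.
(* no face has more elements than there are points, so nothing bounds there *)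
have -> : \dim (boundariesQ K #|T|) = 0%N.
  apply/eqP; rewrite -leqn0; rewrite -(leq_add2l (\dim (chainsQ K #|T|.+1 :&: lker (linfun (@boundaryQ T))))) limg_ker_dim.
  apply: leq_trans (leq_addl _ _).
  rewrite dim_chainsQ leqn0 cards_eq0; apply/eqP/setP => s; rewrite !inE.
  apply/negP => /andP[_ /eqP sT]; have : (#|s| <= #|T|)%N by exact: max_card.
  by rewrite sT ltnn.
rewrite mulr0 mul0r addr0.
have -> : \sum_(k < #|T|.+1) (-1) ^+ k * ((\dim (cyclesQ K k))%:R - (\dim (boundariesQ K k))%:R)
     = (-1) ^+ j :> int.
  rewrite (bigD1 (Ordinal (jT : j < #|T|.+1)%N)) //= big1 ?addr0 => [|k kj].
    rewrite (betti_homology_sphere _ sphere) eqxx natrD addrAC subrr add0r mulr1 //.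
  rewrite (betti_homology_sphere _ sphere) (_ : (_ == _) = false) ?addn0 ?subrr ?mulr0 //.
  by apply: contraNF kj => /eqP kj; apply/eqP/val_inj => /=; lia.
move=> <-.
rewrite (partition_big (fun s : {set T} => inord #|s| : 'I_#|T|.+1) xpredT) //=.
apply: eq_bigr => k _; rewrite (eq_bigr (fun=> (-1) ^+ k)) => [|s /andP[_ /eqP <-]].
  rewrite sumr_const mulr_natr; congr (_ *+ _); apply: eq_card => s; rewrite !inE.
  rewrite unfold_in /=; congr andb; apply/eqP/eqP => [<-|sk]; first by rewrite inordK // ltnS max_card.
  by apply/val_inj; rewrite /= inordK sk // ltn_ord.
by rewrite inordK // ltnS max_card.
Qed.

End Euler.

(** * Faces and links of a homology manifold *)

Section Manifold.
Variables (T : finType) (M : complex T) (d : nat).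
Hypothesis manifoldM : homology_manifold M.
Hypothesis dimM : complex_dim M = d%:Z - 1.

Lemma max_face_card : (\max_(s in faces M) #|s|)%N = d.
Proof. by move: dimM; rewrite /complex_dim; lia. Qed.

Lemma face_card s : s \in faces M -> (#|s| <= d)%N.
Proof. by move=> sM; rewrite -max_face_card; apply: (leq_bigmax_cond _ sM). Qed.

Fact link0 s : s \in faces M -> set0 \in link M s.
Proof. by move=> sM; rewrite inE complex0 set0I eqxx set0U. Qed.

Fact linkS s (t u : {set T}) : u \subset t -> t \in link M s -> u \in link M s.
Proof.
move=> ut; rewrite !inE => /and3P[tM /eqP ts tsM]; apply/and3P; split.
- exact: complexS ut tM.
- by rewrite -subset0 -ts setSI.
- by apply: complexS tsM; rewrite setSU.
Qed.

Definition link_complex s (sM : s \in faces M) := Complex (link0 sM) (@linkS s).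

Lemma link_sphere s : s \in faces M -> s != set0 ->
  homology_sphere (link M s) ((d - #|s|)%N%:Z - 1).
Proof.
move=> sM s0; have := manifoldM sM s0; rewrite dimM.
suff -> : d%:Z - 1 - #|s|%:Z = (d - #|s|)%N%:Z - 1 by [].
by rewrite -subzn ?face_card //; lia.
Qed.

Lemma link_euler s : s \in faces M -> s != set0 ->
  \sum_(t in link M s) (-1) ^+ #|t| = (-1) ^+ (d - #|s|) :> int.
Proof.
move=> sM s0; have := @euler_homology_sphere _ (link_complex sM) _ (link_sphere sM s0).
apply; apply: leq_trans (leq_subr _ _) _; rewrite -max_face_card.
by apply/bigmax_leqP => t _; exact: max_card.
Qed.

Lemma sum_link (s : {set T}) (R : zmodType) (F : {set T} -> R) :
  \sum_(t in faces M | s \subset t) F t = \sum_(t in link M s) F (t :|: s).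
Proof.
rewrite (reindex_onto (fun t => t :|: s) (fun t => t :\: s)) /=; last first.
  move=> t /andP[_ st]; apply/setP => x; rewrite !inE.
  case: (boolP (x \in s)) => [/(subsetP st) -> //|_]; rewrite ?orbF //.
apply: eq_bigl => t; rewrite !inE subsetUr andbT.
apply/andP/and3P => [[tsM /eqP tsD]|[tM /eqP ts tsM]].
  split=> //; first by apply: complexS tsM; rewrite subsetUl.
  by rewrite -tsD; apply/eqP/setP => x; rewrite !inE; case: (x \in s); rewrite /= ?andbF.
split=> //; apply/eqP; rewrite setDUl setDv setU0.
by apply/setDidPl; rewrite -setI_eq0 ts.
Qed.

Lemma face_euler s : s \in faces M -> s != set0 ->
  \sum_(t in faces M | s \subset t) (-1) ^+ #|t| = (-1) ^+ d :> int.
Proof.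
move=> sM s0; rewrite sum_link -(subnK (face_card sM)) exprD -link_euler // mulr_suml.
apply: eq_bigr => t; rewrite inE => /and3P[_ /eqP ts _].
by rewrite cardsU ts cards0 subn0 exprD.
Qed.

(** If nothing extended the face, its link would consist of the empty face alone,
    whose homology sits in dimension -1 and not in that of the required sphere. *)
Lemma face_extends s : s \in faces M -> s != set0 -> (#|s| < d)%N ->
  exists2 v, v \notin s & v |: s \in faces M.
Proof.
move=> sM s0 sd.
(* the empty face is a cycle of the link; writing it as a boundary needs a vertex *)
pose c : {ffun {set T} -> int} := [ffun t => (t == set0)%:R].
have cZ : c \in cycles (link M s) 0.
  apply/andP; split.
    apply/forallP => t; apply/implyP; rewrite ffunE.
    by have [->|_] := eqVneq t set0; rewrite //= link0 // cards0.
  apply/eqP/ffunP => t; rewrite !ffunE big1 // => v vt; rewrite ffunE.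
  by rewrite -cards_eq0 cardsU1 vt mulr0.
have [|b /forallP bC cb] := homology_sphere_trivial (link_sphere sM s0) _ cZ.
  by lia.
have := congr1 (fun f : {ffun {set T} -> int} => f set0) cb.
rewrite !ffunE eqxx => sum1.
have [v bv] : exists v, b (v |: set0) != 0.
  apply: contrapT => h; move: sum1; rewrite big1 // => v _.
  by have [->|bn0] := eqVneq (b (v |: set0)) 0; [rewrite mulr0|case: h; exists v].
have /implyP/(_ bv)/andP[] := bC (v |: set0).
rewrite setU0 inE => /and3P[_ vs vsM] _; exists v => //.
by apply: contraTN vs => vs; rewrite -sub1set in vs; rewrite (setIidPl vs) -cards_eq0 cards1.
Qed.

Lemma face_pure s : s \in faces M -> s != set0 ->
  exists2 t, t \in faces M & s \subset t /\ #|t| = d.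
Proof.
move=> sM; move: {2}(d - #|s|)%N (erefl (d - #|s|)%N) => k.
elim: k s sM => [|k IH] s sM sk s0.
  by exists s => //; split => //; have := face_card sM; lia.
have [|v vs vsM] := face_extends sM s0; first by lia.
have [||t tM [st td]] := IH _ vsM.
- by rewrite cardsU1 vs; lia.
- by apply/set0Pn; exists v; rewrite setU11.
by exists t => //; split=> //; apply: subset_trans st; rewrite subsetUr.
Qed.

(** The link of a face of codimension 2 has vanishing reduced homology in dimension
    0, so the difference of two vertices bounds. Summing the coefficients of that
    boundary over a union of components gives 0, because every edge contributes its
    two ends with opposite signs; hence a union of components that contains one of
    the vertices contains the other. *)
Lemma link_connected s (S : {set T}) : s \in faces M -> s != set0 -> (#|s| + 2 = d)%N ->
  (forall u v, u \in S -> [set u; v] \in link M s -> v \in S) ->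
  forall u v, [set u] \in link M s -> [set v] \in link M s -> u \in S -> v \in S.
Proof.
move=> sM s0 sd closedS u v uL vL uS; apply/negPn/negP => vS.
pose c : {ffun {set T} -> int} := [ffun t => (t == [set u])%:R - (t == [set v])%:R].
have uv : u != v by apply: contraNneq vS => <-.
have cZ : c \in cycles (link M s) 1.
  apply/andP; split.
    apply/forallP => t; apply/implyP; rewrite ffunE.
    have [->|_] := eqVneq t [set u]; first by rewrite uL cards1.
    by have [->|_] := eqVneq t [set v]; first by rewrite vL cards1.
  apply/eqP/ffunP => t; rewrite !ffunE; have [->|t0] := eqVneq t set0; last first.
    rewrite big1 // => w wt; rewrite ffunE.
    have ne x : (w |: t == [set x]) = false.
      by apply/eqP => /(congr1 (fun A : {set T} => #|A|)); rewrite cardsU1 wt cards1; move: t0; rewrite -cards_eq0; lia.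
    by rewrite !ne subrr mulr0.
  rewrite (bigD1 u) ?inE //= (bigD1 v) ?inE 1?eq_sym //= big1 => [|w /andP[/andP[_ wu] wv]].
    rewrite !ffunE !setU0 eqxx (inj_eq set1_inj) (negbTE uv) eqxx eq_sym (inj_eq set1_inj) (negbTE uv).
    rewrite !(eq_card0 (A := [set _ in _ | _])) => [|x|x]; rewrite ?inE //; lia.
  by rewrite ffunE setU0 !(inj_eq set1_inj) (negbTE wu) (negbTE wv) subrr mulr0.
have [|b /forallP bC cb] := homology_sphere_trivial (link_sphere sM s0) _ cZ.
  by rewrite -sd; lia.
have inc1 (x y : T) : incidence [set x] y = (enum_rank x < enum_rank y)%N.
  rewrite -{1}(setU0 [set x]) incidenceU ?inE // [incidence _ _]eq_card0 // => w.
  by rewrite !inE.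
(* the sum over S, computed from the definition of c and from the boundary *)
have sum1 : \sum_(x in S) c [set x] = 1.
  rewrite (bigD1 u) //= ffunE eqxx (inj_eq set1_inj) (negbTE uv) big1 ?addr0 ?subr0 // => x /andP[xS xu].
  rewrite ffunE !(inj_eq set1_inj) (negbTE xu) (_ : (x == v) = false) ?subrr //.
  by apply: contraNF vS => /eqP <-.
pose F x y := (-1) ^+ (enum_rank x < enum_rank y)%N * b [set y; x].
have sum2 : \sum_(x in S) c [set x] = \sum_(x in S) \sum_(y in S | y != x) F x y.
  apply: eq_bigr => x xS; rewrite cb ffunE [LHS](bigID (mem S)) /= [X in _ + X]big1 => [|y /andP[yx yS]].
    rewrite addr0; apply: eq_big => [y|y _]; first by rewrite inE andbC.
    by rewrite /F -inc1.
  have [->|/(implyP (bC _))/andP[yxL _]] := eqVneq (b (y |: [set x])) 0; first by rewrite mulr0.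
  by move: yS; rewrite (closedS x y xS) // setUC.
have : \sum_(x in S) \sum_(y in S | y != x) F x y = - \sum_(x in S) \sum_(y in S | y != x) F x y.
  rewrite {1}(exchange_big_dep (mem S)) /=; last by move=> x y _ /andP[].
  rewrite -sumrN; apply: eq_bigr => y yS; rewrite -sumrN.
  apply: eq_big => [x|x /andP[xS /andP[_ yx]]]; first by rewrite yS eq_sym.
  rewrite /F setUC.
  have : (enum_rank x < enum_rank y)%N = ~~ (enum_rank y < enum_rank x)%N.
    rewrite -leqNgt ltn_neqAle; case: eqP => // /val_inj/enum_rank_inj e.
    by rewrite e eqxx in yx.
  by move=> ->; case: ltnP => _; rewrite ?expr0 ?expr1 /=; ring.
by rewrite -sum2 sum1.
Qed.

End Manifold.

(** * Cliques and common neighbourhoods *)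

Section Cliques.
Variables (T : finType) (e : rel T).

Definition clique (s : {set T}) :=
  [forall u in s, forall v in s, (u != v) ==> e u v].

Definition cliques (V : {set T}) : {set {set T}} :=
  [set s : {set T} | (s \subset V) && clique s].

Definition cliquesn V k : {set {set T}} := [set s in cliques V | #|s| == k].

(** For a clique [s], the vertices of [V] by which it extends to a larger clique. *)
Definition ext (V s : {set T}) : {set T} := [set v in V | [forall u in s, e u v]].

Lemma cliqueP (s : {set T}) : reflect {in s &, forall u v, u != v -> e u v} (clique s).
Proof.
apply: (iffP forall_inP) => [h u v us vs uv|h u us].
  by have /forall_inP/(_ v vs)/implyP/(_ uv) := h u us.
by apply/forall_inP => v vs; apply/implyP; exact: h.
Qed.

Lemma clique_sub (s t : {set T}) : s \subset t -> clique t -> clique s.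
Proof.
by move=> /subsetP st /cliqueP tC; apply/cliqueP => u v /st us /st vs; exact: tC.
Qed.

Lemma clique0 : clique set0.
Proof. by apply/cliqueP => u v; rewrite inE. Qed.

Lemma cliques_sub V (s t : {set T}) : s \subset t -> t \in cliques V -> s \in cliques V.
Proof.
move=> st; rewrite !inE => /andP[tV tC].
by rewrite (subset_trans st) //= (clique_sub st).
Qed.

Lemma cliquesS (V W : {set T}) : V \subset W -> cliques V \subset cliques W.
Proof.
by move=> VW; apply/subsetP => s; rewrite !inE => /andP[sV ->]; rewrite (subset_trans sV VW).
Qed.

Lemma cliquesnS (V W : {set T}) k : V \subset W -> cliquesn V k \subset cliquesn W k.
Proof.
by move=> VW; apply/subsetP => s; rewrite ![s \in cliquesn _ _]inE => /andP[/(subsetP (cliquesS VW)) -> ->].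
Qed.

Lemma cliquesnP (V : {set T}) k (s : {set T}) : reflect [/\ s \subset V, clique s & #|s| = k] (s \in cliquesn V k).
Proof.
rewrite inE [s \in cliques V]inE -andbA.
by apply: (iffP and3P) => -[? ? /eqP ?]; split => //; apply/eqP.
Qed.

Lemma in_ext (V s : {set T}) v : (v \in ext V s) = (v \in V) && [forall u in s, e u v].
Proof. by rewrite inE. Qed.

Lemma extP (V s : {set T}) v : reflect (v \in V /\ {in s, forall u, e u v}) (v \in ext V s).
Proof. by rewrite inE; apply: (iffP andP) => -[vV /forall_inP]. Qed.

Lemma cliquesn0 V : cliquesn V 0 = [set set0].
Proof.
apply/setP => s; rewrite in_set1; apply/cliquesnP/eqP => [[_ _ /eqP]|->].
  by rewrite cards_eq0 => /eqP.
by rewrite sub0set clique0 cards0.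
Qed.

Lemma clique1 v : clique [set v].
Proof. by apply/cliqueP => x y /set1P-> /set1P->; rewrite eqxx. Qed.

Lemma cliquesn1 V : cliquesn V 1 = [set [set v] | v in V].
Proof.
apply/setP => s; apply/cliquesnP/imsetP => [[sV _ /eqP/cards1P[v sv]]|[v vV ->]].
  by exists v => //; rewrite -sub1set -sv.
by rewrite sub1set vV clique1 cards1.
Qed.

Lemma card_cliquesn1 V : #|cliquesn V 1| = #|V|.
Proof. by rewrite cliquesn1 card_imset //; exact: set1_inj. Qed.

Lemma ext_sub V s : ext V s \subset V.
Proof. by apply/subsetP => v; rewrite inE => /andP[]. Qed.

Lemma ext_anti V (s t : {set T}) : s \subset t -> ext V t \subset ext V s.
Proof.
move=> /subsetP st; apply/subsetP => v /extP[vV h]; apply/extP; split=> // u /st.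
exact: h.
Qed.

Hypothesis irr : irreflexive e.

Lemma ext_notin V (s : {set T}) v : v \in ext V s -> v \notin s.
Proof. by case/extP => _ h; apply/negP => /h; rewrite irr. Qed.

Hypothesis sym : symmetric e.

Lemma cliqueU1 (s : {set T}) v : v \notin s -> clique (v |: s) = clique s && [forall u in s, e u v].
Proof.
move=> vs; apply/cliqueP/andP => [h|[/cliqueP h /forall_inP sv] u w].
  split; first by apply/cliqueP => u w us ws; apply: h; rewrite inE ?us ?ws orbT.
  apply/forall_inP => u us; apply: h; rewrite ?setU11 // ?inE ?us ?orbT //.
  by apply: contraNneq vs => <-.
rewrite !inE => /predU1P[->|us] /predU1P[->|ws]; rewrite ?eqxx //.
- by rewrite sym => _; exact: sv.
- by move=> _; exact: sv.
- exact: h.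
Qed.

Lemma cliquesnU1 V k (s : {set T}) v : v \notin s ->
  (v |: s \in cliquesn V k.+1) = (s \in cliquesn V k) && (v \in ext V s).
Proof.
move=> vs; rewrite ![_ \in cliquesn _ _]inE ![_ \in cliques _]inE in_ext subUset sub1set cliqueU1 // cardsU1 vs eqSS.
by case: (v \in V); case: (s \subset V); case: (clique s); rewrite ?andbF ?andbT //= andbC.
Qed.

(** A clique with a marked vertex is a smaller clique with a vertex that extends it;
    all double counts over cliques go through this bijection. *)
Lemma sum_marked_cliques (R : nmodType) V k (g : {set T} -> T -> R) :
  \sum_(P in cliquesn V k) \sum_(v in ext V P) g P v =
  \sum_(A in cliquesn V k.+1) \sum_(a in A) g (A :\ a) a.
Proof.
rewrite pair_big_dep [RHS]pair_big_dep /=.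
rewrite [RHS](reindex_onto (fun p : {set T} * T => (p.2 |: p.1, p.2))
  (fun p => (p.1 :\ p.2, p.2))) /=; last first.
  by move=> [A a] /= /andP[_ aA]; rewrite setD1K.
apply/eq_big => [[P v] /=|[P v] /=].
  rewrite setU11 andbT; case: (boolP (v \in P)) => vP.
    rewrite (negbTE (contraL (@ext_notin V P v) vP)) andbF; apply/esym/negbTE.
    rewrite negb_and; apply/orP; right; apply/eqP => -[/setP/(_ v)].
    by rewrite !inE eqxx vP.
  by rewrite cliquesnU1 // setU1K // eqxx andbT.
by case/andP=> _ /ext_notin vP; rewrite setU1K.
Qed.

Lemma sum_ext_card V k : (\sum_(P in cliquesn V k) #|ext V P| = k.+1 * #|cliquesn V k.+1|)%N.
Proof.
transitivity (\sum_(P in cliquesn V k) \sum_(v in ext V P) 1)%N.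
  by apply: eq_bigr => P _; rewrite sum1_card.
rewrite (sum_marked_cliques (R := nat)) (eq_bigr (fun=> k.+1)) ?sum_nat_const ?(mulnC k.+1) //.
by move=> A /cliquesnP[_ _ cA]; rewrite sum1_card.
Qed.

Lemma card_cliquesn_le V k : (#|cliquesn V k| <= #|V| ^ k)%N.
Proof.
elim: k => [|k IH]; first by rewrite expn0 cliquesn0 cards1.
rewrite -(leq_pmul2l (ltn0Sn k)) -sum_ext_card.
apply: (@leq_trans (\sum_(P in cliquesn V k) #|V|)%N).
  by apply: leq_sum => P _; apply/subset_leq_card/ext_sub.
rewrite sum_nat_const mulnC expnS; apply: leq_trans (leq_pmull _ _) => //.
by rewrite leq_mul2l IH orbT.
Qed.

End Cliques.

Section FacePolynomial.
Variables (T : finType) (R : nzRingType).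

(** The [f]-polynomial, indexed by cardinality: the coefficient of ['X^k] counts the faces
    of dimension [k - 1]. *)
Definition fpoly (K : {set {set T}}) : {poly R} := \sum_(s in K) 'X^#|s|.

Lemma coef_fpoly K k : (fpoly K)`_k = #|[set s in K | #|s| == k]|%:R.
Proof.
rewrite coef_sum (eq_bigr (fun s : {set T} => (#|s| == k)%:R)) => [|s _]; last first.
  by rewrite coefXn eq_sym.
rewrite -natr_sum -big_mkcondr /= sum1_card; congr _%:R.
by apply: eq_card => s; rewrite !inE.
Qed.

End FacePolynomial.

(** Expanding the product of [1 + 'X] over the elements of [t]. *)
Lemma sum_subsets (T : finType) (R : comNzRingType) (t : {set T}) :
  \sum_(u : {set T} | u \subset t) ('X : {poly R}) ^+ #|u| = ('X + 1) ^+ #|t|.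
Proof.
have := @bigA_distr _ 0 1 *%R +%R T
  (fun i => if i \in t then 'X else 0 : {poly R}) (fun=> 1).
rewrite (bigID (mem t)) /= [X in _ * X]big1 ?mulr1; last first.
  by move=> i /negbTE ->; rewrite add0r.
rewrite (eq_bigr (fun=> 'X + 1)) => [|i ->] //; rewrite prodr_const => ->.
rewrite [RHS](bigID (fun u : {set T} => u \subset t)) /= [X in _ + X]big1 ?addr0.
  apply: eq_big => [u|u ut] //.
  rewrite (bigID (mem u)) /= [X in _ * X]big1 ?mulr1; last by move=> i /negbTE ->.
  rewrite (eq_bigr (fun=> 'X)) ?prodr_const // => i iu.
  by rewrite iu (subsetP ut).
move=> u /subsetPn[x xu xt].
by rewrite (bigD1 x) //= xu (negbTE xt) mul0r.
Qed.

(** * Polynomials antisymmetric about -1/2 *)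

Section Antisymmetric.
Variable F : realFieldType.
Implicit Types p q : {poly F}.

(** The substitution [x -> -1 - x], the reflection about [-1/2] under which the face
    polynomial of an even-dimensional homology sphere changes sign. *)
Definition reflected p := p \Po (- 'X - 1).

(** An antisymmetric polynomial takes opposite values at 0 and -1. Subtracting a multiple
    of [1 + 2 X] makes both vanish, and the cofactor of [X (X + 1)] is antisymmetric
    again. *)
Lemma reflected_antisym_factor r p : (size p <= r.+1.*2)%N -> reflected p = - p ->
  exists q, [/\ (size q <= r.*2)%N, reflected q = - q &
     p = q * ('X + 1) * 'X + p`_0 *: (1 + 'X *+ 2)].
Proof.
move=> sp ap; set l := 1 + 'X *+ 2 : {poly F}.
have ap1 : p.[-1] = - p.[0].
  by have /(congr1 (horner^~ 0)) := ap; rewrite horner_comp !hornerE oppr0 add0r.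
have lE x : l.[x] = 1 + x *+ 2.
  by rewrite /l hornerD hornerMn hornerX -polyC1 hornerC.
pose p1 := p - p`_0 *: l.
have root0 : root p1 0.
  by apply/rootP; rewrite /p1 hornerD hornerN hornerZ lE horner_coef0; ring.
have [q0 p1q0] := factor_theorem _ _ root0.
have root1 : root q0 (-1).
  have : p1.[-1] = 0 by rewrite /p1 hornerD hornerN hornerZ lE ap1 horner_coef0; ring.
  by rewrite p1q0 hornerM hornerXsubC subr0 => /eqP; rewrite mulf_eq0 oppr_eq0 oner_eq0 orbF.
have [q q0q] := factor_theorem _ _ root1.
have p1E : p1 = q * ('X + 1) * 'X by rewrite p1q0 q0q !polyCN polyC1 opprK subr0.
exists q; split; last by rewrite -p1E /p1 subrK.
- have [->|qn0] := eqVneq q 0; first by rewrite size_poly0.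
  have : (size p1 <= r.+1.*2)%N.
    rewrite (leq_trans (size_polyD _ _)) // geq_max sp size_polyN.
    rewrite (leq_trans (size_scale_leq _ _)) // (leq_trans (size_polyD _ _)) //.
    rewrite size_poly1 geq_max /= -scaler_nat (leq_trans (size_scale_leq _ _)) ?size_polyX //.
  rewrite p1E size_mulX; last by rewrite mulf_neq0 // -polyC1 -size_poly_eq0 size_XaddC.
  by rewrite -polyC1 size_Mmonic ?monicXaddC // size_XaddC addn2 /= doubleS.
- have ap1' : reflected p1 = - p1.
    rewrite /reflected rmorphB /= linearZ /= -/(reflected p) ap.
    rewrite rmorphD /= rmorph1 rmorphMn /= comp_polyX.
    rewrite /p1 /l opprB -!mul_polyC; ring.
  have : reflected q * (('X + 1) * 'X) = - q * (('X + 1) * 'X).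
    rewrite mulNr [q * _]mulrA -p1E -ap1' p1E /reflected !rmorphM rmorphD /= rmorph1 comp_polyX.
    ring.
  apply: mulIf; rewrite mulf_neq0 ?polyX_eq0 //.
  by rewrite -polyC1 -size_poly_eq0 size_XaddC.
Qed.

(** A weak form of the Dehn-Sommerville equations: antisymmetry lets the lower half
    of the coefficients bound all of them, with a constant that depends on the degree
    only. *)
Lemma reflected_antisym_bound r : exists C : nat, forall p (B : F),
  (size p <= r.*2)%N -> reflected p = - p ->
  (forall i, (i < r)%N -> `|p`_i| <= B) -> forall i, `|p`_i| <= C%:R * B.
Proof.
elim: r => [|r [C IH]].
  exists 0%N => p B; rewrite leqn0 size_poly_eq0 => /eqP-> _ _ i.
  by rewrite coef0 normr0 mul0r.
exists (6 * C * r + 2)%N => p B sp ap pB.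
have [q [sq aq pE]] := reflected_antisym_factor sp ap.
have B0 : 0 <= B by rewrite (le_trans _ (pB 0%N _)).
have lB i : `|(p`_0 *: (1 + 'X *+ 2 : {poly F}))`_i| <= 2 * B.
  rewrite coefZ normrM coefD coef1 coefMn coefX.
  have := pB 0%N isT; set a := `|_| => aB.
  have a0 : 0 <= a by exact: normr_ge0.
  case: i => [|[|i]] /=; rewrite ?mul0rn ?addr0 ?add0r ?normr1 ?normr0 ?mulr1 ?mulr0; try lra.
  rewrite normr_nat; lra.
have p1B i : (i < r.+1)%N -> `|(q * ('X + 1) * 'X)`_i| <= 3 * B.
  move=> ir; have -> : q * ('X + 1) * 'X = p - p`_0 *: (1 + 'X *+ 2) by rewrite {1}pE addrK.
  rewrite coefB (le_trans (ler_normB _ _)) //.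
  have := pB i ir; have := lB i; lra.
(* reading the coefficients of q off those of q (X + 1) X from the bottom up *)
have qi i : (q * ('X + 1) * 'X)`_i.+1 = q`_i + (q * 'X)`_i.
  by rewrite coefMX /= mulrDr mulr1 coefD addrC.
have qB i : (i < r)%N -> `|q`_i| <= 3 * B * r%:R.
  move=> ir; apply: (@le_trans _ _ (3 * B * i.+1%:R)); last first.
    by rewrite ler_wpM2l ?ler_nat // mulr_ge0.
  elim: i ir => [|i IHi] ir.
    have := p1B 1%N ir; rewrite qi coefMX /= addr0; lra.
  have := p1B i.+2 ir; rewrite qi coefMX /= => h1.
  have := IHi (ltnW ir) => h2.
  rewrite -[q`_i.+1](addrK q`_i) (le_trans (ler_normB _ _)) // (natrD _ 1 i.+1).
  lra.
have qC i : `|q`_i| <= C%:R * (3 * B * r%:R) by apply: IH.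
move=> i; rewrite pE coefD (le_trans (ler_normD _ _)) //.
apply: (@le_trans _ _ (2 * (C%:R * (3 * B * r%:R)) + 2 * B)); last first.
  rewrite natrD !natrM; lra.
apply: lerD (lB i); case: i => [|i].
  rewrite coefMX normr0 !mulr_ge0 //.
rewrite qi coefMX (le_trans (ler_normD _ _)) // mulr_natl mulr2n lerD ?qC //.
by case: i => [|i] /=; rewrite ?normr0 ?qC // !mulr_ge0.
Qed.

End Antisymmetric.

(** * The graph of a flag homology manifold *)

Definition edge (T : finType) (M : {set {set T}}) : rel T :=
  [rel u v | (u != v) && ([set u; v] \in M)].

Section FlagManifold.
Variables (T : finType) (M : complex T) (r : nat).
Hypothesis flagM : flag M.
Hypothesis manifoldM : homology_manifold M.
Hypothesis dimM : complex_dim M = r.*2%:Z - 1.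

Notation e := (edge M).
Notation V := (vertices M).

Lemma edge_irr : irreflexive e.
Proof. by move=> u; rewrite /edge /= eqxx. Qed.

Lemma edge_sym : symmetric e.
Proof. by move=> u v; rewrite /edge /= eq_sym setUC. Qed.

Lemma flag_cliques : faces M = cliques e V.
Proof.
apply/setP => s; rewrite inE; apply/idP/andP => [sM|[sV /cliqueP sC]].
  split; first by apply/subsetP => v vs; rewrite inE (complexS _ sM) // sub1set.
  apply/cliqueP => u v us vs uv; rewrite /edge /= uv (complexS _ sM) //.
  by rewrite subUset !sub1set us.
by apply: flagM => // u v us vs uv; have /andP[] := sC u v us vs uv.
Qed.

Lemma cliquesn_face k s : s \in cliquesn e V k -> s \in faces M.
Proof. by rewrite inE -flag_cliques => /andP[]. Qed.

Lemma cliquesn_n0 k s : s \in cliquesn e V k.+1 -> s != set0.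
Proof. by case/cliquesnP => _ _ sk; rewrite -cards_eq0 sk. Qed.

Lemma ext_link k s v : s \in cliquesn e V k.+1 ->
  (v \in ext e V s) = ([set v] \in link M s).
Proof.
move=> sC; rewrite [RHS]inE.
apply/idP/and3P => [vs|[vM vs vsM]].
  have vsC : v |: s \in cliquesn e V k.+2.
    by rewrite (cliquesnU1 edge_sym) ?sC // (ext_notin edge_irr vs).
  split; last exact: cliquesn_face vsC.
    by apply: complexS (cliquesn_face vsC); rewrite subsetUl.
  by rewrite setI_eq0 disjoints1 (ext_notin edge_irr vs).
rewrite setI_eq0 disjoints1 in vs.
have : v |: s \in cliquesn e V k.+2.
  by have /cliquesnP[_ _ sk] := sC; rewrite inE -flag_cliques vsM cardsU1 vs sk /= add1n.
by rewrite (cliquesnU1 edge_sym) // sC.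
Qed.

Lemma card_clique_max k s : s \in cliquesn e V k -> (k <= r.*2)%N.
Proof. by move=> sC; have /cliquesnP[_ _ <-] := sC; apply: face_card dimM _ (cliquesn_face sC). Qed.

Lemma clique_pure k s : s \in cliquesn e V k.+1 ->
  exists2 t, t \in cliquesn e V r.*2 & s \subset t.
Proof.
move=> sC; have [t tM [st tr]] := face_pure manifoldM dimM (cliquesn_face sC) (cliquesn_n0 sC).
by exists t => //; rewrite inE -flag_cliques tM tr eqxx.
Qed.

(** The link of a face of codimension 1 has only vertices, and the Euler characteristic
    of the 0-sphere counts two of them. *)
Lemma card_ext_ridge k s : (k.+2 = r.*2)%N -> s \in cliquesn e V k.+1 -> #|ext e V s| = 2%N.
Proof.
move=> kr sC; have /cliquesnP[_ _ sk] := sC.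
have := link_euler manifoldM dimM (cliquesn_face sC) (cliquesn_n0 sC).
rewrite sk -kr subSn // subnn expr1 (bigD1 set0) /=; last exact: link0 (cliquesn_face sC).
rewrite cards0 expr0 (eq_bigr (fun=> -1)) ?sumr_const => [h|t /andP[]]; last first.
  rewrite inE => /and3P[_ /eqP ts tsM]; rewrite -card_gt0 => t0.
  have := face_card dimM tsM; rewrite cardsU ts cards0 sk => tk.
  by have -> : #|t| = 1%N by lia.
suff <- : #|[set t in link M s | t != set0]| = #|ext e V s|.
  by rewrite cardsE; move: h; rewrite mulNrn; set n := #|_|; lia.
rewrite -(card_imset (mem (ext e V s)) set1_inj).
apply: eq_card => t; rewrite inE; apply/andP/imsetP => [[tL t0]|[v vs ->]]; last first.
  by rewrite -(ext_link _ sC) vs -cards_eq0 cards1.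
have : #|t| == 1%N.
  move: (tL) t0; rewrite inE => /and3P[_ /eqP ts tsM]; rewrite -card_gt0 => t0.
  have := face_card dimM tsM; rewrite cardsU ts cards0 sk; lia.
by case/cards1P => v tv; exists v => //; rewrite (ext_link _ sC) -tv.
Qed.

(** The link of a face of codimension 2 is a connected graph. *)
Lemma ext_connected k s (S : {set T}) : (k.+3 = r.*2)%N -> s \in cliquesn e V k.+1 ->
  S \subset ext e V s -> S != set0 ->
  (forall u v, u \in S -> v \in ext e V s -> e u v -> v \in S) -> S = ext e V s.
Proof.
move=> kr sC SE /set0Pn[u uS] cl; apply/eqP; rewrite eqEsubset SE /=; apply/subsetP => v vE.
have /cliquesnP[_ _ sk] := sC.
apply: (link_connected manifoldM dimM (cliquesn_face sC) (cliquesn_n0 sC) _ _ (u := u)) => //.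
- by rewrite sk addn2.
- move=> x y xS xyL; have [<-//|xy] := eqVneq x y.
  have yE : y \in ext e V s.
    by rewrite (ext_link _ sC); apply: linkS xyL; rewrite subsetUr.
  by apply: cl xS yE _; rewrite /edge /= xy; move: xyL; rewrite inE => /and3P[].
- by rewrite -(ext_link _ sC) (subsetP SE).
- by rewrite -(ext_link _ sC).
Qed.

Lemma link_vertex w : w \in V -> link M [set w] = cliques e (ext e V [set w]).
Proof.
move=> wV; apply/setP => t; rewrite [LHS]inE [RHS]inE.
have wC : [set w] \in cliquesn e V 1.
  by apply/cliquesnP; rewrite sub1set wV cards1 clique1.
apply/and3P/andP => [[tM tw twM]|[/subsetP tE tC]].
  have tL : t \in link M [set w] by rewrite inE tM tw.
  have : t \in cliques e V by rewrite -flag_cliques.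
  rewrite inE => /andP[_ tC]; split=> //.
  apply/subsetP => v vt; rewrite (ext_link _ wC); apply: linkS tL.
  by rewrite sub1set.
have wt : w \notin t.
  by apply/negP => /tE /(ext_notin edge_irr); rewrite inE eqxx.
have : w |: t \in faces M.
  rewrite {1}flag_cliques inE subUset sub1set wV (cliqueU1 edge_sym) // tC /=.
  apply/andP; split; first by apply/subsetP => v /tE /extP[].
  apply/forall_inP => v /tE /extP[_ /(_ w)]; rewrite inE eqxx => /(_ isT).
  by rewrite edge_sym.
move=> wtM; split; first by apply: complexS wtM; rewrite subsetUr.
  by rewrite setIC setI_eq0 disjoints1.
by rewrite setUC.
Qed.

(** The Euler relation at [w |: u] in [M], rewritten inside the link of [w]. *)
Lemma vertex_link_euler w u : w \in V -> u \in link M [set w] ->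
  \sum_(t in link M [set w] | u \subset t) (-1) ^+ #|t| = -1 :> int.
Proof.
move=> wV uL; have wM : [set w] \in faces M by rewrite inE in wV.
have /and3P[_ uw uwM] : [&& u \in faces M, u :&: [set w] == set0 & u :|: [set w] \in faces M].
  by move: uL; rewrite inE.
have wu : w \notin u by move: uw; rewrite setIC setI_eq0 disjoints1.
have uw0 : u :|: [set w] != set0 by apply/set0Pn; exists w; rewrite !inE eqxx orbT.
have := face_euler manifoldM dimM uwM uw0.
rewrite -mul2n exprM sqrrN expr1n => E; rewrite -[RHS](congr1 -%R E).
rewrite [in RHS](eq_bigl (fun t : {set T} => (t \in faces M) && ([set w] \subset t) && (u \subset t))); last first.
  by move=> t; rewrite subUset -andbA; congr andb; rewrite andbC.
rewrite [in RHS]big_mkcondr /= sum_link -big_mkcondr /= -sumrN.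
apply: eq_big => [t|t /andP[tL ut]].
  rewrite setUC; congr andb; apply/idP/idP => [ut|/subsetP ut].
    by rewrite subsetU // ut orbT.
  apply/subsetP => x xu; have := ut x xu; rewrite !inE => /predU1P[xw|//].
  by rewrite -xw xu in wu.
move: tL; rewrite inE => /and3P[_ /eqP tw _].
by rewrite cardsU tw cards0 subn0 cards1 addn1 exprS mulN1r opprK.
Qed.

End FlagManifold.

(** The link of a vertex is a homology sphere of even dimension, and the Euler relations
    of its faces are the Dehn-Sommerville equations: substituting [-1 - X] expands
    each face into its subsets, and the Euler relation of the link evaluates the sum over
    the faces above each subset. *)
Lemma fpoly_vertex_link (R : realFieldType) (T : finType) (M : complex T) (r : nat) (w : T) :
  homology_manifold M -> complex_dim M = r.*2%:Z - 1 -> w \in vertices M ->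
  reflected (fpoly R (link M [set w])) = - fpoly R (link M [set w]).
Proof.
move=> mM dM wV; rewrite /reflected /fpoly rmorph_sum /=.
transitivity (\sum_(t in link M [set w]) \sum_(u in link M [set w] | u \subset t)
   (-1) ^+ #|t| * ('X : {poly R}) ^+ #|u|).
  apply: eq_bigr => t tL; rewrite comp_Xn_poly -opprD [LHS]exprNn -sum_subsets mulr_sumr.
  apply: eq_bigl => u; apply/idP/andP => [ut|[]//]; split=> //; exact: linkS tL.
rewrite (exchange_big_dep (mem (link M [set w]))) /=; last by move=> t u _ /andP[].
rewrite -sumrN; apply: eq_bigr => u uL; rewrite -mulr_suml -[RHS]mulN1r; congr (_ * _).
have := congr1 (fun z : int => z%:~R : {poly R}) (vertex_link_euler mM dM wV uL).
rewrite rmorph_sum /= rmorphN1 => E; rewrite -[RHS]E; apply: eq_big => [t|t _]; first by rewrite uL.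
by rewrite rmorphXn /= rmorphN1.
Qed.

(** The link of a vertex has trivially at most [n ^ i] faces with [i] elements, which
    is enough for [i < r]; antisymmetry carries the bound over to the larger faces,
    where the trivial bound is far too weak. *)
Lemma vertex_link_bound r : (0 < r)%N -> exists C : nat,
  forall (T : finType) (M : complex T) (w : T), flag M ->
  homology_manifold M -> complex_dim M = r.*2%:Z - 1 -> w \in vertices M ->
  forall k : nat, (#|cliquesn (edge M) (ext (edge M) (vertices M) [set w]) k|
     <= C * #|vertices M| ^ r.-1)%N.
Proof.
move=> r0; have [C bound] := reflected_antisym_bound rat r.
exists C => T M w fM mM dM wV k; set L := cliquesn _ _.
have nL i : (fpoly rat (link M [set w]))`_i = #|L i|%:R.
  rewrite coef_fpoly (link_vertex fM wV); congr _%:R.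
have n0 : (0 < #|vertices M|)%N by apply/card_gt0P; exists w.
rewrite -(ler_nat rat) natrM -[X in X <= _]ger0_norm ?ler0n // -nL.
apply: bound.
- rewrite /fpoly; apply: (big_ind (fun p : {poly rat} => size p <= r.*2)%N).
  + by rewrite size_poly0.
  + by move=> p q sp sq; rewrite (leq_trans (size_polyD _ _)) // geq_max sp.
  move=> t; rewrite inE => /and3P[_ /eqP tw twM]; rewrite size_polyXn.
  have := face_card dM twM; rewrite cardsU tw cards0 subn0 cards1; lia.
- exact: (fpoly_vertex_link rat mM dM wV).
move=> i ir; rewrite nL ger0_norm ?ler0n // ler_nat.
apply: leq_trans (card_cliquesn_le (@edge_irr _ _) (@edge_sym _ _) _ _) _.
apply: (@leq_trans (#|vertices M| ^ i)%N).
  by case: (i) => [//|i']; rewrite leq_exp2r // subset_leq_card ?ext_sub.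
by rewrite leq_pexp2l //; lia.
Qed.

(** * The Moon-Moser inequality and its stability *)

Section MoonMoser.
Variables (T : finType) (e : rel T) (V : {set T}).
Hypothesis irr : irreflexive e.
Hypothesis sym : symmetric e.

Notation ext := (ext e V).
Notation cliquesn := (cliquesn e V).

(** For nonempty [A], the vertices nonadjacent to at least two elements of [A]. *)
Definition junk (A : {set T}) : {set T} :=
  [set v in V | [forall a in A, v \notin ext (A :\ a)]].

Lemma ext_del2 (A : {set T}) a b v : a \in A -> b \in A -> a != b ->
  v \in ext (A :\ a) -> v \in ext (A :\ b) -> v \in ext A.
Proof.
move=> aA bA ab /extP[vV va] /extP[_ vb]; apply/extP; split=> // u uA.
have [->|ua] := eqVneq u a; first by apply: vb; rewrite !inE ab.
by apply: va; rewrite !inE ua.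
Qed.

(** A vertex extends none of the cliques [A :\ a], exactly one of them, or, if it extends
    [A], all of them. *)
Lemma sum_ext_junk k A : A \in cliquesn k.+1 ->
  (\sum_(a in A) #|ext (A :\ a)| + #|junk A| = #|V| + k * #|ext A|)%N.
Proof.
case/cliquesnP=> AV AC Ak.
have cnt (S : {set T}) : S \subset V -> #|S| = (\sum_(v in V) (v \in S))%N.
  move=> SV; rewrite -sum1_card big_mkcond [RHS]big_mkcond /=.
  apply: eq_bigr => v _; case: (boolP (v \in S)) => [/(subsetP SV)->//|_].
  by case: ifP.
have jV : junk A \subset V by apply/subsetP => v; rewrite inE => /andP[].
rewrite (cnt _ jV) (cnt (ext A)) ?ext_sub // (eq_bigr _ (fun a _ => cnt _ (ext_sub e V _))).
rewrite exchange_big /= -sum1_card big_distrr /= -!big_split /=.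
apply: eq_bigr => v vV; rewrite [v \in junk A]inE vV /=.
have [vE|vE] := boolP (v \in ext A).
  rewrite (eq_bigr (fun=> 1%N)) => [|a _]; last first.
    by rewrite (subsetP (ext_anti _ _ (subsetDl _ _)) _ vE).
  rewrite sum1_card Ak muln1.
  have /card_gt0P[a aA] : (0 < #|A|)%N by rewrite Ak.
  have -> : [forall a in A, v \notin ext (A :\ a)] = false.
    apply/negbTE/forall_inPn; exists a => //.
    by rewrite negbK (subsetP (ext_anti _ _ (subsetDl _ _)) _ vE).
  by rewrite addn0 add1n.
rewrite muln0 addn0; have [vj|] := boolP [forall a in A, v \notin ext (A :\ a)].
  by rewrite big1 // => a aA; rewrite (negbTE (forall_inP vj a aA)).
case/forall_inPn => a aA; rewrite negbK => va.
rewrite (bigD1 a) //= va big1 ?addn0 // => b /andP[bA ba].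
rewrite eq_sym in ba; apply/eqP; rewrite eqb0; apply: (contra _ vE) => vb.
exact: ext_del2 aA bA ba va vb.
Qed.

(** The exact form of the Moon-Moser inequality: keeping the number of junk vertices
    turns near-equality into structure. *)
Lemma sum_ext_sqr k :
  (\sum_(P in cliquesn k) #|ext P| ^ 2 + \sum_(A in cliquesn k.+1) #|junk A|
   = #|V| * #|cliquesn k.+1| + k * (k.+2 * #|cliquesn k.+2|))%N.
Proof.
have -> : (\sum_(P in cliquesn k) #|ext P| ^ 2 =
   \sum_(A in cliquesn k.+1) \sum_(a in A) #|ext (A :\ a)|)%N.
  rewrite -(sum_marked_cliques (R := nat) irr sym _ _ (fun P _ => #|ext P|)).
  by apply: eq_bigr => P _; rewrite sum_nat_const mulnn.
rewrite -big_split -sum_ext_card //= big_distrr /= mulnC -sum_nat_const -big_split /=.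
by apply: eq_bigr => A /sum_ext_junk ->.
Qed.

End MoonMoser.

Section CliqueGrowth.
Variable R : realFieldType.

Lemma cauchy_schwarz1 (I : finType) (S : {pred I}) (f : I -> R) :
  (\sum_(i in S) f i) ^+ 2 <= #|S|%:R * \sum_(i in S) f i ^+ 2.
Proof.
set s := \sum_(i in S) f i; set q := \sum_(i in S) f i ^+ 2; set m : R := #|S|%:R.
have m0 : 0 <= m by exact: ler0n.
have : 0 <= \sum_(i in S) (m * f i - s) ^+ 2 by apply: sumr_ge0 => i _; exact: sqr_ge0.
have -> : \sum_(i in S) (m * f i - s) ^+ 2 = m * (m * q - s ^+ 2).
  rewrite (eq_bigr (fun i => m ^+ 2 * f i ^+ 2 - 2 * m * s * f i + s ^+ 2)); last first.
    by move=> i _; ring.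
  rewrite big_split sumrB /= -!mulr_sumr sumr_const -/s -/q -[_ *+ #|S|]mulr_natr -/m; ring.
have [m00 _|mn0] := eqVneq m 0.
  have S0 : #|S| = 0%N by apply/eqP; rewrite -(pnatr_eq0 R) -/m m00.
  by rewrite /s big1 ?expr0n ?m00 ?mul0r //= => i iS; rewrite (card0_eq S0) in iS.
by rewrite pmulr_rge0 ?subr_ge0 // lt_neqAle eq_sym mn0.
Qed.

(** [K s] stands for the number of cliques with [s] vertices in a graph with [n]
    vertices. *)
Definition moon_moser (n : R) (K : nat -> R) := forall s,
  s.+1%:R ^+ 2 * K s.+1 ^+ 2 <= K s * (n * K s.+1 + s%:R * (s.+2%:R * K s.+2)).

Lemma moon_moser_cliques (T : finType) (e : rel T) (V : {set T}) :
  irreflexive e -> symmetric e -> moon_moser #|V|%:R (fun s => #|cliquesn e V s|%:R).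
Proof.
move=> irr sym s; have := cauchy_schwarz1 (mem (cliquesn e V s)) (fun P => #|ext e V P|%:R).
rewrite -natr_sum sum_ext_card // natrM exprMn => h; apply: (le_trans h).
rewrite ler_wpM2l ?ler0n //; under eq_bigr do rewrite -natrX.
rewrite -natr_sum -!natrM -natrD ler_nat -sum_ext_sqr //.
by rewrite leq_addr.
Qed.

(** Let [x s] be the average number of vertices that extend an [s]-clique and [d s] its
    excess over the value in the Turan graph with [r] parts. The Moon-Moser
    inequality reads [(s + 1) d s <= s d (s + 1)]. A negative excess at [l] passes down
    to smaller cliques, whose numbers then stay below their Turan values; with [d l]
    far below 0 there would be too few [l.+1]-cliques. So [d l] is bounded from below,
    and the inequality passes this bound up to [r]: the number of cliques keeps
    growing by a factor of order [n] in each step, and [r.-1]-cliques extend in almost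
    [n / r] ways on average. *)
Lemma moon_moser_stability (r l : nat) (C : R) : (0 < l < r)%N -> 0 <= C ->
  exists c0 C2 n0 : R, 0 < c0 /\ forall (n : R) (K : nat -> R), n0 <= n ->
  moon_moser n K -> (forall s, 0 <= K s) -> (forall s, K s.+1 <= n * K s) ->
  K 0%N = 1 -> K 1%N = n ->
  'C(r, l.+1)%:R * (n / r%:R) ^+ l.+1 - C * n ^+ l <= K l.+1 ->
  c0 * n ^+ r <= K r /\ (n - C2) * K r.-1 <= r%:R ^+ 2 * K r.
Proof.
move=> /andP[l0 lr] C0; have r0 : 0 < r%:R :> R by rewrite ltr0n; lia.
pose C' := l.+1%:R * C * r%:R ^+ l + 1.
exists (2^-1 * (2 * r%:R ^+ 2)^-1 ^+ r), (C' * r%:R ^+ 2),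
  (1 + 2 * r%:R ^+ 2 * C' + 2 * C * r%:R ^+ l.+1).
split; first by rewrite mulr_gt0 ?exprn_gt0 ?invr_gt0 ?mulr_gt0 ?exprn_gt0 //; lra.
move=> n K n0 mm K0 Kn K00 K1 Kl.
have C'1 : 1 <= C'.
  by rewrite ler_wpDl // ?mulr_ge0 ?exprn_ge0 ?ler0n.
have t1 : 0 <= 2 * r%:R ^+ 2 * C' by rewrite !mulr_ge0 ?exprn_ge0 ?ler0n //; lra.
have t2 : 0 <= 2 * C * r%:R ^+ l.+1 by rewrite !mulr_ge0 ?exprn_ge0 ?ler0n.
have n1 : 1 <= n by lra.
set N := n / r%:R in Kl *; have nE : n = r%:R * N by rewrite mulrC divfK // gt_eqF.
have N0 : 0 < N by rewrite divr_gt0 //; lra.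
have Klow : 2^-1 * N ^+ l.+1 <= K l.+1.
  apply: le_trans Kl.
  have : C * n ^+ l <= 2^-1 * N ^+ l.+1.
    rewrite nE exprMn exprS.
    have : C * r%:R ^+ l <= 2^-1 * N.
      rewrite /N mulrA ler_pdivlMr //; move: n0 t2; rewrite (exprS _ l); lra.
    move=> h; have := ler_wpM2r (exprn_ge0 l (ltW N0)) h; lra.
  have : N ^+ l.+1 <= 'C(r, l.+1)%:R * N ^+ l.+1.
    by rewrite ler_peMl ?(exprn_ge0 _ (ltW N0)) // ler1n bin_gt0.
  lra.
have Kpos s : (s <= l.+1)%N -> 0 < K s.
  move=> sl; rewrite lt_neqAle K0 andbT eq_sym; apply/eqP => Ks.
  have Kl0 : 0 < K l.+1 by apply: lt_le_trans Klow; rewrite mulr_gt0 ?exprn_gt0 //; lra.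
  have Kt t : K (s + t)%N <= 0.
    elim: t => [|t IH]; first by rewrite addn0 Ks.
    rewrite addnS (le_trans (Kn _)) // pmulr_rle0 //; lra.
  by have := Kt (l.+1 - s)%N; rewrite subnKC // leNgt Kl0.
pose x s := s.+1%:R * K s.+1 / K s.
pose d s := x s - (r%:R - s%:R) * N.
have xE s : 0 < K s -> s.+1%:R * K s.+1 = x s * K s.
  by move=> Ks; rewrite divfK // gt_eqF.
have mmd s : 0 < K s -> 0 < K s.+1 -> s.+1%:R * d s <= s%:R * d s.+1.
  move=> Ks Ks1; suff : s.+1%:R * x s <= n + s%:R * x s.+1.
    rewrite /d nE -(natr1 s); lra.
  have Kss : 0 < K s * K s.+1 by rewrite mulr_gt0.
  rewrite -(ler_pM2r Kss); have := mm s.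
  rewrite [X in _ <= X -> _](_ : _ = (n + s%:R * x s.+1) * (K s * K s.+1)); last first.
    by rewrite xE //; ring.
  apply: le_trans; rewrite -exprMn xE //.
  rewrite [X in X <= _](_ : _ = x s * K s * (s.+1%:R * K s.+1)); last by ring.
  by rewrite xE // -expr2.
(* the excess cannot be far below 0 at l *)
have dl : - (C' * l%:R) <= d l.
  rewrite leNgt; apply/negP => dl.
  have l1 : 1 <= l%:R :> R by rewrite ler1n.
  have dl' : d l < - C' by apply: lt_le_trans dl _; rewrite lerN2 ler_peMr //; lra.
  have dneg t : (t <= l)%N -> d (l - t)%N <= 0.
    elim: t => [|t IH] tl; first by rewrite subn0; lra.
    have := IH (ltnW tl); have := mmd (l - t.+1)%N (Kpos _ _) (Kpos _ _).
    rewrite (_ : (l - t.+1).+1 = (l - t)%N); last by clear -tl; lia.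
    have lt1 : (l - t.+1 <= l.+1)%N by clear -tl; lia.
    have lt2 : (l - t <= l.+1)%N by clear -tl; lia.
    move=> /(_ lt1 lt2) h1 h2.
    rewrite -(pmulr_rle0 _ (_ : 0 < (l - t)%:R)) ?ltr0n; last by clear -tl; lia.
    by apply: le_trans h1 _; rewrite mulr_ge0_le0.
  have xle t : (t <= l)%N -> x t <= (r%:R - t%:R) * N.
    by move=> tl; have := dneg (l - t)%N (leq_subr _ _); rewrite subKn // /d subr_le0.
  have Kup t : (t <= l)%N -> K t <= 'C(r, t)%:R * N ^+ t.
    elim: t => [|t IH] tl; first by rewrite bin0 mul1r expr0 K00.
    rewrite -(ler_pM2l (_ : 0 < t.+1%:R)) ?ltr0n // xE ?Kpos //; last by clear -tl; lia.
    apply: (@le_trans _ _ ((r%:R - t%:R) * N * ('C(r, t)%:R * N ^+ t))).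
      apply: ler_pM => //; last by apply: IH; clear -tl; lia.
        by rewrite mulr_ge0 ?invr_ge0 // mulr_ge0.
      by apply: xle; clear -tl; lia.
    rewrite exprS [X in _ <= X]mulrA -natrM mul_bin_left natrM natrB; last by clear -tl lr; lia.
    by rewrite le_eqVlt; apply/orP; left; apply/eqP; ring.
  have := ler_wpM2l (ler0n R l.+1) Kl.
  rewrite mulrBr mulrA -natrM mul_bin_left natrM natrB ?xE ?Kpos //; last by clear -lr; lia.
  set a := 'C(r, l)%:R * N ^+ l => h.
  have xl : x l <= (r%:R - l%:R) * N - C'.
    have := dl'; rewrite /d; lra.
  have : x l * K l <= ((r%:R - l%:R) * N - C') * a.
    apply: ler_pM => //; last by apply: Kup.
    by rewrite mulr_ge0 ?invr_ge0 // mulr_ge0.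
  have aN : N ^+ l <= a.
    by rewrite ler_peMl ?(exprn_ge0 _ (ltW N0)) // ler1n bin_gt0; clear -lr; lia.
  have Npos : 0 < N ^+ l by rewrite exprn_gt0.
  have := ler_wpM2l (_ : 0 <= C') aN; rewrite (_ : 0 <= C') //; last by lra.
  move=> /(_ isT).
  have nl : n ^+ l = r%:R ^+ l * N ^+ l by rewrite {1}nE exprMn.
  pose c1 := l.+1%:R * C * r%:R ^+ l.
  have h' : (r%:R - l%:R) * N * a - c1 * N ^+ l <= x l * K l.
    by move: h; rewrite nl (exprS N) /c1 /a; lra.
  rewrite (_ : C' = c1 + 1) //; move: h' Npos; set y := N ^+ l.
  clearbody a c1 y; clear; move=> h1 h2 h3; lra.
(* the lower bound on the excess moves up from l to r *)
have step s : (l <= s)%N -> (s < r)%N ->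
   [/\ 0 < K s, - (C' * s%:R) <= d s & 2^-1 * (N / (2 * r%:R)) ^+ s.+1 <= K s.+1].
  elim: s => [|s IH] ls sr.
    by exfalso; clear -ls l0; lia.
  have [ls'|ls'] := ltnP l s.+1; last first.
    have -> : s.+1 = l by clear -ls ls'; lia.
    split=> //; first exact: Kpos.
    apply: le_trans Klow; rewrite ler_wpM2l ?invr_ge0 ?ler0n //.
    rewrite lerXn2r ?nnegrE ?(ltW N0) //; first by rewrite divr_ge0 ?(ltW N0) ?mulr_ge0 ?ler0n.
    by rewrite ler_pdivrMr ?mulr_gt0 // ler_peMr ?(ltW N0) // -natrM ler1n; clear -sr; lia.
  have [||Ks ds Ks1] := IH; [by []|by clear -sr; lia|].
  have Ks1p : 0 < K s.+1.
    apply: lt_le_trans Ks1; apply: mulr_gt0; first by rewrite invr_gt0.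
    by apply: exprn_gt0; apply: divr_gt0 => //; apply: mulr_gt0.
  have s0 : 0 < s%:R :> R by rewrite ltr0n; clear -ls' l0; lia.
  have dS : - (C' * s.+1%:R) <= d s.+1.
    rewrite -(ler_pM2l s0); apply: le_trans (mmd s Ks Ks1p).
    have := ler_wpM2l (ler0n R s.+1) ds; lra.
  split=> //.
  have sr' : s.+2%:R <= r%:R :> R by rewrite ler_nat; clear -sr; lia.
  have s1r : 1 <= r%:R - s.+1%:R :> R.
    by rewrite -natrB ?ler1n ?subn_gt0 //; exact: ltnW.
  have xlow : 2^-1 * N <= x s.+1.
    have : 2 * r%:R * C' <= N by rewrite -(ler_pM2l r0) -nE; lra.
    have : C' * s.+1%:R <= C' * r%:R.
      by rewrite ler_wpM2l ?ler_nat //; [lra|exact: ltnW].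
    have := ler_wpM2r (ltW N0) s1r; move: dS; rewrite /d; lra.
  have : 2^-1 * N * K s.+1 <= r%:R * K s.+2.
    apply: (@le_trans _ _ (s.+2%:R * K s.+2)); last by rewrite ler_wpM2r.
    by rewrite xE // ler_wpM2r.
  set q := N / (2 * r%:R) in Ks1 *.
  have q0 : 0 <= q by rewrite divr_ge0 ?(ltW N0) // mulr_ge0.
  have -> : 2^-1 * N = r%:R * q by rewrite /q; field; rewrite gt_eqF.
  rewrite -mulrA ler_pM2l //; apply: le_trans; rewrite exprS mulrCA ler_wpM2l //.
have [||Kr dr KrE] := step r.-1; [by clear -lr; lia|by clear -lr; lia|].
have rE : r.-1.+1 = r by clear -lr; lia.
rewrite rE in KrE; split.
  apply: le_trans KrE; rewrite -mulrA -exprMn (_ : _ * n = N / (2 * r%:R)) //.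
  by rewrite /N; field; rewrite gt_eqF.
have xr := xE _ Kr; rewrite rE in xr.
rewrite (_ : r%:R ^+ 2 * K r = r%:R * x r.-1 * K r.-1); last by rewrite expr2 -mulrA xr mulrA.
rewrite ler_wpM2r ?(ltW Kr) //.
have r1 : r.-1%:R = r%:R - 1 :> R by rewrite -{2}rE -natr1 addrK.
have : N - C' * r%:R <= x r.-1.
  move: dr; rewrite /d r1; lra.
move=> /(ler_wpM2l (ltW r0)); rewrite [in X in _ -> X]nE; lra.
Qed.

End CliqueGrowth.

(** * A typical clique *)

Lemma card_bigcup_le (I T : finType) (P : {pred I}) (F : I -> {set T}) :
  (#|\bigcup_(i in P) F i| <= \sum_(i in P) #|F i|)%N.
Proof.
apply: (big_ind2 (fun (A : {set T}) m => #|A| <= m)%N) => [|A m B p Am Bp|//].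
  by rewrite cards0.
by rewrite (leq_trans (leq_card_setU _ _)) // leq_add.
Qed.

Section Averages.
Variables (T : finType) (e : rel T) (V : {set T}).
Hypothesis irr : irreflexive e.
Hypothesis sym : symmetric e.

Notation ext := (ext e V).
Notation cliquesn := (cliquesn e V).
Notation junk := (junk e V).

(** The parts cut out by [A] are the sets [ext (A :\ a) :\: ext A]; these are the
    nonadjacent pairs of vertices from different parts. *)
Definition missing (A : {set T}) : {set T * T} :=
  [set p | [&& p.1 \notin ext A, p.2 \notin ext A, ~~ e p.1 p.2 &
     [exists a in A, [exists b in A,
        [&& a != b, p.1 \in ext (A :\ a) & p.2 \in ext (A :\ b)]]]]].

(** If [u] can replace [a] in [A] and misses [v] from another part, then [v] misses two
    elements of the clique [u |: A :\ a], so it is junk for that clique. *)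
Lemma card_missing A :
  (#|missing A| <= \sum_(a in A) \sum_(u in ext (A :\ a)) #|junk (u |: A :\ a)|)%N.
Proof.
pose W a u := [set (u, v) | v in junk (u |: A :\ a)].
apply: (@leq_trans #|\bigcup_(a in A) \bigcup_(u in ext (A :\ a)) W a u|).
  apply/subset_leq_card/subsetP => -[u v]; rewrite inE /=.
  case/and4P => uA vA uv /exists_inP[a aA /exists_inP[b bA /and3P[ab ua vb]]].
  apply/bigcupP; exists a => //; apply/bigcupP; exists u => //.
  apply/imsetP; exists v => //; rewrite inE.
  have /extP[vV vadj] := vb; rewrite vV /=.
  apply/forall_inP => x; rewrite in_setU1 in_setD1 => /predU1P[->|/andP[xa xA]]; last first.
    apply/negP => /extP[_ /(_ u)]; rewrite !inE eqxx /=.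
    rewrite (_ : u != x) /=; first by move=> /(_ isT) uv'; rewrite uv' in uv.
    by apply: contraNneq (ext_notin irr ua) => ->; rewrite !inE xa.
  rewrite setU1K; last exact: (ext_notin irr ua).
  apply/negP => va; case/negP: vA; rewrite eq_sym in ab.
  exact: ext_del2 bA aA ab vb va.
apply: leq_trans (card_bigcup_le _ _) _; apply: leq_sum => a aA.
apply: leq_trans (card_bigcup_le _ _) _; apply: leq_sum => u ua.
by rewrite card_imset // => v w [].
Qed.

Lemma sum_missing k : (\sum_(A in cliquesn k.+1) #|missing A| <=
  #|V| * (k.+1 * \sum_(A in cliquesn k.+1) #|junk A|))%N.
Proof.
pose g P := (\sum_(u in ext P) #|junk (u |: P)|)%N.
apply: (@leq_trans (\sum_(A in cliquesn k.+1) \sum_(a in A) g (A :\ a))%N).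
  by apply: leq_sum => A _; exact: card_missing.
rewrite -(sum_marked_cliques (R := nat) irr sym _ _ (fun P _ => g P)).
apply: (@leq_trans (\sum_(P in cliquesn k) #|V| * g P)%N).
  by apply: leq_sum => P _; rewrite sum_nat_const leq_mul2r subset_leq_card ?ext_sub ?orbT.
rewrite -big_distrr leq_mul2l /=; apply/orP; right.
rewrite (sum_marked_cliques (R := nat) irr sym _ _ (fun P u => #|junk (u |: P)|)).
rewrite big_distrr /=; apply: leq_sum => A /cliquesnP[_ _ Ak].
rewrite (eq_bigr (fun=> #|junk A|)) ?sum_nat_const ?Ak // => a aA.
by rewrite setD1K.
Qed.

Lemma sum_marked_pred k (q : {set T} -> bool) :
  (\sum_(A in cliquesn k.+1) \sum_(a in A) q (A :\ a)
   = \sum_(P in cliquesn k) #|ext P| * q P)%N.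
Proof.
rewrite -(sum_marked_cliques (R := nat) irr sym _ _ (fun P _ => nat_of_bool (q P))).
by apply: eq_bigr => P _; rewrite sum_nat_const.
Qed.

End Averages.

Lemma exists_below_average (R : realFieldType) (I : finType) (S : {pred I}) (f : I -> R) :
  \sum_(i in S) f i < #|S|%:R -> exists2 i, i \in S & f i < 1.
Proof.
move=> h; apply: contrapT => h1; move: h; rewrite ltNge => /negP; apply.
rewrite -sumr_const; apply: ler_sum => i iS; rewrite leNgt; apply/negP => fi.
by apply: h1; exists i.
Qed.

(** Averaging over the cliques with [k.+1] vertices. The upper bound on [kk k.+2] bounds the
    average of [#|ext A|]. The last inequality bounds that of [#|junk A|], by the
    exact Moon-Moser identity and Cauchy-Schwarz, and with it that of [#|missing A|].
    Finally a clique with few extensions lies in few larger cliques, so the lower bound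
    on [kk k.+1] leaves few [A] with a small part. Some [A] is good in all four
    respects. *)
Lemma typical_clique (R : realFieldType) (k : nat) (C0 c0 C2 : R) : 
  0 < c0 -> 0 <= C0 -> exists K c : R, [/\ 0 < K, 0 < c &
  forall (T : finType) (e : rel T) (V : {set T}),
  irreflexive e -> symmetric e -> (0 < #|V|)%N ->
  let n : R := #|V|%:R in
  let kk j : R := #|cliquesn e V j|%:R in
  kk k.+2 <= C0 * n ^+ k.+1 -> c0 * n ^+ k.+1 <= kk k.+1 ->
  (n - C2) * kk k <= k.+1%:R ^+ 2 * kk k.+1 ->
  exists2 A, A \in cliquesn e V k.+1 &
    [/\ #|junk e V A|%:R <= K, #|ext e V A|%:R <= K, #|missing e V A|%:R <= K * n &
     forall a, a \in A -> c * n <= #|ext e V (A :\ a)|%:R]].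
Proof.
move=> c00 C00.
have [B [B0 C2B]] : exists B : R, 0 <= B /\ C2 <= B.
  by exists `|C2|; rewrite normr_ge0 ler_norm.
pose J' := B + k%:R * k.+2%:R * (C0 / c0) + 1.
pose D' := k.+2%:R * (C0 / c0) + 1.
have q0 : 0 <= C0 / c0 by rewrite divr_ge0 // ltW.
have kq : 0 <= k%:R * k.+2%:R * (C0 / c0) by apply: mulr_ge0 => //; rewrite mulr_ge0.
have J'0 : 0 < J' by rewrite ltr_wpDl // addr_ge0.
have D'0 : 0 < D' by rewrite ltr_wpDl // mulr_ge0.
have k0 : 0 < k.+1%:R :> R by rewrite ltr0n.
exists (8 * J' + 8 * D' + 8 * (k.+1%:R * J')), (c0 / 2); split.
- have := mulr_gt0 k0 J'0; lra.
- by rewrite divr_gt0.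
move=> T e V irr sym V0 n kk h0 h1 h2.
have n0 : 0 < n by rewrite ltr0n.
have kk1 : 0 < kk k.+1 by apply: lt_le_trans h1; rewrite mulr_gt0 ?exprn_gt0.
have kk2 : kk k.+2 <= C0 / c0 * kk k.+1.
  apply: le_trans h0 _; rewrite -mulrA ler_wpM2l // mulrC.
  by rewrite -(ler_pM2l c00) mulrCA divff ?gt_eqF // mulr1.
have kk0 : 0 < kk k.
  rewrite lt_neqAle ler0n andbT eq_sym; apply/eqP => kk0.
  suff : k.+1%:R * kk k.+1 <= 0 by rewrite leNgt mulr_gt0.
  rewrite -natrM -sum_ext_card // big1 // => P Pk.
  by move/eqP: kk0; rewrite pnatr_eq0 => /eqP/card0_eq/(_ P); rewrite Pk.
pose J : R := (\sum_(A in cliquesn e V k.+1) #|junk e V A|)%N%:R.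
have JJ : J <= J' * kk k.+1.
  have := congr1 (fun x : nat => x%:R : R) (sum_ext_sqr V irr sym k).
  rewrite !natrD -/J !natrM -/(kk k.+1) -/(kk k.+2) -/n => E.
  set d := (\sum_(P in cliquesn e V k) #|ext e V P| ^ 2)%N%:R in E.
  have dlow : (n - C2) * kk k.+1 <= d.
    rewrite -(ler_pM2l kk0).
    have := cauchy_schwarz1 (mem (cliquesn e V k)) (fun P => #|ext e V P|%:R : R).
    rewrite -natr_sum sum_ext_card // natrM exprMn -/(kk k.+1).
    rewrite (_ : \sum_(P in cliquesn e V k) _ = d); last first.
      by rewrite /d natr_sum; apply: eq_bigr => P _; rewrite natrX.
    apply: le_trans; rewrite [_ ^+ 2 * _]mulrC expr2 -mulrA [_ * _ ^+ 2]mulrC mulrCA mulrA.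
    rewrite -mulrA mulrC mulrA ler_wpM2r ?(ltW kk1) //; move: h2; lra.
  have C2k : C2 * kk k.+1 <= B * kk k.+1 by rewrite ler_wpM2r ?(ltW kk1).
  have := ler_wpM2l (_ : 0 <= k%:R * k.+2%:R) kk2; rewrite mulr_ge0 // => /(_ isT).
  move: E dlow C2k kk1; rewrite /J'; clear; clearbody d J n kk.
  by move: (kk k.+1) (kk k.+2) (C0 / c0) => x y z; lra.
have DD : (\sum_(A in cliquesn e V k.+1) #|ext e V A|)%N%:R <= D' * kk k.+1.
  rewrite sum_ext_card // natrM -/(kk k.+2).
  have := ler_wpM2l (ler0n R k.+2) kk2; move: kk1; rewrite /D'; clear; clearbody kk.
  by move: (kk k.+1) (kk k.+2) (C0 / c0) => x y z; lra.
have MM : (\sum_(A in cliquesn e V k.+1) #|missing e V A|)%N%:R <= n * (k.+1%:R * (J' * kk k.+1)).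
  apply: (@le_trans _ _ (n * (k.+1%:R * J))); first by rewrite -!natrM ler_nat sum_missing.
  by rewrite ler_pM2l // ler_pM2l.
pose small P := #|ext e V P|%:R < c0 / 2 * n.
have SS : (\sum_(A in cliquesn e V k.+1) \sum_(a in A) small (A :\ a))%N%:R <= kk k.+1 / 2.
  rewrite sum_marked_pred // natr_sum.
  apply: (@le_trans _ _ (\sum_(P in cliquesn e V k) c0 / 2 * n)).
    apply: ler_sum => P _; rewrite /small; case: ltP => h; rewrite ?muln1 ?muln0 ?(ltW h) //.
    by rewrite mulr_ge0 ?(ltW n0) // divr_ge0 ?(ltW c00).
  rewrite sumr_const -[_ *+ _]mulr_natr -/(kk k).
  have : kk k <= n ^+ k by rewrite -natrX ler_nat card_cliquesn_le.
  move=> /(ler_wpM2l (ltW n0)); rewrite -exprS => /(ler_wpM2l (ltW c00)).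
  move: h1; clear; lra.
(* each of the first three terms has average at most 1/8 and the last at most 1/2,
   so f is below 1 somewhere *)
pose f A : R := #|junk e V A|%:R / (8 * J') + #|ext e V A|%:R / (8 * D')
  + #|missing e V A|%:R / (8 * (k.+1%:R * J') * n) + (\sum_(a in A) small (A :\ a))%N%:R.
have : \sum_(A in cliquesn e V k.+1) f A < #|cliquesn e V k.+1|%:R.
  rewrite -/(kk k.+1) /f !big_split /= -!mulr_suml -!natr_sum.
  have d1 : J / (8 * J') <= kk k.+1 / 8.
    by rewrite ler_pdivrMr ?mulr_gt0 //; move: JJ; clear; lra.
  have d2 : (\sum_(A in cliquesn e V k.+1) #|ext e V A|)%N%:R / (8 * D') <= kk k.+1 / 8.
    by rewrite ler_pdivrMr ?mulr_gt0 //; move: DD; clear; lra.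
  have d3 : (\sum_(A in cliquesn e V k.+1) #|missing e V A|)%N%:R / (8 * (k.+1%:R * J') * n) <= kk k.+1 / 8.
    by rewrite ler_pdivrMr ?mulr_gt0 //; move: MM; clear; lra.
  apply: le_lt_trans (lerD (lerD (lerD d1 d2) d3) SS) _.
  by move: kk1; clear; lra.
case/exists_below_average => A Ak fA; exists A => //.
have t1 : 0 <= #|junk e V A|%:R / (8 * J') by rewrite divr_ge0 ?mulr_ge0 ?(ltW J'0).
have t2 : 0 <= #|ext e V A|%:R / (8 * D') by rewrite divr_ge0 ?mulr_ge0 ?(ltW D'0).
have t3 : 0 <= #|missing e V A|%:R / (8 * (k.+1%:R * J') * n).
  by rewrite divr_ge0 // ?mulr_ge0 ?(ltW J'0) ?(ltW n0).
have t4 : 0 <= (\sum_(a in A) small (A :\ a))%N%:R :> R by [].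
have kJ : 0 < k.+1%:R * J' by rewrite mulr_gt0.
have aux (x y z w : R) : 0 <= x -> 0 <= y -> 0 <= z -> 0 <= w -> x + y + z + w < 1 ->
  [/\ x <= 1, y <= 1, z <= 1 & w < 1] by clear; move=> *; split; lra.
have {fA} [f1 f2 f3 f4] := aux _ _ _ _ t1 t2 t3 t4 fA; split.
- by move: f1; rewrite ler_pdivrMr ?mulr_gt0 // => h; move: J'0 D'0 kJ h; clear; lra.
- by move: f2; rewrite ler_pdivrMr ?mulr_gt0 // => h; move: J'0 D'0 kJ h; clear; lra.
- move: f3; rewrite ler_pdivrMr ?mulr_gt0 // mul1r => /le_trans; apply.
  by rewrite ler_wpM2r ?(ltW n0) //; move: J'0 D'0; clear; lra.
move=> a aA; rewrite leNgt; apply/negP => sm.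
by move: f4; rewrite ltrn1 (bigD1 a) //= /small sm.
Qed.

(** * The near Turan partition *)

Section DoubleCounting.
Variable R : realFieldType.

(** If every set in [F] grows to a set in [G] in at least [y] ways, counting the pairs of
    a set and an added element twice compares [#|F|] with [#|G|]. *)
Lemma grow_count (T : finType) (F G : {set {set T}}) (k : nat) (y : R) :
  (forall s, s \in G -> #|s| = k.+1) ->
  (forall s, s \in F -> y <= #|[set v | (v \notin s) && (v |: s \in G)]|%:R) ->
  y * #|F|%:R <= k.+1%:R * #|G|%:R.
Proof.
move=> Gk Fy; pose P := [set q : {set T} * T | [&& q.1 \in F, q.2 \notin q.1 & q.2 |: q.1 \in G]].
pose Q := [set q : {set T} * T | (q.1 \in G) && (q.2 \in q.1)].
apply: (@le_trans _ _ #|P|%:R).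
  rewrite mulrC mulr_natl -sumr_const.
  have -> : #|P| = (\sum_(s in F) #|[set v | (v \notin s) && (v |: s \in G)]|)%N.
    rewrite -sum1_card (eq_bigl (fun q => (q.1 \in F) && ((q.2 \notin q.1) && (q.2 |: q.1 \in G)))).
      rewrite -(pair_big_dep (fun s => s \in F) (fun s v => (v \notin s) && (v |: s \in G)) (fun _ _ => 1%N)).
      by apply: eq_bigr => s _; rewrite sum1dep_card.
    by move=> q; rewrite inE.
  by rewrite natr_sum; apply: ler_sum => s /Fy.
have PQ : (#|P| <= #|Q|)%N.
  rewrite -(card_in_imset (f := fun q => (q.2 |: q.1, q.2))).
    apply/subset_leq_card/subsetP => _ /imsetP[[s v] + ->]; rewrite !inE /= eqxx.
    by case/and3P => _ _ ->.
  move=> [s v] [t w]; rewrite !inE /= => /and3P[_ vs _] /and3P[_ wt _] [E vw].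
  by rewrite vw in E vs *; congr pair; rewrite -(setU1K vs) E setU1K.
apply: (@le_trans _ _ #|Q|%:R); first by rewrite ler_nat.
rewrite -natrM ler_nat -sum1_card.
rewrite (eq_bigl (fun q => (q.1 \in G) && (q.2 \in q.1))) => [|q]; last by rewrite inE.
rewrite -(pair_big_dep (fun s => s \in G) (fun (s : {set T}) v => v \in s) (fun _ _ => 1%N)) /=.
rewrite mulnC -sum_nat_const; apply: leq_sum => s /Gk <-.
by rewrite sum1_card.
Qed.

Lemma card_heavy (T : finType) (m : {set T * T}) (H : {set T}) (t : R) :
  (forall u, u \in H -> t <= #|[set v | (u, v) \in m]|%:R) -> t * #|H|%:R <= #|m|%:R.
Proof.
move=> Ht; rewrite mulrC mulr_natl -sumr_const.
apply: (@le_trans _ _ (\sum_(u in H) #|[set v | (u, v) \in m]|%:R)); first exact: ler_sum.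
rewrite -natr_sum ler_nat.
have -> : (\sum_(u in H) #|[set v | (u, v) \in m]| = #|[set p in m | p.1 \in H]|)%N.
  rewrite -[RHS]sum1_card (eq_bigl (fun q => (q.1 \in H) && (q \in m))); last first.
    by move=> q; rewrite inE andbC.
  rewrite (eq_bigl (fun q => (q.1 \in H) && ((q.1, q.2) \in m))); last by move=> [].
  rewrite -(pair_big_dep (fun u => u \in H) (fun u v => (u, v) \in m) (fun _ _ => 1%N)) /=.
  by apply: eq_bigr => u _; rewrite sum1dep_card.
by apply/subset_leq_card/subsetP => p; rewrite inE => /andP[].
Qed.

End DoubleCounting.

Lemma free_part (T : finType) (r : nat) (s : {set T}) (p : T -> 'I_r) :
  (#|s| < r)%N -> exists i, forall v, v \in s -> p v != i.
Proof.
move=> sr; have : ~~ ([set: 'I_r] \subset p @: s).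
  apply/negP => /subset_leq_card; rewrite cardsT card_ord leqNgt.
  by rewrite (leq_ltn_trans (leq_imset_card _ _) sr).
case/subsetPn => i _ ip; exists i => v vs; apply: contraNneq ip => <-.
exact: imset_f.
Qed.

Section Transversal.
Variables (R : realFieldType) (T : finType) (e : rel T) (r : nat).
Hypothesis irr : irreflexive e.
Hypothesis sym : symmetric e.

(** Cliques with at most one vertex per part are built one vertex at a time: a clique
    with fewer than [r] vertices misses a part, and each of its vertices excludes at
    most [t] vertices of that part. *)
Lemma transversal_cliques (W : {set T}) (p : T -> 'I_r) (y t : R) : 0 <= t -> 0 <= y ->
  (forall i, y + r%:R * t <= #|[set v in W | p v == i]|%:R) ->
  (forall v j, v \in W -> p v != j -> #|[set u in W | (p u == j) && ~~ e v u]|%:R <= t) ->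
  y ^+ r <= r`!%:R * #|cliquesn e W r|%:R.
Proof.
move=> t0 y0 big few.
pose F k := [set s in cliquesn e W k | [forall u in s, forall v in s, (p u == p v) ==> (u == v)]].
have step k : (k < r)%N -> y * #|F k|%:R <= k.+1%:R * #|F k.+1|%:R.
  move=> kr; apply: grow_count => s; rewrite inE => /andP[sC inj_s].
    by case/cliquesnP: sC.
  have /cliquesnP[sW sc sk] := sC.
  have [|i si] := @free_part _ r s p; first by rewrite sk.
  pose Z := \bigcup_(v in s) [set u in W | (p u == i) && ~~ e v u].
  have Zt : #|Z|%:R <= r%:R * t.
    apply: (@le_trans _ _ (\sum_(v in s) t)).
      apply: (@le_trans _ _ (\sum_(v in s) #|[set u in W | (p u == i) && ~~ e v u]|%:R)).
        by rewrite -natr_sum ler_nat card_bigcup_le.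
      by apply: ler_sum => v vs; apply: few; [exact: (subsetP sW)|exact: si].
    by rewrite sumr_const sk -[_ *+ k]mulr_natl ler_wpM2r // ler_nat ltnW.
  apply: (@le_trans _ _ #|[set v in W | p v == i] :\: Z|%:R).
    have := big i; have : (#|[set v in W | p v == i]| <= #|[set v in W | p v == i] :\: Z| + #|Z|)%N.
      by rewrite -(cardsID Z) addnC leq_add2l subset_leq_card ?subsetIr.
    rewrite -(ler_nat R) natrD; lra.
  rewrite ler_nat; apply/subset_leq_card/subsetP => v /setDP[]; rewrite inE => /andP[vW pv] vZ.
  have vs : v \notin s by apply/negP => /si; rewrite pv.
  rewrite inE vs /= [_ \in F _]inE cliquesnU1 // sC /=; apply/andP; split.
    apply/extP; split=> // u us; apply: contraR vZ => uv.
    by apply/bigcupP; exists u => //; rewrite inE vW pv.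
  apply/forall_inP => a /setU1P aP; apply/forall_inP => b /setU1P bP.
  case: aP => [->|aS]; case: bP => [->|bS]; rewrite ?eqxx ?implybT //.
  - by rewrite (eqP pv) eq_sym (negbTE (si _ bS)).
  - by rewrite (eqP pv) (negbTE (si _ aS)).
  by have /forall_inP/(_ _ aS)/forall_inP/(_ _ bS) := inj_s.
have all k : (k <= r)%N -> y ^+ k <= k`!%:R * #|F k|%:R.
  elim: k => [|k IH] kr.
    rewrite expr0 mul1r ler1n; apply/card_gt0P; exists set0; rewrite inE cliquesn0 set11.
    by apply/forall_inP => u; rewrite inE.
  rewrite exprS factS natrM.
  apply: (@le_trans _ _ (y * (k`!%:R * #|F k|%:R))); first by rewrite ler_wpM2l ?IH // ltnW.
  by rewrite mulrCA [k.+1%:R * _]mulrC -mulrA ler_wpM2l ?ler0n //; apply: step.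
apply: le_trans (all r (leqnn _)) _; rewrite ler_wpM2l // ler_nat.
by apply/subset_leq_card/subsetP => s; rewrite inE => /andP[].
Qed.

End Transversal.

Section PartsOfClique.
Variables (T : finType) (e : rel T) (V A : {set T}) (r : nat).
Hypothesis irr : irreflexive e.
Hypothesis Ar : A \in cliquesn e V r.

Fact card_A : r = #|A|.
Proof. by case/cliquesnP: Ar. Qed.

Definition corner (i : 'I_r) : T := enum_val (cast_ord card_A i).

Definition part (i : 'I_r) : {set T} := ext e V (A :\ corner i) :\: ext e V A.

Lemma cornerA i : corner i \in A.
Proof. exact: enum_valP. Qed.

Lemma corner_inj : injective corner.
Proof. by move=> i j /enum_val_inj/cast_ord_inj. Qed.

Lemma corner_onto a : a \in A -> exists i, a = corner i.
Proof.
move=> aA; exists (cast_ord (esym card_A) (enum_rank_in aA a)).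
by rewrite /corner cast_ordKV enum_rankK_in.
Qed.

Lemma part_sub i : part i \subset V.
Proof. by apply: subset_trans (subsetDl _ _) (ext_sub _ _ _). Qed.

Lemma part_inj i j v : v \in part i -> v \in part j -> i = j.
Proof.
move=> /setDP[vi vA] /setDP[vj _]; apply: contraNeq vA => ij.
by apply: ext_del2 (cornerA i) (cornerA j) _ vi vj; rewrite (inj_eq corner_inj).
Qed.

Lemma card_part i : (#|ext e V (A :\ corner i)| <= #|part i| + #|ext e V A|)%N.
Proof.
by rewrite -(cardsID (ext e V A)) addnC leq_add2l subset_leq_card ?subsetIr.
Qed.

Lemma missing_parts i j u v : i != j -> u \in part i -> v \in part j -> ~~ e u v ->
  (u, v) \in missing e V A.
Proof.
move=> ij /setDP[ui uA] /setDP[vj vA] uv; rewrite inE /= uA vA uv /=.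
apply/exists_inP; exists (corner i); first exact: cornerA.
apply/exists_inP; exists (corner j); first exact: cornerA.
by rewrite ui vj (inj_eq corner_inj) ij.
Qed.

Lemma card_no_part : (#|V :\: \bigcup_i part i| <= #|junk e V A| + #|ext e V A|)%N.
Proof.
apply: leq_trans (leq_card_setU _ _); apply/subset_leq_card/subsetP => v /setDP[vV vU].
apply/setUP; have [vA|vA] := boolP (v \in ext e V A); [by right|left].
rewrite inE vV /=; apply/forall_inP => a /corner_onto[i ->].
by apply: contra vU => vi; apply/bigcupP; exists i => //; apply/setDP.
Qed.

End PartsOfClique.

Section NearTuran.
Variable R : realFieldType.

(** A partition [p] of a graph on [V] into [r] parts, with a set [B] of few bad vertices: the
    parts are linear in [n]; a good vertex is adjacent to almost all good vertices of the
    other parts; a bad vertex has few neighbours in its own part and misses a positive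
    fraction of the vertices elsewhere. There are two small constants because
    the losses caused by bad vertices, of order [eps'], must not outweigh what they
    miss, of order [eps]. *)
Definition near_turan (r : nat) (n c eps eps' : R) (T : finType) (e : rel T)
    (V : {set T}) (p : T -> 'I_r) (B : {set T}) :=
  [/\ B \subset V,
   forall i, c * n <= #|[set v in V :\: B | p v == i]|%:R,
   forall v i, v \in V :\: B -> p v != i ->
     #|[set u in V :\: B | (p u == i) && ~~ e v u]|%:R <= eps * n,
   forall w, w \in B ->
     #|[set u in V :\: B | (p u == p w) && e w u]|%:R <= eps' * n /\
     eps / 2 * n <= #|[set u in V :\: B | (p u != p w) && ~~ e w u]|%:R &
   #|B|%:R <= eps' * n].

Section Parts.
Variables (T : finType) (e : rel T) (V : {set T}) (r : nat).
Hypothesis irr : irreflexive e.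
Hypothesis sym : symmetric e.
Variables (U : 'I_r -> {set T}) (m : {set T * T}).
Hypothesis UV : forall i, U i \subset V.
Hypothesis Uinj : forall i j v, v \in U i -> v \in U j -> i = j.
Hypothesis Um : forall i j u v, i != j -> u \in U i -> v \in U j -> ~~ e u v -> (u, v) \in m.
Variable i0 : 'I_r.

Definition pick_part (v : T) : 'I_r := odflt i0 [pick i | v \in U i].

Lemma pick_partE i v : v \in U i -> pick_part v = i.
Proof.
rewrite /pick_part => vi; case: pickP => [j vj|/(_ i)]; last by rewrite vi.
exact: Uinj vj vi.
Qed.

Lemma pick_partP v : v \in \bigcup_i U i -> v \in U (pick_part v).
Proof. by case/bigcupP => i _ vi; rewrite (pick_partE vi). Qed.

(** If the neighbourhood of [w] met every part in many vertices, it would contain many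
    transversal cliques; the vertices with more than [t] missing cross pairs are
    removed first. *)
Lemma cliques_of_dense_traces (w : T) (y t : R) : 0 <= t -> 0 <= y ->
  (forall i, y + r%:R * t <= #|[set v in U i | e w v]|%:R
     - #|[set u | t < #|[set v | (u, v) \in m]|%:R]|%:R) ->
  y ^+ r <= r`!%:R * #|cliquesn e (ext e V [set w]) r|%:R.
Proof.
move=> t0 y0; set H := [set u | _] => big.
pose W := [set v in (\bigcup_i U i) :\: H | e w v].
have WE v : v \in W = [&& v \in U (pick_part v), v \notin H & e w v].
  rewrite inE in_setD; case: (boolP (v \in H)) => _; rewrite ?andbF //=; congr andb.
  apply/idP/idP => [/pick_partP //|vU]; apply/bigcupP; by exists (pick_part v).
have WV : W \subset ext e V [set w].
  apply/subsetP => v; rewrite WE => /and3P[vU _ wv]; apply/extP.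
  by split=> [|u /set1P -> //]; exact: (subsetP (UV _) _ vU).
apply: (@le_trans _ _ (r`!%:R * #|cliquesn e W r|%:R)); last first.
  by rewrite ler_wpM2l // ler_nat subset_leq_card ?cliquesnS.
apply: (transversal_cliques sym (p := pick_part) t0 y0) => [i|v j].
  apply: le_trans (big i) _; rewrite lerBlDr -natrD ler_nat.
  apply: leq_trans (leq_card_setU _ _); apply/subset_leq_card/subsetP => v.
  rewrite inE => /andP[vi wv]; apply/setUP; case: (boolP (v \in H)) => vH; [by right|left].
  by rewrite inE WE (pick_partE vi) vi vH wv eqxx.
rewrite WE => /and3P[vU]; rewrite inE -leNgt => vH _ vj; apply: le_trans vH.
rewrite ler_nat; apply/subset_leq_card/subsetP => u; rewrite inE WE.
case/andP=> /and3P[uU _ _] /andP[/eqP uj uv]; rewrite uj in uU; rewrite inE.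
exact: Um vj vU uU uv.
Qed.

End Parts.

(** A vertex [w] goes to a part that contains few of its neighbours. Such a part exists, for
    otherwise the link of [w] would contain of the order of [n ^ r] cliques with [r]
    vertices, against the assumed bound [n ^ r.-1]. All but boundedly many vertices
    go to the part they were in, because with only [K * n] missing pairs few vertices
    miss linearly many others. *)
Lemma near_turan_partition (r : nat) (K c C0 eps eps' : R) :
  (0 < r)%N -> 0 < K -> 0 < c -> 0 <= C0 -> 0 < eps -> eps <= c / 4 -> 0 < eps' -> eps' <= c / 4 ->
  exists n0 : R, forall (T : finType) (e : rel T) (V : {set T}) (U : 'I_r -> {set T})
    (m : {set T * T}), irreflexive e -> symmetric e -> let n : R := #|V|%:R in n0 <= n ->
  (forall i, U i \subset V) -> (forall i j v, v \in U i -> v \in U j -> i = j) ->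
  #|V :\: \bigcup_i U i|%:R <= 2 * K -> (forall i, c * n - K <= #|U i|%:R) ->
  #|m|%:R <= K * n ->
  (forall i j u v, i != j -> u \in U i -> v \in U j -> ~~ e u v -> (u, v) \in m) ->
  (forall w, w \in V -> #|cliquesn e (ext e V [set w]) r|%:R <= C0 * n ^+ r.-1) ->
  exists p B, near_turan n (c / 2) eps eps' e V (p : T -> 'I_r) B.
Proof.
move=> r0 K0 c0 C00 e0 ec e'0 e'c.
pose del := eps' / 2; have d0 : 0 < del by rewrite divr_gt0.
(* a bound for the number of vertices that change part or are bad *)
pose b0 := 2 * K + 2 * (K / eps).
have rr : 0 < r%:R :> R by rewrite ltr0n.
pose q1 := 16 * (r%:R * K / del ^+ 2).
pose q2 := r`!%:R * C0 * (2 / del) ^+ r.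
pose q3 := 4 * b0 / eps + b0 / del + 2 * (K + b0) / c.
have Ke0 : 0 < K / eps by rewrite divr_gt0.
have b00 : 0 < b0 by rewrite /b0; lra.
have q10 : 0 <= q1.
  apply: mulr_ge0 => //; apply: divr_ge0; last exact/exprn_ge0/ltW.
  by apply: mulr_ge0 => //; exact: ltW.
have q20 : 0 <= q2.
  by apply: mulr_ge0; [exact: mulr_ge0|apply/exprn_ge0/divr_ge0 => //; exact: ltW].
have q31 : 0 <= 4 * b0 / eps by apply: divr_ge0; rewrite ?mulr_ge0 // ltW.
have q32 : 0 <= b0 / del by apply: divr_ge0; exact: ltW.
have q33 : 0 <= 2 * (K + b0) / c.
  by apply: divr_ge0; [rewrite mulr_ge0 // addr_ge0 // ltW|exact: ltW].
exists (1 + q1 + q2 + q3) => T e V U m irr sym n n0 UV Uinj UK Uc mK Um link.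
have n1 : 1 <= n by move: n0; rewrite /q3; lra.
have np : 0 < n by lra.
have nb1 : b0 <= eps / 4 * n.
  have : 4 * b0 / eps <= n by move: n0; rewrite /q3; lra.
  by rewrite ler_pdivrMr //; lra.
have nb2 : b0 <= del * n.
  have : b0 / del <= n by move: n0; rewrite /q3; lra.
  by rewrite ler_pdivrMr //; lra.
have nb3 : K + b0 <= c / 2 * n.
  have : 2 * (K + b0) / c <= n by move: n0; rewrite /q3; lra.
  by rewrite ler_pdivrMr //; lra.
have nq1 : q1 <= n by move: n0; rewrite /q3; lra.
have nq2 : q2 < n by move: n0; rewrite /q3; lra.
clear n0 q31 q32 q33.
pose i0 := Ordinal r0.
have sparse w : w \in V -> exists i, #|[set v in U i | e w v]|%:R <= del * n.
  move=> wV; apply: contrapT => dense.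
  pose t := del * n / (4 * r%:R).
  have t0 : 0 < t by apply: divr_gt0; apply: mulr_gt0.
  have := @cliques_of_dense_traces T e V r sym U m UV Uinj Um i0 w (del * n / 2) t (ltW t0).
  set H := [set u | _].
  have Ht : t * #|H|%:R <= K * n.
    by apply: le_trans mK; apply: card_heavy => u; rewrite inE => /ltW.
  have Hs : #|H|%:R <= del * n / 4.
    rewrite -(ler_pM2l t0); apply: le_trans Ht _.
    have -> : t * (del * n / 4) = del ^+ 2 * n * n / (16 * r%:R).
      by rewrite /t; field; rewrite gt_eqF.
    rewrite ler_pdivlMr ?mulr_gt0 //.
    have : 16 * (r%:R * K) <= n * del ^+ 2.
      by move: nq1; rewrite /q1 mulrA ler_pdivrMr ?exprn_gt0.
    move=> /(ler_wpM2r (ltW np)); lra.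
  have rt : r%:R * t = del * n / 4 by rewrite /t; field; rewrite gt_eqF.
  have h1 : 0 <= del * n / 2 by apply: divr_ge0 => //; apply: mulr_ge0; exact: ltW.
  move=> /(_ h1)h2.
  have /h2 : forall i, del * n / 2 + r%:R * t <= #|[set v in U i | e w v]|%:R - #|H|%:R.
    move=> i; have : del * n < #|[set v in U i | e w v]|%:R.
      by rewrite ltNge; apply/negP => h; apply: dense; exists i.
    by move: Hs; rewrite rt; clear; lra.
  apply/negP; rewrite -ltNge.
  apply: (@le_lt_trans _ _ (r`!%:R * (C0 * n ^+ r.-1))).
    by rewrite ler_wpM2l // link.
  have := nq2; rewrite -(ltr_pM2r (exprn_gt0 r.-1 np)) -exprS prednK // => h3.
  have dpos : 0 < (2 / del) ^+ r by rewrite exprn_gt0 // divr_gt0.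
  rewrite -(ltr_pM2r dpos) [X in _ < X](_ : _ = n ^+ r); last first.
    by rewrite -exprMn; congr (_ ^+ r); field; rewrite gt_eqF.
  by apply: le_lt_trans h3; rewrite /q2 le_eqVlt; apply/orP; left; apply/eqP; ring.
pose p w := odflt i0 [pick i | #|[set v in U i | e w v]|%:R <= del * n].
have pE w : w \in V -> #|[set v in U (p w) | e w v]|%:R <= del * n.
  by rewrite /p => /sparse[i hi]; case: pickP => [j //|/(_ i)]; rewrite hi.
pose X := \bigcup_i U i.
pose p0 := pick_part U i0.
have p0E i v : v \in U i -> p0 v = i by exact: pick_partE.
have p0P v : v \in X -> v \in U (p0 v) by exact: pick_partP.
have UX i v : v \in U i -> v \in X by move=> vi; apply/bigcupP; exists i.
(* between eps / 2 and eps, with room for moving boundedly many vertices on both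
   sides *)
pose tau := 3 / 4 * eps * n.
pose bad w := tau < #|[set u in X | (p0 u != p w) && ~~ e w u]|%:R.
pose B := [set w in V | bad w].
(* the vertices that change part or are bad *)
pose Y := [set v in V | (v \notin U (p v)) || bad v].
have tau0 : 0 < tau by rewrite /tau !mulr_gt0 ?invr_gt0.
have BY : B \subset Y by apply/subsetP => v; rewrite !inE => /andP[-> ->]; rewrite orbT.
have YX v : v \in Y -> v \in X -> tau <= #|[set u | (v, u) \in m]|%:R.
  rewrite inE => /andP[vV vbad] /p0P vU; have [pv|pv] := eqVneq (p v) (p0 v).
    move: vbad; rewrite pv vU /= /bad pv => /ltW/le_trans; apply; rewrite ler_nat.
    apply/subset_leq_card/subsetP => u; rewrite inE => /and3P[/p0P uU uv evu].
    by rewrite inE; apply: Um vU uU evu; rewrite eq_sym.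
  apply: (@le_trans _ _ #|[set u in U (p v) | ~~ e v u]|%:R).
    have : (#|U (p v)| <= #|[set u in U (p v) | e v u]| + #|[set u in U (p v) | ~~ e v u]|)%N.
      rewrite -cardsUI (leq_trans _ (leq_addr _ _)) // subset_leq_card //.
      by apply/subsetP => u uU; rewrite !inE uU; case: (e v u).
    rewrite -(ler_nat R) natrD; have := Uc (p v); have := pE v vV; move: nb3 b00.
    move: (ler_wpM2r (ltW np) e'c) (ler_wpM2r (ltW np) ec) (mulr_gt0 c0 np).
    rewrite /tau /del; clear; lra.
  rewrite ler_nat; apply/subset_leq_card/subsetP => u; rewrite inE => /andP[uU evu].
  by rewrite inE; apply: Um vU uU evu; rewrite eq_sym.
have Yb : #|Y|%:R <= b0.
  have : (#|Y| <= #|V :\: X| + #|Y :&: X|)%N.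
    apply: leq_trans (leq_card_setU _ _); apply/subset_leq_card/subsetP => v vY.
    have vV : v \in V by move: vY; rewrite inE => /andP[].
    by rewrite in_setU in_setD in_setI vV vY andbT; case: (v \in X).
  have : tau * #|Y :&: X|%:R <= K * n.
    by apply: le_trans mK; apply: card_heavy => u; rewrite in_setI => /andP[]; exact: YX.
  rewrite -(ler_nat R) natrD => h1 h2.
  have : #|Y :&: X|%:R <= 2 * (K / eps).
    rewrite mulrA ler_pdivlMr // -(ler_pM2r np); move: h1; rewrite /tau.
    move: (#|Y :&: X|%:R : R) (ler0n R #|Y :&: X|) => x x0.
    have := mulr_gt0 K0 np; clear -x0; lra.
  by move: UK h2; rewrite /b0 -/X; clear; lra.
have VB v : v \in V :\: B -> v \in V /\ ~~ bad v.
  by rewrite in_setD inE => /andP[+ vV]; rewrite vV.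
have good v : v \in V -> v \notin Y -> [/\ v \in V :\: B, v \in X & p v = p0 v].
  move=> vV vY; have vB : v \notin B by apply: contra vY; exact: (subsetP BY).
  move: vY; rewrite inE vV negb_or /= negbK => /andP[vU _].
  by rewrite in_setD vB vV (p0E _ _ vU) (UX _ _ vU).
have addY (S S' : {set T}) : (forall v, v \in S -> v \notin Y -> v \in S') ->
    #|S|%:R <= #|S'|%:R + b0.
  move=> SS; apply: (@le_trans _ _ (#|S'|%:R + #|Y|%:R)); last by rewrite lerD2l.
  rewrite -natrD ler_nat; apply: leq_trans (leq_card_setU _ _).
  apply/subset_leq_card/subsetP => v vS; rewrite in_setU.
  by case: (boolP (v \in Y)) => [_|/(SS v vS)->]; rewrite ?orbT.
exists p, B; split.
- by apply/subsetP => v; rewrite inE => /andP[].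
- move=> i; have : #|U i|%:R <= #|[set v in V :\: B | p v == i]|%:R + b0.
    apply: addY => v vi vY; have vV := subsetP (UV i) _ vi.
    by have [vB _ pv] := good v vV vY; rewrite inE vB pv (p0E _ _ vi) eqxx.
  have := Uc i; move: nb3; clear; nra.
- move=> v i /VB[vV vgood] pvi.
  apply: (@le_trans _ _ (tau + b0)); last by move: nb1; rewrite /tau; clear; lra.
  move: vgood; rewrite /bad -leNgt => h.
  apply: (@le_trans _ _ (#|[set u in X | (p0 u != p v) && ~~ e v u]|%:R + b0)); last by rewrite lerD2r.
  apply: addY => u; rewrite inE => /andP[/VB[uV _] /andP[/eqP pu evu]] uY.
  have [_ uX pu0] := good u uV uY.
  by rewrite inE uX evu andbT -pu0 pu eq_sym.
- move=> w; rewrite inE => /andP[wV wbad]; split.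
    apply: (@le_trans _ _ (del * n + b0)); last by move: nb2; rewrite /del; clear; lra.
    apply: (@le_trans _ _ (#|[set v in U (p w) | e w v]|%:R + b0)); last by rewrite lerD2r pE.
    apply: addY => u; rewrite inE => /andP[/VB[uV _] /andP[/eqP pu evu]] uY.
    by have [_ /p0P uX pu0] := good u uV uY; rewrite inE evu andbT -pu pu0.
  have : #|[set u in X | (p0 u != p w) && ~~ e w u]|%:R <=
     #|[set u in V :\: B | (p u != p w) && ~~ e w u]|%:R + b0.
    apply: addY => u; rewrite inE => /andP[uX /andP[pu evu]] uY.
    have uV : u \in V by apply: (subsetP (UV (p0 u))); exact: p0P.
    by have [uB _ pu0] := good u uV uY; rewrite inE uB pu0 pu evu.
  move: wbad nb1; rewrite /bad /tau; clear; lra.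
apply: (@le_trans _ _ b0); first by apply: le_trans Yb; rewrite ler_nat subset_leq_card.
by apply: le_trans nb2 _; rewrite /del ler_pM2r //; move: e'0; clear; lra.
Qed.

End NearTuran.

Lemma card_cliques_from_links (T : finType) (e : rel T) (V : {set T}) k (b : nat) :
  irreflexive e -> symmetric e ->
  (forall w, w \in V -> (#|cliquesn e (ext e V [set w]) k| <= b)%N) ->
  (#|cliquesn e V k.+1| <= #|V| * b)%N.
Proof.
move=> irr sym link.
pose cover := \bigcup_(w in V) [set w |: s | s in cliquesn e (ext e V [set w]) k].
apply: (@leq_trans #|cover|).
  apply/subset_leq_card/subsetP => s /cliquesnP[sV sC sk].
  have /card_gt0P[w ws] : (0 < #|s|)%N by rewrite sk.
  apply/bigcupP; exists w; first exact: (subsetP sV).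
  apply/imsetP; exists (s :\ w); last by rewrite setD1K.
  apply/cliquesnP; split.
  - apply/subsetP => v; rewrite in_setD1 => /andP[vw vs]; apply/extP; split.
      exact: (subsetP sV).
    by move=> u /set1P ->; have /cliqueP := sC; apply; rewrite // eq_sym.
  - by apply: clique_sub sC; rewrite subsetDl.
  by move: sk; rewrite (cardsD1 w) ws => -[].
apply: leq_trans (card_bigcup_le _ _) _; rewrite -sum_nat_const.
by apply: leq_sum => w wV; apply: leq_trans (leq_imset_card _ _) (link w wV).
Qed.

Section Stability.
Variable R : realFieldType.

(** Almost as many [l.+1]-cliques as in the Turan graph and thin vertex links force a near
    Turan partition: Moon-Moser carries the clique count up to [r], a typical [r]-clique
    cuts out the parts, and the link bound places the remaining vertices. *)
Lemma near_turan_stability (r l C : nat) (C1 : R) : (0 < l < r)%N -> 0 <= C1 ->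
  exists c c0 : R, [/\ 0 < c, 0 < c0 & forall eps eps' : R,
  0 < eps -> eps <= c / 2 -> 0 < eps' -> eps' <= c / 2 ->
  exists n0 : R, forall (T : finType) (e : rel T) (V : {set T}),
  irreflexive e -> symmetric e -> let n : R := #|V|%:R in n0 <= n ->
  (forall w k, w \in V -> (#|cliquesn e (ext e V [set w]) k| <= C * #|V| ^ r.-1)%N) ->
  'C(r, l.+1)%:R * (n / r%:R) ^+ l.+1 - C1 * n ^+ l <= #|cliquesn e V l.+1|%:R ->
  c0 * n ^+ r <= #|cliquesn e V r|%:R /\
  exists p B, near_turan n c eps eps' e V (p : T -> 'I_r) B].
Proof.
move=> lr C10; have r0 : (0 < r)%N by case/andP: lr => _; apply: leq_ltn_trans.
have [c0 [C2 [n1 [c00 stab]]]] := moon_moser_stability lr C10.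
have [K [c [K0 cc typical]]] := @typical_clique R r.-1 C%:R c0 C2 c00 (ler0n R C).
exists (c / 2), c0; split=> //; first by rewrite divr_gt0.
move=> eps eps' e0 ec e'0 e'c.
have ec4 : eps <= c / 4 by move: ec; lra.
have e'c4 : eps' <= c / 4 by move: e'c; lra.
have [n2 parts] := near_turan_partition r0 K0 cc (ler0n R C) e0 ec4 e'0 e'c4.
pose nn := `|n1| + `|n2| + 1.
exists nn => T e V irr sym n nlarge link large.
have nn1 : n1 <= n.
  apply: le_trans nlarge; apply: le_trans (ler_norm _) _.
  by rewrite /nn -addrA lerDl addr_ge0.
have nn2 : n2 <= n.
  apply: le_trans nlarge; apply: le_trans (ler_norm _) _.
  by rewrite /nn [`|n1| + _]addrC -addrA lerDl addr_ge0.
have n0 : 0 < n.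
  by apply: lt_le_trans nlarge; rewrite /nn ltr_wpDl // addr_ge0.
have V0 : (0 < #|V|)%N by rewrite -(ltr_nat R).
pose kk s : R := #|cliquesn e V s|%:R.
have kkS s : kk s.+1 <= n * kk s.
  rewrite -natrM ler_nat; apply: leq_trans (leq_pmull _ (ltn0Sn s)) _.
  rewrite -sum_ext_card // mulnC -sum_nat_const; apply: leq_sum => P _.
  exact/subset_leq_card/ext_sub.
have kk0 : kk 0%N = 1 by rewrite /kk cliquesn0 cards1.
have kk1 : kk 1%N = n by rewrite /kk card_cliquesn1.
have [kr low] := stab n kk nn1 (moon_moser_cliques R V irr sym) (fun s => ler0n R _) kkS kk0 kk1 large.
split=> //.
(* each vertex lies in few cliques, so cliques with r.+1 vertices are as rare as
   those with r vertices *)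
have kr1 : kk r.+1 <= C%:R * n ^+ r.
  have := card_cliques_from_links irr sym (fun w wV => link w r wV).
  rewrite -(ler_nat R) !natrM natrX -/n -/(kk _) => h; apply: le_trans h _.
  by rewrite mulrCA -exprS prednK.
have rE : r.-1.+1 = r by rewrite prednK.
have := typical T e V irr sym V0; rewrite -/n rE.
move=> /(_ kr1 kr low)[A AC [jA eA mA sA]].
have [|||||||p [B nt]] := parts T e V (part AC) (missing e V A) irr sym nn2; last by exists p, B.
- by move=> i; exact: part_sub.
- by move=> i j v; exact: part_inj.
- rewrite mulr_natl mulr2n; apply: (@le_trans _ _ (#|junk e V A| + #|ext e V A|)%:R).
    by rewrite ler_nat card_no_part.
  by rewrite natrD lerD.
- move=> i; rewrite lerBlDr; apply: le_trans (sA _ (cornerA AC i)) _.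
  apply: le_trans (_ : (#|part AC i| + #|ext e V A|)%:R <= _).
    by rewrite ler_nat card_part.
  by rewrite natrD lerD2l.
- exact: mA.
- by move=> i j u v; exact: missing_parts.
- by move=> w wV; rewrite -natrX -natrM ler_nat link.
Qed.

End Stability.

(** * The graph induced by the good vertices of a part *)

Section Structure.
Variables (R : realFieldType) (r : nat) (c eps eps' : R).
Variables (T : finType) (e : rel T) (V : {set T}) (p : T -> 'I_r) (B : {set T}).
Hypothesis irr : irreflexive e.
Hypothesis sym : symmetric e.
Hypothesis ridge2 : forall k s, (k.+2 = r.*2)%N -> s \in cliquesn e V k.+1 -> #|ext e V s| = 2%N.
Hypothesis clique_max : forall k s, s \in cliquesn e V k -> (k <= r.*2)%N.
Hypothesis pure : forall k s, s \in cliquesn e V k.+1 ->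
  exists2 t, t \in cliquesn e V r.*2 & s \subset t.

Notation n := (#|V|%:R : R).
Hypothesis nt : near_turan n c eps eps' e V p B.
Hypothesis c0 : 0 < c.
Hypothesis r0 : (0 < r)%N.
Hypothesis eps0 : 0 <= eps.
Hypothesis eps_small : 16 * r%:R * eps <= c.
Hypothesis eps'_small : 4 * eps' <= c.
Hypothesis n_large : 8 <= c * n.

Notation ext := (ext e V).
Notation cliquesV := (cliquesn e V).

Definition goodpart i := [set v in V :\: B | p v == i].

Lemma goodpartP i v : reflect [/\ v \in V, v \notin B & p v = i] (v \in goodpart i).
Proof.
rewrite inE in_setD; apply: (iffP andP) => [[/andP[? ?] /eqP]|[-> -> ->]] //.
Qed.

(** Each vertex of [s] excludes at most [eps * n] vertices of the part. *)
Lemma card_common_ext (s : {set T}) i : s \subset V :\: B -> (forall v, v \in s -> p v != i) ->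
  #|goodpart i|%:R - #|s|%:R * (eps * n) <= #|goodpart i :&: ext s|%:R.
Proof.
move=> sV si; have [_ _ miss _ _] := nt.
pose Z := \bigcup_(v in s) [set u in V :\: B | (p u == i) && ~~ e v u].
have Zs : #|Z|%:R <= #|s|%:R * (eps * n).
  apply: (@le_trans _ _ (\sum_(v in s) eps * n)); last by rewrite sumr_const mulr_natl.
  apply: (@le_trans _ _ (\sum_(v in s) #|[set u in V :\: B | (p u == i) && ~~ e v u]|%:R)).
    by rewrite -natr_sum ler_nat card_bigcup_le.
  by apply: ler_sum => v vs; apply: miss; [exact: (subsetP sV)|exact: si].
have : (#|goodpart i| <= #|goodpart i :&: ext s| + #|Z|)%N.
  apply: leq_trans (leq_card_setU _ _); apply/subset_leq_card/subsetP => u ui.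
  have [uV uB pu] := goodpartP _ _ ui.
  rewrite in_setU in_setI ui /=; have [//|uZ] := boolP (u \in Z); rewrite ?orbT //.
  rewrite orbF; apply/extP; split=> // v vs; apply: contraR uZ => evu.
  by apply/bigcupP; exists v => //; rewrite inE in_setD uB uV pu eqxx.
rewrite -(ler_nat R) natrD; move: Zs; lra.
Qed.

Lemma epsn_small k : (k <= 8 * r)%N -> k%:R * (eps * n) <= c * n / 2.
Proof.
move=> kr; rewrite mulrA [_ / 2]mulrAC ler_wpM2r //.
apply: (@le_trans _ _ ((8 * r)%:R * eps)); first by rewrite ler_wpM2r ?ler_nat.
by rewrite natrM; move: eps_small; lra.
Qed.

(** Three common neighbours are too many for a clique of codimension 1. *)
Lemma card_common_ext3 (s : {set T}) i : s \subset V :\: B -> (#|s| <= 8 * r)%N ->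
  (forall v, v \in s -> p v != i) -> (2 < #|goodpart i :&: ext s|)%N.
Proof.
move=> sV sr si; rewrite -(ltr_nat R).
have := card_common_ext sV si; have := epsn_small sr.
have [_ big _ _ _] := nt; have := big i; rewrite -/(goodpart i).
move: n_large; lra.
Qed.

Section Facet.
Variable sigma : {set T}.
Hypothesis facet : sigma \in cliquesV r.*2.
Hypothesis sigma_good : sigma \subset V :\: B.

Definition side j := [set v in sigma | p v != j].

Lemma side_sub j : side j \subset sigma.
Proof. by apply/subsetP => v; rewrite inE => /andP[]. Qed.

Lemma side_good j : side j \subset V :\: B.
Proof. exact: subset_trans (side_sub j) sigma_good. Qed.

Lemma clique_subset k (s t : {set T}) : t \in cliquesV k -> s \subset t -> s \in cliquesV #|s|.
Proof.
case/cliquesnP => tV tC _ st; apply/cliquesnP.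
by split=> //; [exact: subset_trans tV|exact: clique_sub tC].
Qed.

(** With at most one vertex in part [j], the rest of the facet would be a clique of size
    at least [r.*2.-1] with at least 3 common neighbours in that part. So all parts contain
    at least 2 of the [r.*2] vertices, hence exactly 2. *)
Lemma card_sigma_part j : #|[set v in sigma | p v == j]| = 2%N.
Proof.
have sC := facet; have /cliquesnP[_ _ sk] := sC.
have ge2 i : (2 <= #|[set v in sigma | p v == i]|)%N.
  rewrite leqNgt; apply/negP => lt2.
  have card_side : (#|side i| + #|[set v in sigma | p v == i]| = r.*2)%N.
    rewrite -sk -(cardsID [set v | p v == i] sigma) addnC.
    by congr addn; apply: eq_card => v; rewrite !inE // andbC.
  have big3 : (2 < #|goodpart i :&: ext (side i)|)%N.
    apply: card_common_ext3; [exact: side_good| |by move=> v; rewrite inE => /andP[]].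
    by apply: leq_trans (_ : r.*2 <= _)%N; [rewrite -card_side leq_addr|clear; lia].
  have big3' : (2 < #|ext (side i)|)%N.
    by apply: leq_trans big3 _; rewrite subset_leq_card ?subsetIr.
  have sideC := clique_subset sC (side_sub i).
  have [cs|cs] : #|side i| = r.*2 \/ #|side i| = r.*2.-1.
    by move: card_side lt2; case: #|[set v in sigma | _]| => [|[|]] //; clear; lia.
    have /card_gt0P[x xE] : (0 < #|ext (side i)|)%N by exact: ltn_trans big3'.
    have : x |: side i \in cliquesV r.*2.+1.
      by rewrite cliquesnU1 ?(ext_notin irr xE) // xE -cs sideC.
    by move/clique_max; rewrite ltnn.
  have kr : (r.*2.-2.+2 = r.*2)%N by move: r0; clear; lia.
  have := @ridge2 r.*2.-2 (side i) kr.
  have -> : r.*2.-2.+1 = #|side i| by rewrite cs; move: r0; clear; lia.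
  by move=> /(_ sideC) E; rewrite E in big3'.
have sum2 : (\sum_i #|[set v in sigma | p v == i]| = \sum_(i < r) 2)%N.
  rewrite sum_nat_const card_ord muln2 -sk -sum1_card.
  rewrite (partition_big p xpredT) //=; apply: eq_bigr => i _.
  by rewrite -sum1_card; apply: eq_bigl => v; rewrite inE.
apply/eqP; rewrite eqn_leq ge2 andbT leqNgt; apply/negP => gt2.
have : (\sum_(i < r) 2 < \sum_(i < r) #|[set v in sigma | p v == i]|)%N.
  rewrite (bigD1 j) //= [X in (_ < X)%N](bigD1 j) //=.
  by rewrite -addSn leq_add // leq_sum.
by rewrite sum2 ltnn.
Qed.

Lemma side_clique j : side j \in cliquesV r.*2.-2.
Proof.
have sC := facet; have /cliquesnP[_ _ sk] := sC.
suff -> : r.*2.-2 = #|side j| by apply: clique_subset sC _; exact: side_sub.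
have := cardsID [set v | p v == j] sigma; rewrite sk.
have -> : sigma :&: [set v | p v == j] = [set v in sigma | p v == j] by apply/setP => v; rewrite !inE.
have -> : sigma :\: [set v | p v == j] = side j by apply/setP => v; rewrite !inE andbC.
by rewrite card_sigma_part; clear; lia.
Qed.

Lemma ridge_clique j x : x \in ext (side j) -> x |: side j \in cliquesV r.*2.-2.+1.
Proof. by move=> xE; rewrite cliquesnU1 ?(ext_notin irr xE) // xE side_clique. Qed.

Lemma ridge_card2 j x : x \in ext (side j) -> #|ext (x |: side j)| = 2%N.
Proof. by move=> /ridge_clique; apply: ridge2; move: r0; clear; lia. Qed.

(** Otherwise adding [x] to the side would give a ridge that avoids part [j] and has too
    many common neighbours there. *)
Lemma good_in_ext_side j x : x \in ext (side j) -> x \in V :\: B -> p x = j.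
Proof.
move=> xE xg; apply/eqP/negPn/negP => px.
have : (2 < #|goodpart j :&: ext (x |: side j)|)%N.
  apply: card_common_ext3.
  - by rewrite subUset sub1set xg side_good.
  - have /cliquesnP[_ _ ->] := ridge_clique xE; move: r0; clear; lia.
  - by move=> v /setU1P[->//|]; rewrite inE => /andP[].
move=> /leq_trans /(_ (subset_leq_card (subsetIr _ _))).
by rewrite ridge_card2.
Qed.

(** The common neighbourhood of a side of the facet induces a 2-regular graph and consists,
    up to few vertices, of the good vertices of part [j]. Removing the few vertices
    nonadjacent to some element of [S] leaves more than half of its vertices; if these
    were independent, their edges would all end in the smaller rest. *)
Lemma edge_in_part j (S : {set T}) : S \subset V :\: B -> (#|S| <= r.*2.+2)%N ->
  (forall v, v \in S -> p v != j) ->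
  exists x y, [/\ x \in goodpart j, y \in goodpart j, e x y, x \in ext S & y \in ext S].
Proof.
move=> SV Sr Sj; apply: contrapT => none.
pose Y := goodpart j :&: ext (side j :|: S).
pose Z := ext (side j) :\: Y.
have YS x : x \in Y -> [/\ x \in goodpart j, x \in ext (side j) & x \in ext S].
  rewrite in_setI => /andP[-> xE]; split=> //; apply: (subsetP (ext_anti _ _ _) _ xE).
    by rewrite subsetUl.
  by rewrite subsetUr.
(* every edge from Y ends in Z, and both sides have degree 2 *)
have YZ : (#|Y| <= #|Z|)%N.
  rewrite -(leq_pmul2r (ltn0Sn 1)).
  have -> : (#|Y| * 2 = \sum_(x in Y) #|ext (x |: side j)|)%N.
    by rewrite -sum_nat_const; apply: eq_bigr => x /YS[_ xE _]; rewrite ridge_card2.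
  have -> : (#|Z| * 2 = \sum_(x in Z) #|ext (x |: side j)|)%N.
    by rewrite -sum_nat_const; apply: eq_bigr => x /setDP[xE _]; rewrite ridge_card2.
  have extU x z : x \in ext (side j) -> (z \in ext (x |: side j)) = (z \in ext (side j)) && e x z.
    move=> xE; apply/extP/andP => [[zV h]|[/extP[zV h] xz]].
      split; last by apply: h; rewrite setU11.
      by apply/extP; split=> // u us; apply: h; rewrite setU1r.
    by split=> // u /setU1P[->|/h].
  pose E x z := [&& x \in ext (side j), z \in ext (side j) & e x z].
  have sumE (A : {set T}) : A \subset ext (side j) -> 
      (\sum_(x in A) #|ext (x |: side j)| = \sum_(x in A) \sum_z E x z)%N.
    move=> AE; apply: eq_bigr => x xA; rewrite -sum1_card big_mkcond /=.
    by apply: eq_bigr => z _; rewrite /E extU (subsetP AE _ xA) //=; case: (_ && _).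
  have Ysub : Y \subset ext (side j) by apply/subsetP => x /YS[].
  rewrite !sumE ?subsetDl // [X in (_ <= X)%N]exchange_big /=.
  rewrite [X in (_ <= X)%N](bigID (mem Y)) /=; apply: leq_trans (leq_addr _ _).
  apply: leq_sum => x xY; rewrite [X in (_ <= X)%N]big_mkcond /=; apply: leq_sum => z _.
  have [xg xE xS] := YS _ xY.
  rewrite /E; case: (boolP (z \in ext (side j))) => [zE|]; last by rewrite /= andbF.
  have [xz|] := boolP (e x z); last by rewrite /= andbF.
  rewrite in_setD zE andbT sym xz xE /=; case: (boolP (z \in Y)) => //= zY.
  by case: none; have [zg _ zS] := YS _ zY; exists x, z.
have /cliquesnP[_ _ cs] := side_clique j.
have Ylow : #|goodpart j|%:R - (2 * (2 * r))%:R * (eps * n) <= #|Y|%:R.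
  have sU : side j :|: S \subset V :\: B by rewrite subUset side_good.
  have sj v : v \in side j :|: S -> p v != j.
    by rewrite in_setU => /orP[|/Sj//]; rewrite inE => /andP[].
  apply: le_trans (card_common_ext sU sj); rewrite lerD2l lerN2 ler_wpM2r ?mulr_ge0 //.
  by rewrite ler_nat (leq_trans (leq_card_setU _ _)) // cs; move: Sr r0; clear; lia.
(* Z consists of bad vertices and of good ones that miss an element of S *)
have Zup : #|Z|%:R <= eps' * n + (4 * r)%:R * (eps * n).
  have [_ _ _ _ Bs] := nt.
  have : #|goodpart j :\: ext S|%:R <= (4 * r)%:R * (eps * n).
    apply: (@le_trans _ _ (#|S|%:R * (eps * n))); last first.
      by rewrite ler_wpM2r ?mulr_ge0 // ler_nat; move: Sr r0; clear; lia.
    have := card_common_ext SV Sj; rewrite -{1}(cardsID (ext S) (goodpart j)) natrD; lra.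
  have : (#|Z| <= #|B| + #|goodpart j :\: ext S|)%N.
    apply: leq_trans (leq_card_setU _ _); apply/subset_leq_card/subsetP => x /setDP[xE xY].
    rewrite in_setU; have [//|xB] := boolP (x \in B).
    have xV : x \in V by case/extP: xE.
    have xg : x \in goodpart j.
      by apply/goodpartP; split=> //; apply: good_in_ext_side xE _; rewrite in_setD xB.
    rewrite in_setD xg andbT /=; apply: contra xY => xS; rewrite in_setI xg; apply/extP; split=> // u.
    by rewrite in_setU => /orP[us|us]; [have /extP[_] := xE|have /extP[_] := xS]; apply.
  rewrite -(ler_nat R) natrD; move: Bs; lra.
have [_ big _ _ _] := nt; have := big j; rewrite -/(goodpart j).
have := YZ; rewrite -(ler_nat R).
have : (8 * r)%:R * (eps * n) <= c * n / 2 by exact: epsn_small.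
have : eps' * n <= c / 4 * n by rewrite ler_wpM2r //; move: eps'_small; lra.
move: Ylow Zup n_large; rewrite !natrM; lra.
Qed.

(** Two adjacent vertices from each of the other parts, chosen greedily: any few vertices of
    part [i] have such a clique in their common neighbourhood, and it leaves room for
    exactly two more vertices. *)
Lemma side_clique_to (i : 'I_r) (S : {set T}) : S \subset goodpart i -> (#|S| <= 4)%N ->
  exists2 Q, Q \in cliquesV r.*2.-2 &
    [/\ Q \subset V :\: B, forall v, v \in Q -> p v != i & forall u v, u \in Q -> v \in S -> e u v].
Proof.
move=> Si S4.
have Sg : S \subset V :\: B.
  by apply/subsetP => v /(subsetP Si) /goodpartP[vV vB _]; rewrite in_setD vB.
suff step (js : seq 'I_r) : uniq js -> i \notin js -> exists2 Q, Q \in cliquesV (size js).*2 &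
    [/\ Q \subset V :\: B, forall v, v \in Q -> p v \in js & forall u v, u \in Q -> v \in S -> e u v].
  have [||Q QC [QV Qp QS]] := step (rem i (enum 'I_r)).
  - by rewrite rem_uniq ?enum_uniq.
  - by rewrite mem_rem_uniq ?enum_uniq // inE eqxx.
  exists Q; last split => //.
    by rewrite size_rem ?mem_enum // size_enum_ord in QC; rewrite (_ : r.*2.-2 = r.-1.*2) //; move: r0; clear; lia.
  by move=> v /Qp; rewrite mem_rem_uniq ?enum_uniq // inE => /andP[].
elim: js => [_ _|j js IH /= /andP[jjs ujs]].
  exists set0; last by split=> [|v|u v]; rewrite ?sub0set ?inE.
  by apply/cliquesnP; rewrite sub0set clique0 cards0.
rewrite inE negb_or => /andP[ij ijs]; have [Q QC [QV Qp QS]] := IH ujs ijs.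
have jsr : (size js < r)%N.
  have u : uniq (j :: js) by rewrite /= jjs.
  by have := max_card (mem (j :: js)); rewrite (card_uniqP u) card_ord.
have /cliquesnP[_ _ Qk] := QC.
have [|||x [y [xj yj xy xE yE]]] := @edge_in_part j (S :|: Q).
- by rewrite subUset Sg.
- by rewrite (leq_trans (leq_card_setU _ _)) // Qk; move: S4 jsr; clear; lia.
- move=> v /setUP[vS|/Qp]; last by apply: contraTneq => ->.
  by have /goodpartP[_ _ ->] := subsetP Si _ vS.
have xQ : x \in ext Q by apply: (subsetP (ext_anti _ _ _) _ xE); rewrite subsetUr.
have yQ : y \in ext (x |: Q).
  have /extP[yV yh] := yE; apply/extP; split=> // u /setU1P[->//|uQ].
  by apply: yh; rewrite in_setU uQ orbT.
exists (y |: (x |: Q)).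
  by rewrite doubleS !cliquesnU1 ?(ext_notin irr yQ) ?(ext_notin irr xQ) // yQ xQ QC.
have gV v k : v \in goodpart k -> v \in V :\: B by rewrite inE => /andP[].
split.
- by rewrite !subUset !sub1set (gV _ _ yj) (gV _ _ xj).
- have /goodpartP[_ _ px] := xj; have /goodpartP[_ _ py] := yj.
  by move=> v /setU1P[->|/setU1P[->|/Qp]]; rewrite inE ?px ?py ?eqxx // => ->; rewrite orbT.
move=> u v uQ vS; have vSQ : v \in S :|: Q by rewrite in_setU vS.
case/setU1P: uQ => [->|/setU1P[->|uQ]]; last exact: QS.
  by rewrite sym; have /extP[_] := yE; apply.
by rewrite sym; have /extP[_] := xE; apply.
Qed.

(** Three neighbours of [v] in its own part would be three common neighbours of the ridge
    made of [v] and a clique from the other parts. *)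
Lemma goodpart_degree i v : v \in goodpart i -> (#|[set u in goodpart i | e v u]| <= 2)%N.
Proof.
move=> vi; rewrite leqNgt; apply/negP => /card_gt2P[x [y [z [[xN yN zN] [xy yz zx]]]]].
have [xi vx] : x \in goodpart i /\ e v x by move: xN; rewrite inE => /andP[].
have [yi vy] : y \in goodpart i /\ e v y by move: yN; rewrite inE => /andP[].
have [zi vz] : z \in goodpart i /\ e v z by move: zN; rewrite inE => /andP[].
have [||Q QC [QV Qp QS]] := @side_clique_to i [set v; x; y; z].
- by rewrite !subUset !sub1set vi xi yi zi.
- by rewrite -!setUA !cardsU1 cards1; do 3!case: (_ \notin _).
have gV u : u \in goodpart i -> u \in V by case/goodpartP.
have vQ : v \in ext Q.
  by apply/extP; split=> [|u uQ]; [exact: gV vi|rewrite QS // !inE eqxx].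
have vQC : v |: Q \in cliquesV r.*2.-2.+1 by rewrite cliquesnU1 ?(ext_notin irr vQ) // vQ QC.
have inQ u : u \in goodpart i -> e v u -> u \in [set v; x; y; z] -> u \in ext (v |: Q).
  move=> ui vu uS; apply/extP; split=> [|w /setU1P[->//|wQ]]; first exact: gV.
  exact: QS.
have : (#|[set x; y; z]| <= #|ext (v |: Q)|)%N.
  apply/subset_leq_card; rewrite !subUset !sub1set.
  by rewrite !inQ // !inE eqxx ?orbT.
have kr : (r.*2.-2.+2 = r.*2)%N by move: r0; clear; lia.
rewrite (ridge2 kr vQC) -setUA !cardsU1 cards1 !inE negb_or xy yz /=.
by rewrite eq_sym zx.
Qed.

(** A triangle in one part would extend a clique from the other parts beyond the
    dimension. *)
Lemma goodpart_triangle_free i x y z : x \in goodpart i -> y \in goodpart i -> z \in goodpart i ->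
  e x y -> e y z -> e x z -> False.
Proof.
move=> xi yi zi xy yz xz.
have [||Q QC [QV Qp QS]] := @side_clique_to i [set x; y; z].
- by rewrite !subUset !sub1set xi yi zi.
- by rewrite -!setUA !cardsU1 cards1; do 2!case: (_ \notin _).
have gV u : u \in goodpart i -> u \in V by case/goodpartP.
have zQ : z \in ext Q.
  by apply/extP; split=> [|u uQ]; [exact: gV zi|rewrite QS // !inE eqxx ?orbT].
have yQ : y \in ext (z |: Q).
  apply/extP; split=> [|u /setU1P[->|uQ]]; [exact: gV yi|by rewrite sym|].
  by rewrite QS // !inE eqxx ?orbT.
have xQ : x \in ext (y |: (z |: Q)).
  apply/extP; split=> [|u /setU1P[->|/setU1P[->|uQ]]]; [exact: gV xi|by rewrite sym|by rewrite sym|].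
  by rewrite QS // !inE eqxx ?orbT.
have : x |: (y |: (z |: Q)) \in cliquesV r.*2.-2.+3.
  by rewrite !cliquesnU1 ?(ext_notin irr xQ) ?(ext_notin irr yQ) ?(ext_notin irr zQ) // xQ yQ zQ QC.
by move/clique_max; move: r0; clear; lia.
Qed.

End Facet.

(** Each [r]-clique lies in a facet. If every facet contained a bad vertex, all [r]-cliques
    would be subsets of the facets through the few bad vertices, and the link bound
    makes these too few. *)
Lemma good_facet (C c1 : R) : c1 * n ^+ r <= #|cliquesV r|%:R -> 0 <= C ->
  C * 4 ^+ r * eps' < c1 -> 
  (forall w k, w \in V -> #|cliquesn e (ext [set w]) k|%:R <= C * n ^+ r.-1) ->
  exists2 sigma, sigma \in cliquesV r.*2 & sigma \subset V :\: B.
Proof.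
move=> kr C0 small link; apply: contrapT => none.
have [BV _ _ _ Bs] := nt.
have n0 : 0 < n.
  by rewrite lt_neqAle ler0n andbT; apply/eqP => n0; move: n_large; rewrite -n0; lra.
suff : #|cliquesV r|%:R <= C * 4 ^+ r * eps' * n ^+ r :> R.
  apply/negP; rewrite -ltNge; apply: lt_le_trans kr.
  by rewrite ltr_pM2r // exprn_gt0.
pose cover := \bigcup_(w in B) \bigcup_(t in cliquesn e (ext [set w]) r.*2.-1) powerset (w |: t).
apply: (@le_trans _ _ #|cover|%:R).
  rewrite ler_nat; apply/subset_leq_card/subsetP => A AC.
  have AC' : A \in cliquesV r.-1.+1 by rewrite prednK.
  have [t tC At] := pure AC'; have /cliquesnP[tV tc tk] := tC.
  have : ~~ (t \subset V :\: B) by apply/negP => tg; apply: none; exists t.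
  case/subsetPn => w wt; rewrite in_setD (subsetP tV) // andbT negbK => wB.
  apply/bigcupP; exists w => //; apply/bigcupP; exists (t :\ w); last first.
    by rewrite powersetE setD1K.
  apply/cliquesnP; split.
  - apply/subsetP => v; rewrite in_setD1 => /andP[vw vt]; apply/extP; split.
      exact: (subsetP tV).
    by move=> u /set1P ->; have /cliqueP := tc; apply; rewrite // eq_sym.
  - by apply: clique_sub tc; rewrite subsetDl.
  by rewrite (cardsD1 w) wt in tk; rewrite -tk.
apply: (@le_trans _ _ (\sum_(w in B) C * n ^+ r.-1 * 4 ^+ r)).
  apply: (@le_trans _ _ (\sum_(w in B) #|\bigcup_(t in cliquesn e (ext [set w]) r.*2.-1) powerset (w |: t)|%:R)).
    by rewrite -natr_sum ler_nat card_bigcup_le.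
  apply: ler_sum => w wB; have wV := subsetP BV _ wB.
  apply: (@le_trans _ _ (#|cliquesn e (ext [set w]) r.*2.-1|%:R * 4 ^+ r)); last first.
    by rewrite ler_wpM2r ?exprn_ge0 // link.
  rewrite -[4]/(4%:R) -natrX -natrM ler_nat; apply: leq_trans (card_bigcup_le _ _) _.
  rewrite -sum_nat_const; apply: leq_sum => t /cliquesnP[_ _ tk].
  rewrite card_powerset (_ : 4 = 2 ^ 2)%N // -expnM leq_pexp2l // mul2n.
  by rewrite cardsU1 tk; move: r0; case: (_ \notin _); clear; lia.
rewrite sumr_const -[_ *+ _]mulr_natr.
have pos : 0 <= C * n ^+ r.-1 * 4 ^+ r by rewrite !mulr_ge0 ?exprn_ge0.
apply: le_trans (ler_wpM2l pos Bs) _.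
have nr : n ^+ r = n ^+ r.-1 * n by rewrite -exprSr prednK.
by rewrite nr le_eqVlt; apply/orP; left; apply/eqP; ring.
Qed.

End Structure.

(** * Face functionals and products of quadratic polynomials *)

Section FaceFunctional.
Variables (R : realFieldType) (c : nat -> R) (cm1 : R) (l : nat).

(** A face function in terms of the face polynomial; the coefficient at 0 counts the empty
    face. *)
Definition face_functional (p : {poly R}) : R :=
  \sum_(i < l.+1) c i * p`_i.+1 + cm1 * p`_0.

Local Notation Lam := face_functional.

Lemma face_functionalD p q : Lam (p + q) = Lam p + Lam q.
Proof.
rewrite /Lam addrACA -big_split /= coefD mulrDr; congr (_ + _).
by apply: eq_bigr => i _; rewrite coefD mulrDr.
Qed.

Lemma face_functionalZ a p : Lam (a *: p) = a * Lam p.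
Proof.
rewrite /Lam mulrDr mulr_sumr coefZ mulrCA; congr (_ + _).
by apply: eq_bigr => i _; rewrite coefZ mulrCA.
Qed.

Lemma face_functional_bound (p : {poly R}) (b : R) : (forall k, (k <= l.+1)%N -> `|p`_k| <= b) ->
  `|Lam p| <= (\sum_(i < l.+1) `|c i| + `|cm1|) * b.
Proof.
move=> pb; rewrite mulrDl mulr_suml (le_trans (ler_normD _ _)) // lerD //; last first.
  by rewrite normrM ler_wpM2l ?pb.
apply: le_trans (ler_norm_sum _ _ _) _; apply: ler_sum => i _.
by rewrite normrM ler_wpM2l ?pb // ltnS ltn_ord.
Qed.

Hypothesis cl0 : 0 < c l.

(** If the coefficients grow by a large factor in each step up to [l.+1], the leading
    term outweighs all the others together. *)
Lemma face_functional_leading : exists2 x0 : R, 0 < x0 & forall (x : R) (p : {poly R}),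
  x0 <= x -> (forall k, 0 <= p`_k) -> (forall k, (k <= l)%N -> x * p`_k <= p`_k.+1) ->
  c l / 2 * p`_l.+1 <= Lam p.
Proof.
pose S := \sum_(i < l) `|c i| + `|cm1|.
have S0 : 0 <= S by rewrite addr_ge0 // sumr_ge0.
have t0 : 0 <= 2 * S / c l by rewrite divr_ge0 ?(ltW cl0) // mulr_ge0.
exists (1 + 2 * S / c l) => [|x p xx p0 px]; first by rewrite ltr_pwDl.
have x1 : 1 <= x by lra.
have mono k : (k <= l)%N -> p`_(l - k) <= p`_l.
  elim: k => [|k IH] kl; first by rewrite subn0.
  apply: le_trans (IH (ltnW kl)); have := px (l - k.+1)%N (leq_subr _ _).
  by rewrite subnSK //; apply: le_trans; rewrite ler_peMl.
have pl k : (k <= l)%N -> p`_k <= p`_l by move=> kl; have := mono _ (leq_subr k l); rewrite subKn.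
have bound : `|\sum_(i < l) c i * p`_i.+1 + cm1 * p`_0| <= S * p`_l.
  rewrite mulrDl mulr_suml (le_trans (ler_normD _ _)) // lerD //; last first.
    by rewrite normrM (ger0_norm (p0 _)) ler_wpM2l // pl.
  apply: le_trans (ler_norm_sum _ _ _) _; apply: ler_sum => i _.
  by rewrite normrM (ger0_norm (p0 _)) ler_wpM2l // pl.
have := px l (leqnn _) => last.
have : 2 * (S * p`_l) <= c l * p`_l.+1.
  apply: (@le_trans _ _ (c l * (x * p`_l))); last by rewrite ler_wpM2l // ltW.
  rewrite !mulrA ler_wpM2r //; have := ler_wpM2l (ltW cl0) xx.
  by rewrite mulrDr mulr1 [c l * (_ / _)]mulrC divfK ?gt_eqF //; move: cl0; lra.
move: bound; rewrite ler_norml => /andP[+ _] => h1 h2.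
rewrite /Lam big_ord_recr /= mulrAC; move: h1 h2.
move: (\sum_(i < l) c i * p`_i.+1 : R) (cm1 * p`_0) (S * p`_l) (c l * p`_l.+1) => a1 a2 a3 a4.
lra.
Qed.

End FaceFunctional.

Section Growth.
Variable R : realFieldType.
Implicit Types (p q : {poly R}) (y a b : R).

(** The growth that [m] factors with linear coefficient at least [y] impose, in a form
    that is stable under multiplication by one more such factor. *)
Definition grows y (m : nat) q :=
  [/\ forall k, 0 <= q`_k, 0 < q`_0 & forall k, (k < m)%N -> y * q`_k <= m%:R * q`_k.+1].

(** The face polynomial of a triangle-free graph with [a] vertices and [b] edges. *)
Definition quad a b : {poly R} := 1 + a *: 'X + b *: 'X^2.

Lemma coef_quad_mul a b q k :
  (quad a b * q)`_k = q`_k + a * ('X * q)`_k + b * ('X^2 * q)`_k.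
Proof. by rewrite !mulrDl mul1r -!scalerAl !coefD !coefZ. Qed.

Lemma grows_quad y m q a b : 0 <= y -> y <= a -> 0 <= b -> grows y m q -> grows y m.+1 (quad a b * q).
Proof.
move=> y0 ya b0 [q0 q00 qm]; have a0 : 0 <= a by apply: le_trans ya.
split=> [k||k km].
- rewrite coef_quad_mul coefXM coefXnM; case: k => [|[|k]] /=; rewrite ?mulr0 ?addr0 //.
    by rewrite addr_ge0 // mulr_ge0.
  by rewrite !addr_ge0 // mulr_ge0.
- by rewrite coef_quad_mul coefXM coefXnM /= !mulr0 !addr0.
rewrite !coef_quad_mul !coefXM !coefXnM /=.
have h0 : y * q`_k <= a * q`_k by rewrite ler_wpM2r.
have h1 : (0 < k)%N -> a * (y * q`_k.-1) <= a * (m%:R * q`_k).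
  by case: k km {h0} => // k km _; rewrite ler_wpM2l // qm // -ltnS.
have h2 : (1 < k)%N -> b * (y * q`_(k - 2)) <= b * (m%:R * q`_(k.-1)).
  case: k km {h0 h1} => [|[|k]] // km _; rewrite !subSS subn0 /= ler_wpM2l // qm //.
  exact: ltnW km.
have q1 := q0 k.+1; have qk := q0 k; have ak : 0 <= a * q`_k by rewrite mulr_ge0.
have m0 : 0 <= m.+1%:R * q`_k.+1 by rewrite mulr_ge0.
case: k km h0 h1 h2 q1 qk ak m0 => [|[|k]] km h0 h1 h2 q1 qk ak m0 /=.
- by rewrite !mulr0 !addr0 mulrDr; move: h0 m0; rewrite -(natr1 m); have := mulr_ge0 (ler0n R m) ak; lra.
- rewrite !mulr0 !addr0; have := h1 isT => /=; have := mulr_ge0 b0 (q0 0%N); move: h0 m0.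
  have := mulr_ge0 (ler0n R m.+1) (mulr_ge0 b0 (q0 0%N)).
  rewrite subnn -(natr1 m); lra.
have := h1 isT; have := h2 isT; rewrite /= !subSS !subn0 => h2' h1'.
have := mulr_ge0 b0 (q0 k.+1).
move: h0 m0; rewrite -(natr1 m); lra.
Qed.

Lemma grows_addX y m q : grows y m q -> grows y m ((1 + 'X) * q).
Proof.
move=> [q0 q00 qm]; have cE k : ((1 + 'X) * q)`_k = q`_k + ('X * q)`_k by rewrite mulrDl mul1r coefD.
split=> [k||k km]; rewrite ?cE ?coefXM /= ?addr0 //.
  by case: k => [|k] /=; rewrite ?addr0 // addr_ge0.
have := qm k km; case: k km => [|k] km /=.
  by rewrite addr0; have := mulr_ge0 (ler0n R m) (q0 0%N); lra.
by have := qm k (ltnW km); lra.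
Qed.

Lemma grows1 y : grows y 0 1.
Proof. by split=> [k||//]; rewrite coef1; case: eqP. Qed.

Lemma grows_prod (I : finType) (P : {pred I}) y (a b : I -> R) : 0 <= y ->
  (forall i, y <= a i) -> (forall i, 0 <= b i) ->
  grows y #|P| (\prod_(i in P) quad (a i) (b i)).
Proof.
move=> y0 ya b0; rewrite cardE -big_enum /=.
elim: (enum P) => [|i s IH] /=; first by rewrite big_nil; exact: grows1.
by rewrite big_cons; apply: grows_quad.
Qed.

Variables (c : nat -> R) (cm1 : R) (l : nat).
Hypothesis cl0 : 0 < c l.
Hypothesis l0 : (0 < l)%N.
Local Notation Lam := (face_functional c cm1 l).

(** The differences that arise from adding an edge to a part, or from moving a vertex
    between parts, are multiples of ['X^2 * q] with [q] a product of quadratic factors and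
    of factors [1 + 'X]. With [m] quadratic factors the coefficients of ['X^2 * q] grow up
    to degree [m.+2], which is at least [l.+1]. *)
Lemma face_functional_X2 : exists2 x0 : R, 0 < x0 & forall y m q, (l <= m.+1)%N ->
  x0 * m.+1%:R <= y -> grows y m q -> 0 < Lam ('X^2 * q).
Proof.
have [x0 x00 lead] := face_functional_leading cm1 cl0; exists x0 => // y m q lm xy [q0 q00 qm].
have y0 : 0 < y by apply: lt_le_trans xy; rewrite mulr_gt0 // ltr0n.
have qpos k : (k <= m)%N -> 0 < q`_k.
  elim: k => // k IH km; rewrite lt_neqAle q0 andbT; apply/eqP => qk.
  have := qm k km; rewrite -qk mulr0 leNgt mulr_gt0 // IH //; exact: ltnW.
apply: lt_le_trans (lead x0 _ (lexx _) _ _).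
- rewrite mulr_gt0 ?divr_gt0 // coefXnM; case: (l) l0 lm => // l' _ l'm.
  by rewrite !subSS subn0 /= qpos.
- by move=> k; rewrite coefXnM; case: ifP.
move=> k kl; rewrite !coefXnM; case: k kl => [|[|k]] kl /=; rewrite ?mulr0 ?q0 //.
rewrite !subSS !subn0.
have km : (k < m)%N := leq_trans kl lm.
have m0 : 0 < m%:R :> R by rewrite ltr0n; apply: leq_ltn_trans km.
rewrite -(ler_pM2l m0); apply: le_trans (qm k km); rewrite mulrA ler_wpM2r //.
by apply: le_trans xy; rewrite mulrC ler_wpM2l ?(ltW x00) // ler_nat.
Qed.

End Growth.

Definition balanced_size (r n : nat) (i : 'I_r) : nat := (n %/ r + (i < n %% r))%N.

Lemma sum_ord_ltn r a : (a <= r)%N -> (\sum_(i < r) (i < a) = a)%N.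
Proof.
move=> ar; rewrite -(big_mkord xpredT (fun i => nat_of_bool (i < a)%N)).
rewrite (big_cat_nat _ (n := a)) //=.
rewrite big_nat_cond (eq_bigr (fun=> 1%N)) => [|i /andP[/andP[_ ->]]] //.
rewrite -big_nat_cond sum_nat_const_nat subn0 muln1 big_nat_cond big1 ?addn0 // => i.
by case/andP=> /andP[h _] _; rewrite ltnNge h.
Qed.

Lemma sum_balanced_size r n : (0 < r)%N -> (\sum_(i < r) balanced_size n i = n)%N.
Proof.
move=> r0; rewrite big_split /= sum_nat_const card_ord sum_ord_ltn 1?mulnC -?divn_eq //.
by rewrite ltnW // ltn_pmod.
Qed.

(** Sizes that differ by at most 1 take two consecutive values, and the sum determines
    how often. *)
Lemma balanced_perm (r n : nat) (s : 'I_r -> nat) : (0 < r)%N -> (\sum_i s i = n)%N ->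
  (forall i j, (s i <= (s j).+1)%N) ->
  exists pi : {perm 'I_r}, forall i, s i = balanced_size n (pi i).
Proof.
case: r s => // r s _ sn bal.
have [m sm] : exists m : 'I_r.+1, forall i, (s m <= s i)%N.
  by case: (arg_minnP s (i0 := ord0) (P := xpredT)) => // m _ h; exists m => i; exact: h.
pose A := #|[set i | s i == (s m).+1]|.
have sE i : s i = (s m + (s i == (s m).+1))%N.
  have := sm i; have := bal i m; rewrite leq_eqVlt ltnS.
  case: eqP => [-> _ _|_ /= h1 h2]; first by rewrite addn1.
  by apply/eqP; rewrite addn0 eqn_leq h1 h2.
have nE : (n = s m * r.+1 + A)%N.
  rewrite -sn (eq_bigr _ (fun i _ => sE i)) big_split /= sum_nat_const card_ord mulnC.
  congr addn; rewrite /A -sum1dep_card [RHS]big_mkcond /=.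
  by apply: eq_bigr => i _; case: (_ == _).
have Ar : (A < r.+1)%N.
  have : [set i | s i == (s m).+1] \proper [set: 'I_r.+1].
    by rewrite properT; apply/eqP => /setP/(_ m); rewrite !inE ltn_eqF.
  by move/proper_card; rewrite cardsT card_ord.
have q : (n %/ r.+1 = s m)%N by rewrite nE divnMDl // divn_small // addn0.
have md : (n %% r.+1 = A)%N by rewrite nE modnMDl modn_small.
pose f i := s i == (s m).+1; pose g (i : 'I_r.+1) := (i < A)%N.
have fg : #|[set i | f i]| = #|[set i | g i]|.
  rewrite -/A -{1}(sum_ord_ltn (ltnW Ar)) -sum1dep_card [RHS]big_mkcond /=.
  by apply: eq_bigr => i _; rewrite /g; case: (_ < _)%N.
pose s1 := [tuple of map f (ord_tuple r.+1)].
pose s2 := [tuple of map g (ord_tuple r.+1)].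
have /tuple_permP[pi piE] : perm_eq s1 s2.
  have cnt (P : pred 'I_r.+1) : count P (enum 'I_r.+1) = #|[set i | P i]|.
    by rewrite -sum1_count big_enum_cond /= sum1dep_card.
  have cntE (P : pred 'I_r.+1) b : count_mem b (map P (enum 'I_r.+1)) =
      (if b then #|[set i | P i]| else r.+1 - #|[set i | P i]|)%N.
    case: b; first by rewrite count_map -cnt; apply: eq_count => i /=; rewrite eqb_id.
    rewrite count_map -cnt -[X in (X - _)%N](size_enum_ord r.+1) -(count_predC P) addKn.
    by apply: eq_count => i /=; rewrite eqbF_neg.
  by apply/allP => x _ /=; rewrite !cntE fg.
exists pi => i; rewrite (sE i) /balanced_size q md; congr (_ + nat_of_bool _)%N.
rewrite -[LHS]/(f i) -[RHS]/(g (pi i)).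
have := congr1 (fun t => nth false t i) piE.
rewrite /= (nth_map ord0) ?size_enum_ord // nth_ord_enum => ->.
by rewrite (nth_map ord0) ?size_enum_ord // nth_ord_enum tnth_map tnth_ord_tuple.
Qed.

Section Balancing.
Variable R : realFieldType.
Variables (c : nat -> R) (cm1 : R) (l r : nat).
Hypothesis cl0 : 0 < c l.
Hypothesis l0 : (0 < l)%N.
Hypothesis lr : (l < r)%N.
Local Notation Lam := (face_functional c cm1 l).

(** Raising one quadratic coefficient adds a positive multiple of ['X^2] times the other
    factors. *)
Lemma quad_prod_raise : exists2 x0 : R, 0 < x0 & forall (a b : 'I_r -> R),
  (forall i, x0 <= a i) -> (forall i, 0 <= b i <= a i) ->
  (forall i, b i = a i) \/ 
  Lam (\prod_i quad (a i) (b i)) < Lam (\prod_i quad (a i) (a i)).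
Proof.
have [x0 x00 pos] := face_functional_X2 cm1 cl0 l0.
exists (x0 * r%:R) => [|a b ax]; first by rewrite mulr_gt0 // ltr0n; apply: leq_ltn_trans lr.
have [k] := ubnP #|[set i | b i != a i]|; elim: k b => // k IH b bk ba.
have [/set0Pn[i]|/negPn/eqP b0] := boolP ([set i | b i != a i] != set0); last first.
  by left=> i; apply/eqP/negPn/negP => h; move/setP/(_ i): b0; rewrite !inE h.
rewrite inE => bi; right.
pose b' j := if j == i then a j else b j.
have step : Lam (\prod_j quad (a j) (b j)) < Lam (\prod_j quad (a j) (b' j)).
  have -> : \prod_j quad (a j) (b' j) = \prod_j quad (a j) (b j) +
     (a i - b i) *: ('X^2 * \prod_(j in predC1 i) quad (a j) (b j)).
    rewrite (bigD1 i) //= [X in _ = X + _](bigD1 i) //= /b' eqxx.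
    rewrite (eq_bigr (fun j => quad (a j) (b j))) => [|j /negbTE -> //].
    rewrite [X in _ * X = _](eq_bigl (fun j => j \in predC1 i)) //.
    rewrite /quad -!mul_polyC polyCB; ring.
  rewrite face_functionalD face_functionalZ ltrDl mulr_gt0 //.
    by have /andP[_ h] := ba i; rewrite subr_gt0 lt_neqAle bi.
  apply: (pos (x0 * r%:R) #|predC1 i|).
  - by rewrite cardC1 card_ord prednK ?(leq_ltn_trans _ lr) // ltnW.
  - by rewrite cardC1 card_ord prednK ?(leq_ltn_trans _ lr).
  apply: grows_prod => // [|j]; first by rewrite mulr_ge0 // ltW.
  by have /andP[] := ba j.
have b'a j : 0 <= b' j <= a j.
  rewrite /b'; case: eqP => _; last exact: ba.
  by rewrite lexx andbT; apply: le_trans (ax j); rewrite mulr_ge0 // ltW.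
have [|b'E|] := IH b' _ b'a.
- rewrite ltnS in bk; apply: leq_trans bk; apply: proper_card; apply/properP; split.
    apply/subsetP => j; rewrite !inE /b'; case: (j == i) => //; rewrite eqxx //.
  by exists i; rewrite inE ?bi /b' ?eqxx.
- by move: step; rewrite [X in _ < Lam X](eq_bigr (fun j => quad (a j) (a j))) // => j _; rewrite b'E.
exact: lt_trans.
Qed.

Definition cycles_poly (s : 'I_r -> nat) : {poly R} := \prod_i quad (s i)%:R (s i)%:R.

(** Moving a vertex from a larger to a smaller part. As
    [(1 + s X (1 + X)) (1 + t X (1 + X))] depends on [s + t] and [s t] only, the change is
    [(s - 1 - t) X^2 (1 + X)^2] times the remaining factors. *)
Lemma cycles_poly_balance : exists2 x0 : R, 0 < x0 & forall s : 'I_r -> nat,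
  (forall i, x0 <= (s i)%:R) ->
  ((forall i j, (s i <= (s j).+1)%N) /\
   cycles_poly s = cycles_poly (balanced_size (\sum_i s i))) \/
  Lam (cycles_poly s) < Lam (cycles_poly (balanced_size (\sum_i s i))).
Proof.
have [x0 x00 pos] := face_functional_X2 cm1 cl0 l0.
have r0 : (0 < r)%N by apply: leq_ltn_trans lr.
exists (x0 * r%:R) => [|s]; first by rewrite mulr_gt0 // ltr0n.
have balE (s' : 'I_r -> nat) : (forall i j, (s' i <= (s' j).+1)%N) ->
   cycles_poly s' = cycles_poly (balanced_size (\sum_i s' i)).
  move=> bal; have [pi piE] := balanced_perm r0 erefl bal.
  rewrite /cycles_poly [RHS](reindex_inj (@perm_inj _ pi)) /=.
  by apply: eq_bigr => i _; rewrite piE.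
(* the sum of squares drops with every move *)
have [k] := ubnP (\sum_i s i ^ 2)%N; elim: k s => // k IH s sk xs.
case: (boolP [forall i, forall j, (s i <= (s j).+1)%N]) => [/forallP h|].
  have bal i j : (s i <= (s j).+1)%N by have /forallP := h i.
  by left; split=> //; exact: balE.
rewrite negb_forall => /existsP[i]; rewrite negb_forall => /existsP[j]; rewrite -ltnNge => sij.
right; have ij : i != j by apply: contraTneq sij => ->; rewrite ltnNge leqW.
pose s' h := if h == i then (s i).-1 else if h == j then (s j).+1 else s h.
have s'i : s' i = (s i).-1 by rewrite /s' eqxx.
have s'j : s' j = (s j).+1 by rewrite /s' eq_sym (negbTE ij) eqxx.
have s'h h : (h != i) && (h != j) -> s' h = s h by rewrite /s' => /andP[/negbTE-> /negbTE->].
have sum' : (\sum_h s' h = \sum_h s h)%N.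
  rewrite (bigD1 i) // (bigD1 j) 1?eq_sym //= [RHS](bigD1 i) // [in RHS](bigD1 j) 1?eq_sym //=.
  rewrite (eq_bigr s) // s'i s'j !addnA; congr addn; move: sij; clear; lia.
have sq' : (\sum_h s' h ^ 2 < \sum_h s h ^ 2)%N.
  rewrite (bigD1 i) // (bigD1 j) 1?eq_sym //= [X in (_ < X)%N](bigD1 i) // [X in (_ < _ + X)%N](bigD1 j) 1?eq_sym //=.
  rewrite (eq_bigr (fun h => s h ^ 2)%N) => [|h hh]; last by rewrite s'h.
  rewrite s'i s'j !addnA ltn_add2r; move: sij; clear; move: (s i) (s j) => x y; nia.
have step : Lam (cycles_poly s) < Lam (cycles_poly s').
  pose P := [pred h | (h != i) && (h != j)].
  have -> : cycles_poly s' = cycles_poly s + ((s i).-1%:R - (s j)%:R) *: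
     ('X^2 * ((1 + 'X) * ((1 + 'X) * \prod_(h in P) quad (s h)%:R (s h)%:R))).
    rewrite /cycles_poly (bigD1 i) // (bigD1 j) 1?eq_sym //= [X in _ = X + _](bigD1 i) // [X in _ = _ * X + _](bigD1 j) 1?eq_sym //=.
    rewrite (eq_bigr (fun h => quad (s h)%:R (s h)%:R)) => [|h hh]; last by rewrite s'h.
    rewrite [in RHS](eq_bigl (fun h => (h != i) && (h != j))) // s'i s'j.
    have -> : s i = (s i).-1.+1 by rewrite prednK //; apply: leq_ltn_trans sij.
    rewrite /quad -!mul_polyC !polyC_natr -!natr1 /=; set Q := \prod_(_ | _) _.
    rewrite -/Q polyCB !polyC_natr; ring.
  rewrite face_functionalD face_functionalZ ltrDl mulr_gt0 //.
    by rewrite subr_gt0 ltr_nat; move: sij; clear; lia.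
  have cP : (#|P| + 2 = r)%N.
    have := cardC (pred2 i j); rewrite card_ord card2 ij addnC => E.
    by rewrite -[RHS]E; congr addn; apply: eq_card => h; rewrite !inE negb_or.
  apply: (pos (x0 * r%:R) #|P|).
  - by move: cP lr; clear; lia.
  - by rewrite ler_pM2l // ler_nat; move: cP; clear; lia.
  do 2!apply: grows_addX; apply: grows_prod => //.
  by rewrite mulr_ge0 // ltW.
have [||[_ bal]|] := IH s'.
- by rewrite ltnS in sk; exact: leq_trans sq' sk.
- move=> h; rewrite /s'; case: eqP => _; last case: eqP => _ //.
    by apply: le_trans (xs j) _; rewrite ler_nat; move: sij; clear; lia.
  by apply: le_trans (xs j) _; rewrite ler_nat.
- by rewrite -sum' -bal.
- by rewrite sum'; exact: lt_trans.
Qed.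

End Balancing.

(** * Joins of cycles *)

Section FacePolynomials.
Variable R : realFieldType.

(** The face polynomial is an isomorphism invariant. *)
Lemma fpoly_imset (T T' : finType) (f : T -> T') (D : {set T}) (K : {set {set T}}) :
  {in D &, injective f} -> (forall s, s \in K -> s \subset D) ->
  fpoly R [set f @: s | s : {set T} in K] = fpoly R K.
Proof.
move=> finj KD; rewrite /fpoly big_imset /=.
  apply: eq_bigr => s /KD /subsetP sD; rewrite card_in_imset // => u v /sD uD /sD vD.
  exact: finj.
move=> s t /KD /subsetP sD /KD /subsetP tD st; apply/setP => x; apply/idP/idP => xs.
  have : f x \in f @: t by rewrite -st imset_f.
  by case/imsetP => y yt /finj -> //; [exact: sD|exact: tD].
have : f x \in f @: s by rewrite st imset_f.
by case/imsetP => y ys /finj -> //; [exact: tD|exact: sD].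
Qed.

(** Choosing a face of a join is choosing a face in each factor independently, and
    cardinalities add. *)
Lemma fpoly_join (T I : finType) (p : T -> I) (K : {set {set T}}) :
  (forall s, (s \in K) = [forall i, s :&: [set v | p v == i] \in K]) ->
  fpoly R K = \prod_i fpoly R [set s in K | s \subset [set v | p v == i]].
Proof.
move=> Kp; pose Ki i := [set s in K | s \subset [set v | p v == i]].
rewrite /fpoly (bigA_distr_big_dep _ (fun _ (s : {set T}) => 'X^#|s|)) /=.
pose glue (f : {ffun I -> {set T}}) := \bigcup_i f i.
pose cut (s : {set T}) := [ffun i => s :&: [set v | p v == i]].
have cutK : cancel cut glue.
  move=> s; apply/setP => v; apply/bigcupP/idP => [[i _]|vs].
    by rewrite ffunE inE => /andP[].
  by exists (p v) => //; rewrite ffunE !inE vs /=.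
have glueK f : f \in family (fun i s => s \in Ki i) -> cut (glue f) = f.
  move=> /familyP fK; apply/ffunP => i; rewrite ffunE; apply/setP => v; rewrite !inE.
  have sub j : v \in f j -> p v = j.
    have := fK j; rewrite unfold_in inE => /andP[_ /subsetP fj] /fj.
    by rewrite inE => /eqP.
  apply/andP/idP => [[/bigcupP[j _ vj] /eqP vi]|vi]; first by rewrite -vi (sub j vj).
  by split; [apply/bigcupP; exists i|rewrite (sub i vi)].
rewrite [RHS](reindex_onto cut glue) /=; last by move=> f; exact: glueK.
apply: eq_big => [s|s sK].
  rewrite cutK eqxx andbT Kp; apply/forallP/familyP => h i; have := h i.
    by rewrite unfold_in inE ffunE subsetIr andbT.
  by rewrite unfold_in inE ffunE => /andP[].
rewrite prodrXr -sum1_card (partition_big p xpredT) //=; congr ('X^_).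
apply: eq_bigr => i _; rewrite ffunE -sum1_card; apply: eq_bigl => v.
by rewrite !inE.
Qed.

Lemma fpoly_cliques_triangle_free (T : finType) (e : rel T) (V : {set T}) :
  (forall s, s \in cliques e V -> (#|s| <= 2)%N) ->
  fpoly R (cliques e V) = quad #|V|%:R #|cliquesn e V 2|%:R.
Proof.
move=> le2; apply/polyP => k; rewrite coef_fpoly -/(cliquesn e V k).
rewrite !coefD coef1 !coefZ coefX coefXn; case: k => [|[|[|k]]] /=.
- by rewrite !mulr0 !addr0 cliquesn0 cards1.
- by rewrite mulr1 mulr0 addr0 add0r card_cliquesn1.
- by rewrite mulr0 mulr1 !add0r.
rewrite !mulr0 !addr0; apply/eqP; rewrite pnatr_eq0 cards_eq0; apply/eqP/setP => s.
rewrite inE in_set0; apply/negP => /andP[/le2 + /eqP sk].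
by rewrite sk.
Qed.

End FacePolynomials.

Lemma sum_degree (T : finType) (e : rel T) (V : {set T}) : irreflexive e -> symmetric e ->
  (\sum_(v in V) #|[set u in V | e v u]| = 2 * #|cliquesn e V 2|)%N.
Proof.
move=> irr sym; rewrite -sum_ext_card // cliquesn1 big_imset /=; last by move=> x y _ _ /set1_inj.
apply: eq_bigr => v _; apply: eq_card => u; rewrite inE in_ext; congr andb.
by apply/idP/forall_inP => [vu w /set1P -> //|]; apply; rewrite set11.
Qed.

Lemma cliques_join (T I : finType) (e : rel T) (V : {set T}) (p : T -> I) (s : {set T}) :
  (forall u v, p u != p v -> e u v) ->
  (s \in cliques e V) = [forall i, s :&: [set v | p v == i] \in cliques e V].
Proof.
move=> cross; apply/idP/forallP => [sC i|h].
  by apply: cliques_sub sC; rewrite subsetIl.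
rewrite inE; apply/andP; split.
  apply/subsetP => v vs; have := h (p v); rewrite inE => /andP[/subsetP/(_ v) + _].
  by apply; rewrite !inE vs /=.
apply/cliqueP => u v us vs uv; have [puv|] := eqVneq (p u) (p v); last exact: cross.
have := h (p u); rewrite inE => /andP[_ /cliqueP]; apply; rewrite ?inE ?us ?vs //=.
by rewrite puv.
Qed.

Definition cycle_adj (m : nat) : rel 'I_m :=
  [rel x y | (x != y) && ((y == ordS x) || (x == ordS y))].

Lemma cycle_adj_sym m : symmetric (@cycle_adj m).
Proof. by move=> x y; rewrite /cycle_adj /= eq_sym orbC. Qed.

Lemma cycle_adj_irr m : irreflexive (@cycle_adj m).
Proof. by move=> x; rewrite /cycle_adj /= eqxx. Qed.

Lemma iter_ordS m k (x : 'I_m) : iter k (@ordS m) x = ((x + k) %% m)%N :> nat.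
Proof.
elim: k => [|k IH] /=; first by rewrite addn0 modn_small.
by rewrite IH addnS -[((x + k) %% m).+1]addn1 modnDml addn1.
Qed.

Lemma iter_ordS_neq m k (x : 'I_m) : (0 < k < m)%N -> iter k (@ordS m) x != x.
Proof.
case/andP=> k0 km; apply/eqP => /(congr1 (@nat_of_ord m)); rewrite iter_ordS => h.
have : (x + k == x + 0 %[mod m])%N by rewrite addn0 h modn_small.
by rewrite eqn_modDl mod0n modn_small // (gtn_eqF k0).
Qed.

Lemma cycle_clique_card m (s : {set 'I_m}) : (3 < m)%N -> clique (@cycle_adj m) s -> (#|s| <= 2)%N.
Proof.
move=> m3 /cliqueP sC; rewrite leqNgt; apply/negP => /card_gt2P[x [y [z [[xs ys zs] [xy yz zx]]]]].
wlog yE : x y xs ys xy yz zx / y = ordS x.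
  move=> W; have /andP[_ /orP[/eqP h|/eqP h]] := sC x y xs ys xy; first exact: (W x y).
  by apply: (W y x) => //; rewrite eq_sym.
have n1 := @iter_ordS_neq m 1 x _; have n2 := @iter_ordS_neq m 2 x _; have n3 := @iter_ordS_neq m 3 x _.
have /andP[_ /orP[/eqP zE|/eqP h]] := sC y z ys zs yz; last first.
  by move: zx; rewrite -(inj_eq (@ordS_inj m)) -h -yE eqxx.
have /andP[_ /orP[/eqP h|/eqP h]] := sC z x zs xs zx.
  by move: n3; rewrite /= -yE -zE -h eqxx m3 => /(_ isT).
by move: yz; rewrite yE -h eqxx.
Qed.

(** A cycle with more than three vertices has no triangle, so it is the clique complex of
    its graph. *)
Lemma cycle_facesE m : (3 < m)%N -> cycle_faces m = cliques (@cycle_adj m) [set: 'I_m].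
Proof.
move=> m3; apply/setP => s; rewrite [RHS]inE subsetT /= inE.
have n1 (x : 'I_m) : ordS x != x by apply: (@iter_ordS_neq m 1); rewrite /= ltnW // ltnW.
apply/orP/idP => [[/eqP ->|/existsP[j sj]]|sC]; first exact: clique0.
  apply: clique_sub sj _; apply/cliqueP => x y /set2P[]-> /set2P[]->; rewrite ?eqxx // /cycle_adj /= eqxx ?orbT.
    by rewrite eq_sym n1.
  by rewrite n1.
have [->|/set0Pn[x xs]] := eqVneq s set0; [by left|right].
have [sx|] := boolP (s \subset [set x]).
  by apply/existsP; exists x; apply: subset_trans sx _; rewrite sub1set set21.
case/subsetPn => y ys; rewrite in_set1 => yx.
wlog yE : x y xs ys yx / y = ordS x.
  move=> W; have /cliqueP/(_ y x ys xs yx)/andP[_ /orP[/eqP h|/eqP h]] := sC; last exact: (W x y).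
  by apply: (W y x) => //; rewrite eq_sym.
apply/existsP; exists x; rewrite -yE; have s2 := cycle_clique_card m3 sC.
suff <- : [set x; y] = s by [].
by apply/eqP; rewrite eqEcard subUset !sub1set xs ys /= cards2 eq_sym yx.
Qed.

Lemma cycle_degree m (x : 'I_m) : (3 < m)%N -> #|[set y in [set: 'I_m] | cycle_adj x y]| = 2%N.
Proof.
move=> m3; have -> : [set y in [set: 'I_m] | cycle_adj x y] = [set ordS x; ord_pred x].
  have n1 (z : 'I_m) : ordS z != z by apply: (@iter_ordS_neq m 1); rewrite /= ltnW // ltnW.
  apply/setP => y; rewrite in_set2 inE in_setT /=.
  apply/idP/orP => [/andP[_ /orP[->|/eqP ->]]|[/eqP ->|/eqP ->]]; first by left.
  - by right; rewrite ordSK.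
  - by rewrite /cycle_adj /= eqxx eq_sym n1.
  by rewrite /cycle_adj /= ord_predK eqxx orbT andbT -{1}(ord_predK x) n1.
rewrite cards2; have := @iter_ordS_neq m 2 (ord_pred x); rewrite /= ord_predK.
by move=> ->; rewrite // ltnW.
Qed.

(** The graph whose cliques are the faces of a join of cycles. *)
Definition join_adj (I : finType) (m : I -> nat) : rel {i : I & 'I_(m i)} :=
  fun x y => (tag x != tag y) || cycle_adj (tagged x) (tagged_as x y).

Section JoinOfCycles.
Variables (I : finType) (m : I -> nat).
Hypothesis m3 : forall i, (3 < m i)%N.
Notation T := {i : I & 'I_(m i)}.
Notation K := (join_complex (fun i => cycle_complex (m i))).

Lemma join_adj_Tagged i (x y : 'I_(m i)) :
  join_adj (Tagged (fun i => 'I_(m i)) x) (Tagged (fun i => 'I_(m i)) y) = cycle_adj x y.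
Proof. by rewrite /join_adj /= eqxx /= tagged_asE. Qed.

Lemma join_cycles_cliques : faces K = cliques (@join_adj I m) [set: T].
Proof.
apply/setP => s; rewrite [RHS]inE subsetT /= inE.
apply/forallP/cliqueP => [h u v us vs uv|sC i].
  rewrite /join_adj; case: eqVneq => //= tuv.
  case: u v us vs uv tuv => [i x] [j y] /= us vs uv tuv.
  move: y vs uv; rewrite -tuv => y vs uv; rewrite tagged_asE.
  have : [set x | Tagged (fun i => 'I_(m i)) x \in s] \in cycle_faces (m i) := h i.
  rewrite cycle_facesE // inE => /andP[_ /cliqueP]; apply; rewrite ?inE //.
  by apply: contraNneq uv => ->.
rewrite /cycle_complex /= cycle_facesE // inE subsetT /=; apply/cliqueP => x y; rewrite !inE => xs ys xy.
rewrite -join_adj_Tagged; apply: sC => //.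
by apply: contraNneq xy => /eqP; rewrite eq_Tagged.
Qed.

Lemma join_adj_sym : symmetric (@join_adj I m).
Proof.
move=> [i x] [j y]; rewrite /join_adj /= eq_sym; case: eqVneq => //= ij.
move: x; rewrite -ij => x; rewrite !tagged_asE; exact: cycle_adj_sym.
Qed.

Lemma join_adj_irr : irreflexive (@join_adj I m).
Proof. by move=> [i x]; rewrite join_adj_Tagged cycle_adj_irr. Qed.

Lemma fpoly_join_cycles (R : realFieldType) :
  fpoly R (faces K) = \prod_i quad (m i)%:R (m i)%:R.
Proof.
rewrite join_cycles_cliques (@fpoly_join R _ _ tag) => [|s]; last first.
  by apply: cliques_join => u v uv; rewrite /join_adj uv.
apply: eq_bigr => i _.
pose h := Tagged (fun i => 'I_(m i)) : 'I_(m i) -> T.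
have hinj : injective h by move=> x y /eqP; rewrite /h eq_Tagged => /eqP.
have -> : [set s in cliques (@join_adj I m) [set: T] | s \subset [set v | tag v == i]] =
   [set h @: s | s : {set 'I_(m i)} in cliques (@cycle_adj (m i)) [set: 'I_(m i)]].
  apply/setP => s; rewrite inE; apply/andP/imsetP => [[]|[t]].
    rewrite [s \in cliques _ _]inE => /andP[_ /cliqueP sC] /subsetP si.
    exists [set x | h x \in s].
      rewrite inE subsetT; apply/cliqueP => x y; rewrite !inE => xs ys xy.
      by rewrite -join_adj_Tagged; apply: sC => //; rewrite (inj_eq hinj).
    apply/setP => v; apply/idP/imsetP => [vs|[x + ->]]; last by rewrite inE.
    have := si v vs; case: v vs => [j x] vs; rewrite inE /= => /eqP ji.
    by move: x vs; rewrite ji => x vs; exists x; rewrite ?inE.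
  rewrite inE => /andP[_ /cliqueP tC] ->; split.
    rewrite inE subsetT; apply/cliqueP => _ _ /imsetP[x xt ->] /imsetP[y yt ->].
    by rewrite (inj_eq hinj) join_adj_Tagged => xy; exact: tC.
  by apply/subsetP => _ /imsetP[x _ ->]; rewrite inE /=.
rewrite (@fpoly_imset R _ _ _ setT) => [|x y _ _ /hinj //|s _]; last exact: subsetT.
rewrite fpoly_cliques_triangle_free => [|s]; last first.
  by rewrite inE => /andP[_]; apply: cycle_clique_card.
rewrite cardsT card_ord; congr (quad _ _%:R); apply: double_inj; rewrite -mul2n.
rewrite -(sum_degree _ (@cycle_adj_irr _) (@cycle_adj_sym _)).
rewrite (eq_bigr (fun=> 2)) => [|x _]; last exact: cycle_degree.
by rewrite sum_nat_const cardsT card_ord muln2.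
Qed.

End JoinOfCycles.

Section LowerBound.
Variable R : realFieldType.

(** Keeping only the linear terms of the factors. *)
Lemma coef_quad_prod_ge (I : finType) (P : {pred I}) (x : R) (a b : I -> R) k : 0 <= x ->
  (forall i, x <= a i) -> (forall i, 0 <= b i) ->
  'C(#|P|, k)%:R * x ^+ k <= (\prod_(i in P) quad (a i) (b i))`_k.
Proof.
move=> x0 xa b0; rewrite cardE -big_enum /=.
elim: (enum P) k => [|i s IH] k /=.
  by rewrite big_nil coef1 bin0n; case: k => [|k] /=; rewrite ?mul0r ?mul1r ?expr0.
rewrite big_cons coef_quad_mul coefXM coefXnM; set q := \prod_(_ <- _) _ in IH *.
have q0 j : 0 <= q`_j by apply: le_trans (IH j); rewrite mulr_ge0 ?exprn_ge0.
have t0 : 0 <= b i * (if (k < 2)%N then 0 else q`_(k - 2)) by rewrite mulr_ge0 //; case: ifP.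
apply: (@le_trans _ _ (q`_k + a i * (if k == 0%N then 0 else q`_k.-1))); last by rewrite lerDl.
case: k {t0} => [|k] /=; first by have := IH 0%N; rewrite !bin0 mulr0 addr0.
rewrite binS natrD mulrDl lerD // exprS mulrCA; apply: le_trans (_ : x * q`_k <= _).
  by rewrite ler_wpM2l.
by rewrite ler_wpM2r.
Qed.

Lemma pred_expr_ge (x : R) k : 1 <= x -> x ^+ k - k%:R * x ^+ k.-1 <= (x - 1) ^+ k.
Proof.
move=> x1; elim: k => [|k IH]; first by rewrite /= !expr0 mulr1 subr0.
have x0 : 0 <= x - 1 by rewrite subr_ge0.
rewrite [X in _ <= X]exprS; apply: le_trans (ler_wpM2l x0 IH).
case: k IH => [_|k _]; first by rewrite /= expr0 expr1; lra.
rewrite /= !exprS -(natr1 k.+1); have := exprn_ge0 k (_ : 0 <= x) => /(_ ltac:(lra)).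
have := ler0n R k.+1; set y := x ^+ k; set m : R := k.+1%:R => m0 y0.
have := mulr_ge0 m0 y0; lra.
Qed.

Lemma coef_balanced_cycles_ge (r n k : nat) : (0 < r)%N -> (r <= n)%N ->
  'C(r, k)%:R * (n%:R / r%:R) ^+ k - 'C(r, k)%:R * k%:R * n%:R ^+ k.-1 <=
  (cycles_poly R (@balanced_size r n))`_k :> R.
Proof.
move=> r0 rn; set x : R := n%:R / r%:R.
have rr : 0 < r%:R :> R by rewrite ltr0n.
have x1 : 1 <= x by rewrite /x ler_pdivlMr // mul1r ler_nat.
have xn : x <= n%:R by rewrite /x ler_pdivrMr // ler_peMr // ler1n.
have xq : x - 1 <= (n %/ r)%:R.
  rewrite lerBlDr /x ler_pdivrMr // natr1 -natrM ler_nat mulSn.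
  by rewrite {1}(divn_eq n r) addnC leq_add2r ltnW // ltn_pmod.
have := @coef_quad_prod_ge 'I_r predT (x - 1) (fun i => (balanced_size n i)%:R)
  (fun i => (balanced_size n i)%:R) k; rewrite card_ord -/(cycles_poly R (balanced_size n)) => h.
apply: le_trans (h _ _ _); last 3 first.
- by rewrite subr_ge0.
- by move=> i; apply: le_trans xq _; rewrite ler_nat leq_addr.
- by [].
rewrite -mulrA -mulrBr ler_wpM2l //; apply: le_trans (pred_expr_ge k x1).
have x0 : 0 <= x by apply: le_trans x1.
by rewrite lerD2l lerN2 ler_wpM2l // lerXn2r // nnegrE.
Qed.

Variables (c : nat -> R) (cm1 : R) (l : nat).
Hypothesis l0 : (0 < l)%N.
Hypothesis cl0 : 0 < c l.
Local Notation Lam := (face_functional c cm1 l).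

(** All coefficients below the leading one contribute at most [n ^ l], so comparing
    values of the functional compares leading coefficients up to that order. *)
Lemma leading_coef_ge (n : R) (p q : {poly R}) : 1 <= n ->
  (forall k, 0 <= p`_k <= n ^+ k) -> (forall k, 0 <= q`_k <= n ^+ k) -> Lam q <= Lam p ->
  q`_l.+1 - 2 * (\sum_(i < l) `|c i| + `|cm1|) / c l * n ^+ l <= p`_l.+1.
Proof.
move=> n1 pn qn.
have split_lead (s : {poly R}) : Lam s = face_functional c cm1 l.-1 s + c l * s`_l.+1.
  by rewrite /face_functional prednK // big_ord_recr /= addrAC.
set S := \sum_(i < l) _ + _.
have low (s : {poly R}) : (forall k, 0 <= s`_k <= n ^+ k) -> `|face_functional c cm1 l.-1 s| <= S * n ^+ l.
  move=> sn; have := @face_functional_bound R c cm1 l.-1 s (n ^+ l); rewrite prednK //; apply=> k kl.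
  have /andP[s0 sk] := sn k; rewrite ger0_norm //; apply: le_trans sk _.
  by rewrite ler_weXn2l.
have := low _ pn; have := low _ qn; rewrite !ler_norml !split_lead => /andP[q1 q2] /andP[p1 p2] h.
have h' : c l * q`_l.+1 - 2 * (S * n ^+ l) <= c l * p`_l.+1 by move: q1 q2 p1 p2 h; lra.
rewrite -(ler_pM2l cl0) mulrBr; apply: le_trans h'; rewrite lerD2l lerN2 le_eqVlt; apply/orP; left; apply/eqP.
by field; rewrite gt_eqF.
Qed.

End LowerBound.

Lemma card_join_cycles (r n : nat) : (0 < r)%N ->
  #|{: {i : 'I_r & 'I_(balanced_size n i)}}| = n.
Proof.
move=> r0; rewrite card_tagged sumnE big_map big_enum /=.
by rewrite -[RHS](sum_balanced_size n r0); apply: eq_bigr => i _; rewrite card_ord.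
Qed.

(** * Completing the graph between the parts *)

Lemma card_cliques_through (T : finType) (e : rel T) (V : {set T}) u v k :
  irreflexive e -> symmetric e -> u != v ->
  (#|[set s in cliquesn e V k.+2 | (u \in s) && (v \in s)]| <= #|V| ^ k)%N.
Proof.
move=> irr sym uv; apply: leq_trans (card_cliquesn_le irr sym V k).
rewrite -(card_in_imset (f := fun s : {set T} => s :\ u :\ v)).
  apply/subset_leq_card/subsetP => _ /imsetP[s + ->]; rewrite inE => /and3P[sC us vs].
  have /cliquesnP[sV sc sk] := sC; apply/cliquesnP; split.
  - by apply: subset_trans sV; apply: subset_trans (subsetDl _ _) (subsetDl _ _).
  - by apply: clique_sub sc; apply: subset_trans (subsetDl _ _) (subsetDl _ _).
  have vs' : v \in s :\ u by rewrite !inE eq_sym uv.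
  by move: sk; rewrite (cardsD1 u) us (cardsD1 v) vs' => -[].
move=> s t; rewrite !inE => /and3P[_ us vs] /and3P[_ ut vt] E.
have vs' : v \in s :\ u by rewrite !inE eq_sym uv.
have vt' : v \in t :\ u by rewrite !inE eq_sym uv.
by rewrite -(setD1K us) -(setD1K ut) -(setD1K vs') -(setD1K vt') E.
Qed.

Section Compare.
Variables (R : realFieldType) (r l : nat) (cf : nat -> R) (cm1 : R).
Hypothesis l0 : (0 < l)%N.
Hypothesis lr : (l < r)%N.
Hypothesis cl0 : 0 < cf l.
Local Notation Lam := (face_functional cf cm1 l).

(** The graph that is compared with the given one: all pairs from different parts become
    adjacent, and bad vertices lose all neighbours in their own part. *)
Definition completed (T : finType) (e : rel T) (p : T -> 'I_r) (B : {set T}) : rel T :=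
  fun u v => (p u != p v) || [&& u \notin B, v \notin B & e u v].

Lemma fpoly_setD (T : finType) (K L : {set {set T}}) :
  fpoly R K + fpoly R (L :\: K) = fpoly R L + fpoly R (K :\: L).
Proof.
rewrite /fpoly (big_setID L) /= [X in _ = X + _](big_setID K) /= setIC -!addrA; congr (_ + _).
exact: addrC.
Qed.

(** Each missing cross pair creates many new cliques, because a clique with at most [l]
    vertices extends in at least [c * n] ways into a part that it avoids. The cliques that
    get lost contain a bad vertex and one of its few neighbours in its own part. Each bad
    vertex misses at least [eps / 2 * n] cross pairs and loses of the order of
    [eps' * n] edges at most, so the gain prevails when [eps'] is small compared
    with [eps]. *)
Lemma completed_compare (c eps : R) : 0 < c -> 0 < eps ->
  exists e'0 n0 : R, 0 < e'0 /\
  forall (eps' : R) (T : finType) (e : rel T) (V B : {set T}) (p : T -> 'I_r),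
  irreflexive e -> symmetric e -> let n : R := #|V|%:R in
  0 < eps' -> eps' <= e'0 -> n0 <= n ->
  near_turan n c eps eps' e V p B ->
  Lam (fpoly R (cliques e V)) < Lam (fpoly R (cliques (completed e p B) V)) \/
  (B = set0 /\ {in V &, forall u v, completed e p B u v -> e u v}).
Proof.
move=> c0 eps0; have [x0 x00 lead] := face_functional_leading cm1 cl0.
pose S := \sum_(i < l.+1) `|cf i| + `|cm1|.
have S0 : 0 <= S by rewrite addr_ge0 // sumr_ge0.
have r0 : 0 < r%:R :> R by rewrite ltr0n; apply: leq_ltn_trans lr.
pose m := cf l / 2 * (c / r%:R) ^+ l.-1 * (eps / 2).
have m0 : 0 < m.
  apply: mulr_gt0; last exact: divr_gt0.
  by apply: mulr_gt0; [exact: divr_gt0|apply/exprn_gt0/divr_gt0].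
exists (m / (2 * S + 1)), (1 + x0 * r%:R / c).
have S1 : 0 < 2 * S + 1 by lra.
split; first by rewrite divr_gt0.
move=> eps' T e V B p irr sym n eps'0 eps'm nn [BV big miss badP Bs].
have t0 : 0 <= x0 * r%:R / c by apply: divr_ge0; [apply: mulr_ge0|]; exact: ltW.
have n1 : 1 <= n by lra.
have n0 : 0 < n by lra.
(* the factor by which the number of new cliques grows with each vertex *)
pose x := c * n / r%:R.
have x0x : x0 <= x.
  rewrite /x ler_pdivlMr // [c * n]mulrC; have : x0 * r%:R / c <= n by lra.
  by rewrite ler_pdivrMr.
pose g := completed e p B.
(* D consists of the new cliques and D' of the lost ones *)
pose D := cliques g V :\: cliques e V; pose D' := cliques e V :\: cliques g V.
have LE : Lam (fpoly R (cliques g V)) = Lam (fpoly R (cliques e V)) + (Lam (fpoly R D) - Lam (fpoly R D')).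
  have := congr1 Lam (fpoly_setD (cliques e V) (cliques g V)); rewrite !face_functionalD -/D -/D'.
  lra.
have gsym : symmetric g by move=> u v; rewrite /g /completed eq_sym sym andbCA.
have Dpos k : 0 <= (fpoly R D)`_k by rewrite coef_fpoly.
(* a new clique stays new when it grows into a part that it avoids *)
have Dgrow k : (k <= l)%N -> x * (fpoly R D)`_k <= (fpoly R D)`_k.+1.
  move=> kl; have kr : (k < r)%N by apply: leq_ltn_trans lr.
  rewrite !coef_fpoly; set Dk := [set s in D | _]; set Dk1 := [set s in D | _].
  have h : c * n * #|Dk|%:R <= k.+1%:R * #|Dk1|%:R.
    apply: grow_count => s; rewrite inE => /andP[sD /eqP sk] //.
    have [|i si] := @free_part _ r s p; first by rewrite sk.
    apply: le_trans (big i) _; rewrite ler_nat; apply/subset_leq_card/subsetP => v.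
    rewrite inE in_setD => /andP[/andP[_ vV] /eqP pv].
    have vs : v \notin s by apply/negP => /si; rewrite pv eqxx.
    move: sD; rewrite in_setD inE vs => /andP[sCe sCg]; rewrite inE cardsU1 vs sk eqxx andbT /= in_setD.
    move: sCg; rewrite [s \in cliques g V]inE => /andP[sV sC]; apply/andP; split.
      by apply: contra sCe; apply: cliques_sub; rewrite subsetUr.
    rewrite inE subUset sub1set vV sV cliqueU1 // sC /=; apply/forall_inP => u us.
    by rewrite /g /completed pv si.
  rewrite /x mulrAC ler_pdivrMr //; apply: le_trans h _; rewrite mulrC ler_wpM2l // ler_nat.
  exact: leq_trans kr.
have Dlead := lead x (fpoly R D) x0x Dpos Dgrow.
have xpos : 0 < x by rewrite divr_gt0 // mulr_gt0.
have D2 : x ^+ l.-1 * (fpoly R D)`_2 <= (fpoly R D)`_l.+1.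
  have ind k : (k < l)%N -> x ^+ k * (fpoly R D)`_2 <= (fpoly R D)`_k.+2.
    elim: k => [|k IH] kl; first by rewrite mul1r.
    rewrite exprS -mulrA; apply: le_trans (Dgrow _ kl).
    by rewrite ler_pM2l // IH // ltnW.
  by have := ind l.-1; rewrite prednK //; apply.
have [B0|Bn0] := eqVneq B set0.
  have D'0 : D' = set0.
    apply/eqP; rewrite setD_eq0; apply/subsetP => s; rewrite !inE => /andP[-> /cliqueP sC].
    apply/cliqueP => u v us vs uv; rewrite /g /completed B0 !inE /=.
    by rewrite (sC u v us vs uv) orbT.
  have [DD|DD] := eqVneq ((fpoly R D)`_2) 0; [right|left].
    split=> // u v uV vV guv; apply/negPn/negP => euv.
    move/eqP: DD; rewrite coef_fpoly pnatr_eq0 cards_eq0 => /eqP/setP/(_ [set u; v]).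
    have uv : u != v.
      by apply: contraTneq guv => <-; rewrite /completed eqxx irr !andbF.
    rewrite !inE cards2 uv subUset !sub1set uV vV /= andbT => /negbT/negP; apply.
    apply/andP; split.
      by apply: contra euv => /cliqueP; apply; rewrite ?set21 ?set22.
    by apply/cliqueP => a b /set2P[]-> /set2P[]->; rewrite ?eqxx // => _; rewrite -/g gsym.
  rewrite LE D'0 ltrDl {2}/fpoly big_set0.
  rewrite (_ : Lam 0 = 0) ?subr0; last first.
    by rewrite -(scale0r (0 : {poly R})) face_functionalZ mul0r.
  apply: lt_le_trans Dlead; rewrite mulr_gt0 ?divr_gt0 //; apply: lt_le_trans D2.
  by rewrite mulr_gt0 ?exprn_gt0 // lt_neqAle eq_sym DD Dpos.
left; rewrite LE ltrDl subr_gt0.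
have b0 : 0 < #|B|%:R :> R by rewrite ltr0n card_gt0.
(* the missing cross pairs at bad vertices are new edges *)
have low2 : #|B|%:R * (eps / 2 * n) <= (fpoly R D)`_2.
  rewrite mulrC mulr_natr -sumr_const.
  apply: (@le_trans _ _ (\sum_(w in B) #|[set u in V :\: B | (p u != p w) && ~~ e w u]|%:R)).
    by apply: ler_sum => w /badP[].
  rewrite -natr_sum coef_fpoly ler_nat.
  pose P := [set q : T * T | (q.1 \in B) && (q.2 \in [set u in V :\: B | (p u != p q.1) && ~~ e q.1 u])].
  have -> : (\sum_(w in B) #|[set u in V :\: B | (p u != p w) && ~~ e w u]| = #|P|)%N.
    rewrite -[RHS]sum1_card (eq_bigl (fun q => (q.1 \in B) && (q.2 \in [set u in V :\: B | (p u != p q.1) && ~~ e q.1 u]))).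
      rewrite -(pair_big_dep (fun w => w \in B) (fun w u => u \in [set u in V :\: B | (p u != p w) && ~~ e w u]) (fun _ _ => 1%N)) /=.
      by apply: eq_bigr => w _; rewrite sum1_card.
    by move=> q; rewrite [LHS]inE.
  rewrite -(card_in_imset (f := fun q : T * T => [set q.1; q.2])); last first.
    move=> [w u] [w' u']; rewrite !inE /= => /and3P[wB /andP[uB _] _] /and3P[w'B /andP[u'B _] _] E.
    have ww : w = w'.
      have : w \in [set w'; u'] by rewrite -E set21.
      by case/set2P => // wu; rewrite -wu wB in u'B.
    have uu : u = u'.
      have : u \in [set w'; u'] by rewrite -E set22.
      by case/set2P => // uw; rewrite uw w'B in uB.
    by rewrite ww uu.
  apply/subset_leq_card/subsetP => _ /imsetP[[w u] + ->]; rewrite !inE /=.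
  case/and3P => wB /andP[uB uV] /andP[pwu ewu].
  have wu : w != u by apply: contraNneq uB => <-.
  rewrite cards2 wu !subUset !sub1set uV (subsetP BV) //= eqxx andbT.
  apply/andP; split.
    by apply: contra ewu => /cliqueP; apply; rewrite ?set21 ?set22.
  by apply/cliqueP => a b /set2P[]-> /set2P[]->; rewrite ?eqxx // => _; rewrite /g /completed ?pwu // eq_sym pwu.
have up : `|Lam (fpoly R D')| <= S * (#|B|%:R * (2 * eps' * n) * n ^+ l.-1).
  apply: face_functional_bound => k kl; rewrite ger0_norm ?coef_fpoly //.
  (* the possible other ends of lost edges at w *)
  pose P w := [set v in V :\: B | (p v == p w) && e w v] :|: B.
  have Pw w : w \in B -> #|P w|%:R <= 2 * eps' * n.
    move=> wB; apply: (@le_trans _ _ (eps' * n + eps' * n)); last by lra.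
    apply: (@le_trans _ _ (#|[set v in V :\: B | (p v == p w) && e w v]|%:R + #|B|%:R)).
      by rewrite -natrD ler_nat leq_card_setU.
    by apply: lerD => //; have [] := badP w wB.
  pose cover := \bigcup_(w in B) \bigcup_(v in P w :\ w) [set s in cliquesn e V k | (w \in s) && (v \in s)].
  apply: (@le_trans _ _ #|cover|%:R).
    rewrite ler_nat; apply/subset_leq_card/subsetP => s; rewrite inE => /andP[sD sk].
    move: sD; rewrite in_setD => /andP[sg se].
    have /cliquesnP[sV /cliqueP sC _] : s \in cliquesn e V k by rewrite inE se.
    have [u [v [us vs uv guv]]] : exists u v, [/\ u \in s, v \in s, u != v & ~~ g u v].
      apply: contrapT => h; case/negP: sg; rewrite inE sV; apply/cliqueP => u v us vs uv.
      by apply/negPn/negP => guv; apply: h; exists u, v.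
    have euv := sC u v us vs uv.
    have sk' : s \in cliquesn e V k by rewrite inE se.
    move: guv; rewrite /g /completed negb_or negbK => /andP[/eqP puv].
    rewrite euv andbT negb_and !negbK => uvB.
    wlog uB : u v us vs uv euv puv uvB / u \in B.
      move=> W; case/orP: (uvB) => h; first exact: (W u v).
      apply: (W v u) => //; rewrite ?h //; [by rewrite eq_sym|by rewrite sym].
    apply/bigcupP; exists u => //; apply/bigcupP; exists v; last by rewrite inE sk' us vs.
    rewrite !inE eq_sym uv /= (subsetP sV) // andbT puv eqxx euv /= andbT.
    by case: (v \in B).
  have [k2|] := leqP 2 k; last first.
    move=> k2; rewrite (_ : cover = set0) ?cards0.
      by rewrite !mulr_ge0 ?exprn_ge0 // ltW.
    apply/setP => s; rewrite in_set0; apply/negP => /bigcupP[w _ /bigcupP[v]].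
    rewrite in_setD1 inE => /andP[vw _] /and3P[/cliquesnP[_ _ sk] ws vs].
    have : (#|[set w; v]| <= #|s|)%N by rewrite subset_leq_card // subUset !sub1set ws.
    by rewrite cards2 eq_sym vw sk leqNgt k2.
  rewrite /cover {cover}; case: k kl k2 => [|[|k]] // kl _.
  apply: (@le_trans _ _ (\sum_(w in B) \sum_(v in P w :\ w) n ^+ k)).
    apply: (@le_trans _ _ (\sum_(w in B) #|\bigcup_(v in P w :\ w) [set s in cliquesn e V k.+2 | (w \in s) && (v \in s)]|%:R)).
      by rewrite -natr_sum ler_nat card_bigcup_le.
    apply: ler_sum => w wB.
    apply: (@le_trans _ _ (\sum_(v in P w :\ w) #|[set s in cliquesn e V k.+2 | (w \in s) && (v \in s)]|%:R)).
      by rewrite -natr_sum ler_nat card_bigcup_le.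
    apply: ler_sum => v; rewrite in_setD1 => /andP[vw _].
    by rewrite -natrX ler_nat card_cliques_through // eq_sym.
  rewrite -mulrA mulr_natl -sumr_const; apply: ler_sum => w wB.
  rewrite sumr_const -[_ *+ _]mulr_natl; apply: ler_pM => //; first by rewrite exprn_ge0 // ltW.
    by apply: le_trans (Pw w wB); rewrite ler_nat subset_leq_card // subsetDl.
  by rewrite ler_weXn2l //; case: (l) l0 kl.
apply: (@le_lt_trans _ _ (S * (#|B|%:R * (2 * eps' * n) * n ^+ l.-1))).
  by apply: le_trans up; exact: ler_norm.
apply: (@lt_le_trans _ _ (cf l / 2 * (x ^+ l.-1 * (#|B|%:R * (eps / 2 * n))))); last first.
  apply: le_trans Dlead; rewrite ler_wpM2l ?(ltW (divr_gt0 cl0 _)) //; apply: le_trans D2.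
  by rewrite ler_pM2l ?exprn_gt0.
have -> : x ^+ l.-1 = (c / r%:R) ^+ l.-1 * n ^+ l.-1 by rewrite -exprMn /x mulrAC.
have -> : cf l / 2 * ((c / r%:R) ^+ l.-1 * n ^+ l.-1 * (#|B|%:R * (eps / 2 * n))) =
   m * (#|B|%:R * n * n ^+ l.-1) by rewrite /m; ring.
have -> : S * (#|B|%:R * (2 * eps' * n) * n ^+ l.-1) = 2 * S * eps' * (#|B|%:R * n * n ^+ l.-1) by ring.
rewrite ltr_pM2r ?mulr_gt0 ?exprn_gt0 //.
apply: (@lt_le_trans _ _ ((2 * S + 1) * eps')); first by rewrite ltr_pM2r //; lra.
by move: eps'm; rewrite ler_pdivlMr // mulrC.
Qed.

End Compare.

Section CompletedGraph.
Variables (R : realFieldType) (r : nat) (T : finType) (e : rel T) (V B : {set T}).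
Variable p : T -> 'I_r.
Hypothesis irr : irreflexive e.
Hypothesis sym : symmetric e.
Notation good i := [set v in V :\: B | p v == i].
Hypothesis deg2 : forall i v, v \in good i -> (#|[set u in good i | e v u]| <= 2)%N.
Hypothesis triangle_free : forall i x y z, x \in good i -> y \in good i -> z \in good i ->
  e x y -> e y z -> e x z -> False.
Notation g := (completed e p B).
Definition class i := [set v in V | p v == i].

Lemma completed_irr : irreflexive g.
Proof. by move=> v; rewrite /completed eqxx irr !andbF. Qed.

Lemma completed_sym : symmetric g.
Proof. by move=> u v; rewrite /completed eq_sym sym andbCA. Qed.

Lemma completed_class i u v : u \in class i -> v \in class i -> g u v ->
  [/\ u \in good i, v \in good i & e u v].
Proof.
rewrite !inE => /andP[uV /eqP pu] /andP[vV /eqP pv].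
by rewrite /completed pu pv eqxx /= => /and3P[-> -> ->]; rewrite uV vV.
Qed.

(** Inside a part the completed graph only has edges between good vertices, which span no
    triangle. *)
Lemma class_clique_card i s : s \in cliques g (class i) -> (#|s| <= 2)%N.
Proof.
rewrite inE => /andP[/subsetP si /cliqueP sC]; rewrite leqNgt; apply/negP.
case/card_gt2P => x [y [z [[xs ys zs] [xy yz zx]]]].
have [xi yi exy] := completed_class (si x xs) (si y ys) (sC x y xs ys xy).
have [_ zi eyz] := completed_class (si y ys) (si z zs) (sC y z ys zs yz).
rewrite eq_sym in zx.
have [_ _ exz] := completed_class (si x xs) (si z zs) (sC x z xs zs zx).
exact: triangle_free xi yi zi exy eyz exz.
Qed.

Lemma class_degree i v : v \in class i -> (#|[set u in class i | g v u]| <= 2)%N.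
Proof.
move=> vi; have [vg|vg] := boolP (v \in good i); last first.
  rewrite eq_card0 // => u; apply/negP; rewrite inE => /andP[ui gvu].
  by have [] := completed_class vi ui gvu; rewrite (negbTE vg).
apply: leq_trans (deg2 vg); apply/subset_leq_card/subsetP => u.
rewrite inE => /andP[ui gvu]; have [_ ug evu] := completed_class vi ui gvu.
by rewrite inE ug.
Qed.

(** Degrees are at most 2. *)
Lemma class_edges i : (#|cliquesn g (class i) 2| <= #|class i|)%N.
Proof.
rewrite -(leq_pmul2l (ltn0Sn 1)) -(sum_degree _ completed_irr completed_sym).
rewrite mulnC -sum_nat_const; apply: leq_sum => v vi; exact: class_degree.
Qed.

Lemma class_edges_eq i v : #|cliquesn g (class i) 2%N| = #|class i| -> v \in class i ->
  #|[set u in class i | g v u]| = 2%N.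
Proof.
move=> E vi; apply/eqP; rewrite eqn_leq class_degree // leqNgt; apply/negP => lt.
have := sum_degree (class i) completed_irr completed_sym; rewrite E.
have : (\sum_(v in class i) #|[set u in class i | g v u]| < \sum_(v in class i) 2)%N.
  rewrite (bigD1 v) //= [X in (_ < X)%N](bigD1 v) //= -addSn leq_add //.
  by apply: leq_sum => u /andP[ui _]; exact: class_degree.
by rewrite sum_nat_const mulnC => + h; rewrite h ltnn.
Qed.

(** The completed graph is the join of the triangle-free graphs on its parts. *)
Lemma fpoly_completed : fpoly R (cliques g V) =
  \prod_i quad #|class i|%:R #|cliquesn g (class i) 2%N|%:R.
Proof.
rewrite (@fpoly_join R _ _ p) => [|s]; last first.
  by apply: cliques_join => u v uv; rewrite /completed uv.
apply: eq_bigr => i _; rewrite -(fpoly_cliques_triangle_free R (@class_clique_card i)).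
congr (fpoly R _); apply/setP => s; rewrite !inE; apply/andP/andP.
  move=> [/andP[/subsetP sV ->] /subsetP si]; split=> //; apply/subsetP => v vs.
  by have := si v vs; rewrite !inE sV.
by move=> [/subsetP si ->]; split; [rewrite andbT|]; apply/subsetP => v /si; rewrite !inE => /andP[].
Qed.

Lemma sum_class : (\sum_i #|class i| = #|V|)%N.
Proof.
rewrite -sum1_card (partition_big p xpredT) //=; apply: eq_bigr => i _.
by rewrite -sum1_card; apply: eq_bigl => v; rewrite inE.
Qed.

End CompletedGraph.

(** * Recognising a join of cycles *)

Local Open Scope nat_scope.

Section TwoRegular.
Variables (T : finType) (e : rel T) (W : {set T}).
Hypothesis irr : irreflexive e.
Hypothesis sym : symmetric e.
Hypothesis deg2 : forall v, v \in W -> #|[set u in W | e v u]| = 2.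

Lemma no_three_neighbours v a b c : v \in W -> a \in W -> b \in W -> c \in W ->
  e v a -> e v b -> e v c -> a != b -> b != c -> c != a -> False.
Proof.
move=> vW aW bW cW va vb vc ab bc ca.
have : (2 < #|[set u in W | e v u]|)%N.
  by apply/card_gt2P; exists a, b, c; rewrite !inE aW bW cW va vb vc.
by rewrite deg2.
Qed.

Lemma two_neighbours v : v \in W -> exists a b, [/\ a \in W, b \in W, e v a, e v b & a != b].
Proof.
move=> vW; have := deg2 vW; move/eqP/cards2P => [a [b [ab E]]]; exists a, b.
have : a \in [set u in W | e v u] by rewrite E set21.
have : b \in [set u in W | e v u] by rewrite E set22.
by rewrite !inE => /andP[bW vb] /andP[aW va].
Qed.

Lemma next_next_neq (s : seq T) u : uniq s -> (2 < size s)%N -> u \in s ->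
  next s u != prev s u.
Proof.
move=> us s2 uIs; apply/eqP => np; case: (rot_to uIs) => i q def_q.
have : next (rot i s) u = prev (rot i s) u by rewrite next_rot // prev_rot.
have : uniq (rot i s) by rewrite rot_uniq.
have : (2 < size (rot i s))%N by rewrite size_rot.
rewrite def_q; case: q {def_q} => [|a [|b q]] // _ /and3P[uq aq _].
rewrite next_nth prev_nth mem_head (memNindex uq) /= eqxx /= => E.
by case/negP: aq; rewrite E -[size q]/((size (b :: q)).-1) nth_last /= mem_last.
Qed.

Hypothesis connW : forall S : {set T}, S \subset W -> S != set0 ->
  (forall u v, u \in S -> v \in W -> e u v -> v \in S) -> S = W.

Lemma longest_path : W != set0 -> exists x t,
  [/\ uniq (x :: t), {subset x :: t <= W}, path e x t &
   forall y s, uniq (y :: s) -> {subset y :: s <= W} -> path e y s -> (size s <= size t)%N].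
Proof.
case/set0Pn => v0 v0W.
pose P k := [exists s : k.-tuple T, [exists x, [&& uniq (x :: s), all (mem W) (x :: s) & path e x s]]].
have PP x (s : seq T) : uniq (x :: s) -> {subset x :: s <= W} -> path e x s -> P (size s).
  move=> us sW ps; apply/existsP; exists (in_tuple s); apply/existsP; exists x.
  by rewrite us ps andbT; apply/allP.
have exP : exists k, P k.
  by exists 0; apply: (PP v0 [::]) => // y; rewrite inE => /eqP ->.
have ubP k : P k -> (k <= #|T|)%N.
  case/existsP => s /existsP[x /and3P[us _ _]].
  have := max_card (mem (x :: s)); rewrite (card_uniqP us) /= size_tuple; exact: ltnW.
case: (ex_maxnP exP ubP) => k /existsP[t /existsP[x /and3P[ut /allP tW pt]]] kmax.
exists x, t; split=> // y s us sW ps; rewrite size_tuple; apply: kmax; exact: PP ps.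
Qed.

(** In a longest path all neighbours of the first vertex lie on the path, and an inner
    vertex already has two neighbours there, so the second neighbour of the first
    vertex is the last one. The path thus closes up to a cycle, which by 2-regularity
    has no edge leaving it. *)
Lemma two_regular_cycle : W != set0 -> exists s : seq T,
  [/\ uniq s, s =i W, cycle e s & (2 < size s)%N].
Proof.
move=> /longest_path[x [t [ut tW pt longest]]].
have xW : x \in W by apply: tW; rewrite mem_head.
have nb y : y \in W -> e x y -> y \in t.
  move=> yW xy; apply/negPn/negP => yt.
  suff : (size (x :: t) <= size t)%N by rewrite ltnn.
  have yx : y \notin x :: t.
    rewrite inE negb_or yt andbT; apply/eqP => yx; move: xy; by rewrite yx irr.
  apply: (longest y (x :: t)).
  - by rewrite cons_uniq yx.
  - by move=> z; rewrite inE => /predU1P[->//|/tW].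
  by rewrite -[path e y (x :: t)]/(e y x && path e x t) sym xy.
have last_adj y j : y \in W -> e x y -> y = nth x t j -> (0 < j < size t)%N -> j = (size t).-1.
  move=> yW xy yj /andP[j0 jt]; apply/eqP/negPn/negP => jl.
  have jt1 : (j.+1 < size t)%N by move: jl jt; clear; lia.
  have jp : (j.-1 < size t)%N by move: jt; clear; lia.
  have tnW i : (i < size t)%N -> nth x t i \in W by move=> it; apply: tW; rewrite inE mem_nth ?orbT.
  have /andP[xt utt] : (x \notin t) && uniq t by [].
  have nx i : (i < size t)%N -> x != nth x t i by move=> it; apply: contraNneq xt => ->; rewrite mem_nth.
  have st := pathP x pt.
  apply: (@no_three_neighbours y x (nth x t j.-1) (nth x t j.+1)) => //.
  - exact: tnW.
  - exact: tnW.
  - by rewrite sym.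
  - rewrite sym yj; have := st j jt; case: (j) j0 => // j' _; exact.
  - by rewrite yj; have := st j.+1 jt1.
  - exact: nx.
  - by rewrite nth_uniq //; move: j0; clear; lia.
  - by rewrite eq_sym nx.
have [a [b [aW bW xa xb ab]]] := two_neighbours xW.
have lastE : e x (last x t) /\ (1 < size t)%N.
  have Ea := esym (nth_index x (nb a aW xa)); have Eb := esym (nth_index x (nb b bW xb)).
  have ia : (index a t < size t)%N by rewrite index_mem nb.
  have ib : (index b t < size t)%N by rewrite index_mem nb.
  case: (posnP (index a t)) => a0.
    have b0 : (0 < index b t)%N.
      by rewrite lt0n; apply: contraNneq ab => b0; rewrite Ea Eb a0 b0.
    have bl : index b t = (size t).-1 by apply: (last_adj b); rewrite ?b0.
    split; last by move: ib b0; clear; lia.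
    by rewrite -nth_last -bl -Eb.
  have al : index a t = (size t).-1 by apply: (last_adj a); rewrite ?a0.
  split; last by move: ia a0; clear; lia.
  by rewrite -nth_last -al -Ea.
have cyc : cycle e (x :: t) by rewrite /= rcons_path pt sym; case: lastE.
suff sW : [set y in x :: t] = W.
  exists (x :: t); split=> //; last by case: lastE.
  by move=> y; rewrite -sW [RHS]inE.
apply: connW.
- by apply/subsetP => y; rewrite inE; exact: tW.
- by apply/set0Pn; exists x; rewrite [_ \in _]inE mem_head.
move=> u v; rewrite [u \in _]inE [v \in [set _ | _]]inE => us vW uv; apply/negPn/negP => vs.
have nu : next (x :: t) u \in x :: t by rewrite mem_next.
have pu : prev (x :: t) u \in x :: t by rewrite mem_prev.
apply: (@no_three_neighbours u v (next (x :: t) u) (prev (x :: t) u)) => //; try exact: tW.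
- exact: (next_cycle cyc us).
- by rewrite sym; exact: (prev_cycle cyc us).
- by apply: contraNneq vs => ->.
- by apply: next_next_neq => //; case: lastE.
by apply: contraNneq vs => <-.
Qed.

End TwoRegular.

Lemma index_next (T : eqType) (s : seq T) u : uniq s -> u \in s ->
  index (next s u) s = (index u s).+1 %% size s.
Proof.
move=> us uIs; rewrite next_nth uIs; case: s us uIs => // x t us ut.
have : index u (x :: t) < size (x :: t) by rewrite index_mem.
rewrite ltnS leq_eqVlt => /predU1P[->|lt].
  by rewrite nth_default // /= eqxx modnn.
rewrite modn_small // -[nth x t _]/(nth x (x :: t) (index u (x :: t)).+1).
by rewrite index_uniq.
Qed.

Section Isomorphism.
Variables (T : finType) (M : complex T) (e : rel T) (r : nat) (m : 'I_r -> nat).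
Variables (p : T -> 'I_r) (pi : {perm 'I_r}) (s : 'I_r -> seq T).
Notation V := (vertices M).
Hypothesis facesM : faces M = cliques e V.
Hypothesis sym : symmetric e.
Hypothesis m3 : forall i, 3 < m i.
Hypothesis cross : {in V &, forall u v, p u != p v -> e u v}.
Hypothesis suniq : forall i, uniq (s i).
Hypothesis sE : forall i v, (v \in s i) = (v \in V) && (p v == i).
Hypothesis scycle : forall i, cycle e (s i).
Hypothesis ssize : forall i, size (s i) = m (pi i).
Hypothesis deg2 : forall v, v \in V -> #|[set u in V | (p u == p v) && e v u]| = 2.

Fact mpos i : 0 < m i.
Proof. exact: leq_ltn_trans (m3 i). Qed.

Definition position (i : 'I_r) (v : T) : 'I_(m (pi i)) :=
  insubd (Ordinal (mpos (pi i))) (index v (s i)).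

Definition to_join (v : T) : {i : 'I_r & 'I_(m i)} :=
  Tagged (fun i => 'I_(m i)) (position (p v) v).

Lemma to_joinE i v : p v = i -> to_join v = Tagged (fun i => 'I_(m i)) (position i v).
Proof. by move=> <-. Qed.

Lemma val_position i v : v \in s i -> position i v = index v (s i) :> nat.
Proof.
move=> vs; have lt : index v (s i) < m (pi i) by rewrite -ssize index_mem.
by rewrite val_insubd lt.
Qed.

Lemma position_inj i u v : u \in s i -> v \in s i -> (position i u == position i v) = (u == v).
Proof.
move=> us vs; apply/eqP/eqP => [/(congr1 (@nat_of_ord _))|->] //.
by rewrite !val_position // => /(congr1 (nth u (s i))); rewrite !nth_index.
Qed.

Lemma position_next i u v : u \in s i -> v \in s i ->
  (position i v == ordS (position i u)) = (v == next (s i) u).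
Proof.
move=> us vs; rewrite -(@position_inj i) ?mem_next //; congr (_ == _).
by apply/val_inj => /=; rewrite !val_position ?mem_next // index_next // ssize.
Qed.

(** The two neighbours along the cyclic enumeration are all the neighbours in the part. *)
Lemma adj_next i u v : u \in s i -> v \in s i ->
  e u v = (v == next (s i) u) || (u == next (s i) v).
Proof.
move=> us vs; have nx w : w \in s i -> e w (next (s i) w).
  by move=> ws; exact: (next_cycle (scycle i) ws).
apply/idP/orP => [uv|[/eqP->|/eqP->]]; last first.
- by rewrite sym; exact: nx.
- exact: nx.
have [uV /eqP pu] : u \in V /\ p u == i by apply/andP; rewrite -sE.
have inN w : w \in s i -> e u w -> w \in [set w in V | (p w == p u) && e u w].
  by rewrite sE [w \in [set _ in _ | _]]inE pu => /andP[-> ->] ->.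
have ne : next (s i) u != prev (s i) u.
  by apply: next_next_neq; rewrite ?ssize //; exact: ltnW.
have E : [set next (s i) u; prev (s i) u] = [set w in V | (p w == p u) && e u w].
  apply/eqP; rewrite eqEcard deg2 // cards2 ne subUset !sub1set !inN ?mem_next ?mem_prev ?nx //.
  by rewrite sym; exact: (prev_cycle (scycle i) us).
have : v \in [set next (s i) u; prev (s i) u] by rewrite E inN.
by case/set2P => ->; [left|right; rewrite next_prev].
Qed.

Lemma to_join_adj : {in V &, forall u v, u != v -> join_adj (to_join u) (to_join v) = e u v}.
Proof.
move=> u v uV vV uv; have [puv|puv] := eqVneq (p u) (p v); last first.
  by rewrite cross // /join_adj /= (inj_eq perm_inj) puv.
have us : u \in s (p v) by rewrite sE uV puv eqxx.
have vs : v \in s (p v) by rewrite sE vV eqxx.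
rewrite (to_joinE puv) (to_joinE (erefl (p v))) join_adj_Tagged /cycle_adj /=.
by rewrite position_inj // uv !position_next // (adj_next us vs).
Qed.

Lemma to_join_inj : {in V &, injective to_join}.
Proof.
move=> u v uV vV E; have puv : p u = p v by apply: (@perm_inj _ pi); exact: (congr1 tag E).
have us : u \in s (p v) by rewrite sE uV puv eqxx.
have vs : v \in s (p v) by rewrite sE vV eqxx.
apply/eqP; rewrite -(position_inj us vs).
by move/eqP: E; rewrite (to_joinE puv) (to_joinE (erefl (p v))) eq_Tagged.
Qed.

Lemma to_join_onto y : exists2 v, v \in V & to_join v = y.
Proof.
case: y => j; have [pi' _ piK] := injF_bij (@perm_inj _ pi).
rewrite -(piK j) => k; set i := pi' j in k *.
have ks : k < size (s i) by rewrite ssize.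
have [x xs] : exists x, x \in s i by case: (s i) ks => // x t _; exists x; rewrite mem_head.
have vs : nth x (s i) k \in s i by rewrite mem_nth.
have /andP[vV /eqP pv] : (nth x (s i) k \in V) && (p (nth x (s i) k) == i) by rewrite -sE.
exists (nth x (s i) k) => //; rewrite (to_joinE pv); congr existT.
by apply: val_inj; rewrite /= val_position // index_uniq.
Qed.

(** A vertex is sent to its part and its position in the cyclic enumeration of that part; this
    identifies the graphs, and the two complexes are the clique complexes of these. *)
Lemma isomorphic_join : isomorphic M (join_complex (fun i => cycle_complex (m i))).
Proof.
exists to_join; split; first exact: to_join_inj.
have adjE := to_join_adj.
apply/setP => t; rewrite join_cycles_cliques // [in LHS]facesM.
apply/imsetP/idP => [[u + ->]|].
  rewrite !inE subsetT => /andP[/subsetP uV /cliqueP uC]; apply/cliqueP => _ _ /imsetP[x xu ->] /imsetP[y yu ->] xy.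
  have nxy : x != y by apply: contraNneq xy => ->.
  by rewrite adjE ?uV // uC.
rewrite inE subsetT => /cliqueP tC; exists [set v in V | to_join v \in t].
  rewrite inE; apply/andP; split; first by apply/subsetP => v; rewrite inE => /andP[].
  apply/cliqueP => x y; rewrite !inE => /andP[xV xt] /andP[yV yt] xy.
  by rewrite -adjE // ?inE //; apply: tC => //; apply: contraNneq xy => /to_join_inj->; rewrite ?inE.
apply/setP => y; apply/idP/imsetP => [yt|[v + ->]]; last by rewrite inE => /andP[].
by have [v vV vy] := to_join_onto y; exists v; rewrite // inE vV vy.
Qed.

End Isomorphism.

Local Open Scope ring_scope.

(** * The extremal complex *)

Section CompleteBetweenParts.
Variables (R : realFieldType) (r : nat) (c eps eps' : R).
Variables (T : finType) (M : complex T) (p : T -> 'I_r) (sigma : {set T}).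
Notation e := (edge M).
Notation V := (vertices M).
Hypothesis flagM : flag M.
Hypothesis manifoldM : homology_manifold M.
Hypothesis dimM : complex_dim M = r.*2%:Z - 1.
Hypothesis nt : near_turan (#|V|%:R : R) c eps eps' e V p set0.
Hypothesis r1 : (1 < r)%N.
Hypothesis eps0 : 0 <= eps.
Hypothesis eps_small : 16 * r%:R * eps <= c.
Hypothesis eps'_small : 4 * eps' <= c.
Hypothesis n_large : 8 <= c * #|V|%:R.
Hypothesis facet : sigma \in cliquesn e V r.*2.
Hypothesis cross : {in V &, forall u v, p u != p v -> e u v}.

(** Once all cross pairs are adjacent, the part is exactly the common neighbourhood of a
    clique with two vertices from each other part, that is, the vertex set of the
    link of a face of codimension 2. *)
Lemma class_connected i (S : {set T}) : S \subset class V p i -> S != set0 ->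
  (forall u v, u \in S -> v \in class V p i -> e u v -> v \in S) -> S = class V p i.
Proof.
have ridge2 := card_ext_ridge flagM manifoldM dimM.
have cmax := card_clique_max flagM dimM.
have sigmaV : sigma \subset V :\: set0 by rewrite setD0; case/cliquesnP: facet.
have r0 : (0 < r)%N by apply: ltnW.
have [||Q QC [QV Qp _]] := side_clique_to (@edge_irr _ _) (@edge_sym _ _) ridge2 cmax nt r0 eps0 eps_small
  eps'_small n_large facet sigmaV (i := i) (S := set0).
- exact: sub0set.
- by rewrite cards0.
have kE : r.*2.-2 = (r.*2.-2.-1).+1 by move: r1; clear; lia.
have QC' := QC; rewrite kE in QC'.
have -> : class V p i = ext e V Q.
  apply/setP => v; apply/idP/idP => [vi|vQ].
    have [vV /eqP pv] : v \in V /\ p v == i by apply/andP; move: vi; rewrite inE.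
    apply/extP; split=> // u uQ; apply: cross; rewrite ?pv ?Qp //.
    by have := subsetP QV _ uQ; rewrite in_setD => /andP[].
  have vV : v \in V by case/extP: vQ.
  have [pv|pv] := eqVneq (p v) i; first by rewrite inE vV pv eqxx.
  have vQC : v |: Q \in cliquesn e V (r.*2.-2).+1.
    by rewrite (cliquesnU1 (@edge_sym _ _)) ?(ext_notin (@edge_irr _ _) vQ) // QC.
  have /cliquesnP[vQV _ vQk] := vQC.
  have : (2 < #|goodpart V p set0 i :&: ext e V (v |: Q)|)%N.
    apply: (card_common_ext3 nt eps0 eps_small n_large).
    - by rewrite setD0.
    - by rewrite vQk; move: r1; clear; lia.
    - by move=> u /setU1P[->//|]; exact: Qp.
  move=> /leq_trans /(_ (subset_leq_card (subsetIr _ _))).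
  by rewrite (ridge2 _ _ _ vQC) //; move: r1; clear; lia.
have kE3 : (r.*2.-2.-1).+3 = r.*2 by move: r1; clear; lia.
exact: (ext_connected flagM manifoldM dimM kE3 QC').
Qed.

Lemma complete_isomorphic_join (m : 'I_r -> nat) (pi : {perm 'I_r}) :
  (forall i, (3 < m i)%N) -> (forall i, #|class V p i| = m (pi i)) ->
  (forall i v, v \in class V p i -> #|[set u in class V p i | e v u]| = 2%N) ->
  isomorphic M (join_complex (fun i => cycle_complex (m i))).
Proof.
move=> m3 mE deg2.
have /fin_all_exists[s sP] i : exists s : seq T,
    [/\ uniq s, s =i class V p i, cycle e s & (2 < size s)%N].
  apply: (two_regular_cycle (@edge_irr _ _) (@edge_sym _ _)).
  - exact: deg2.
  - exact: class_connected.
  - by rewrite -card_gt0 mE; apply: leq_ltn_trans (m3 _).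
apply: (@isomorphic_join _ M e r m p pi s) => //.
- exact: flag_cliques.
- exact: edge_sym.
- by move=> i; have [] := sP i.
- by move=> i v; have [_ -> _ _] := sP i; rewrite inE.
- by move=> i; have [] := sP i.
- by move=> i; have [us sE _ _] := sP i; rewrite -mE -(card_uniqP us); apply: eq_card.
move=> v vV; have vi : v \in class V p (p v) by rewrite inE vV /=.
rewrite -(deg2 _ _ vi); apply: eq_card => u; rewrite [LHS]inE [RHS]inE [u \in class _ _ _]inE.
by rewrite andbA.
Qed.

End CompleteBetweenParts.

Section Extremal.
Variables (R : realFieldType) (r l : nat) (cf : nat -> R) (cm1 : R).
Hypothesis l0 : (0 < l)%N.
Hypothesis lr : (l < r)%N.
Hypothesis cl0 : 0 < cf l.
Local Notation Lam := (face_functional cf cm1 l).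

(** The chain of comparisons. Completing the graph, raising the number of edges of each
    part to its number of vertices, and balancing the parts each increase the
    functional strictly unless nothing changes. As the given complex is not below the
    balanced join of cycles, nothing changes at all: the graph is complete between
    the parts, which are 2-regular of balanced sizes. *)
Lemma near_turan_extremal (c eps : R) : 0 < c -> 0 < eps -> 16 * r%:R * eps <= c ->
  exists e'0 n0 : R, 0 < e'0 /\
  forall (eps' : R) (T : finType) (M : complex T) (p : T -> 'I_r) (B sigma : {set T}),
  flag M -> homology_manifold M -> complex_dim M = r.*2%:Z - 1 ->
  let V := vertices M in let e := edge M in let n : R := #|V|%:R in
  0 < eps' -> eps' <= e'0 -> n0 <= n -> near_turan n c eps eps' e V p B ->
  sigma \in cliquesn e V r.*2 -> sigma \subset V :\: B ->
  Lam (cycles_poly R (@balanced_size r #|V|)) <= Lam (fpoly R (faces M)) ->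
  isomorphic M (Jcomplex r #|V|).
Proof.
move=> c0 eps0 eps_small; have r0 : (0 < r)%N by apply: leq_ltn_trans lr.
have r1 : (1 < r)%N by apply: leq_trans lr.
have [e'1 [n1 [e'10 compare]]] := completed_compare cm1 l0 lr cl0 c0 eps0.
have [x0 x00 raise] := quad_prod_raise cm1 cl0 l0 lr.
have [x1 x10 balance] := cycles_poly_balance cm1 cl0 l0 lr.
exists (Num.min e'1 (c / 4)), (Num.max n1 (Num.max ((8 + x0 + x1) / c) (4 * r)%:R)).
split; first by rewrite lt_min e'10 divr_gt0.
move=> eps' T M p B sigma flagM manifoldM dimM V e n eps'0.
rewrite le_min !ge_max => /andP[e'e1 e'c] /and3P[nn1 nx nr] nt facet sigma_good JM.
have eps'_small : 4 * eps' <= c by move: e'c; lra.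
have {}nx : 8 + x0 + x1 <= c * n by move: nx; rewrite ler_pdivrMr // mulrC.
have n_large : 8 <= c * n by move: nx x00 x10; lra.
have {}nr : (4 * r <= #|V|)%N by rewrite -(ler_nat R).
have irr : irreflexive e := @edge_irr _ _.
have sym : symmetric e := @edge_sym _ _.
have ridge2 := card_ext_ridge flagM manifoldM dimM.
have cmax := card_clique_max flagM dimM.
have deg2 := goodpart_degree irr sym ridge2 cmax nt r0 (ltW eps0) eps_small eps'_small n_large
  facet sigma_good.
have tri := goodpart_triangle_free irr sym ridge2 cmax nt r0 (ltW eps0) eps_small eps'_small n_large
  facet sigma_good.
have class_large i : c * n <= #|class V p i|%:R.
  have [_ big _ _ _] := nt; apply: le_trans (big i) _; rewrite ler_nat.
  by apply/subset_leq_card/subsetP => v; rewrite !inE => /andP[/andP[_ ->]].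
pose g := completed e p B.
pose a i : R := #|class V p i|%:R; pose b i : R := #|cliquesn g (class V p i) 2%N|%:R.
have gE : fpoly R (cliques g V) = \prod_i quad (a i) (b i) := fpoly_completed R tri.
have aE : \prod_i quad (a i) (a i) = cycles_poly R (fun i => #|class V p i|) by [].
have ge_a : (forall i, b i = a i) \/ Lam (fpoly R (cliques g V)) < Lam (\prod_i quad (a i) (a i)).
  rewrite gE; apply: raise => i; first by apply: le_trans (class_large i); move: nx x10; lra.
  by rewrite ler0n ler_nat (class_edges irr sym deg2).
have a_J := balance (fun i => #|class V p i|); rewrite (sum_class V p) in a_J.
have {}a_J := a_J (fun i => le_trans _ (class_large i)).
have {}a_J : [/\ forall i j, (#|class V p i| <= #|class V p j|.+1)%N &
    cycles_poly R (fun i => #|class V p i|) = cycles_poly R (@balanced_size r #|V|)] \/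
    Lam (\prod_i quad (a i) (a i)) < Lam (cycles_poly R (@balanced_size r #|V|)).
  by have [|[? ?]|?] := a_J; [move: nx x00; lra|left|right].
have aJ : Lam (\prod_i quad (a i) (a i)) <= Lam (cycles_poly R (@balanced_size r #|V|)).
  by case: a_J => [[_ E]|/ltW //]; rewrite aE E.
have ga : Lam (fpoly R (cliques g V)) <= Lam (\prod_i quad (a i) (a i)).
  case: ge_a => [E|/ltW //]; rewrite gE le_eqVlt; apply/orP; left; apply/eqP; congr Lam.
  by apply: eq_bigr => i _; rewrite E.
have ME : fpoly R (faces M) = fpoly R (cliques e V) by rewrite -flag_cliques.
have gM : Lam (fpoly R (cliques g V)) <= Lam (fpoly R (cliques e V)).
  by rewrite -ME; apply: le_trans JM; apply: le_trans aJ.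
have [|[B0 ge]] := compare eps' T e V B p irr sym eps'0 e'e1 nn1 nt.
  by rewrite ltNge gM.
have eg u v : e u v -> g u v by move=> uv; rewrite /g /completed B0 !inE uv orbT.
have gV : cliques g V = cliques e V.
  apply/setP => s; rewrite !inE; have [/subsetP sV /=|//] := boolP (s \subset V).
  apply/cliqueP/cliqueP => sC u v us vs uv; first by apply: ge; [exact: sV|exact: sV|exact: sC].
  by apply/eg/sC.
have bE : forall i, b i = a i.
  case: ge_a => // lt; move: (lt_le_trans lt (le_trans aJ JM)).
  by rewrite ME gV ltxx.
have bal : forall i j, (#|class V p i| <= #|class V p j|.+1)%N.
  case: a_J => [[]//|lt]; have := lt_le_trans lt (le_trans JM _).
  by rewrite ME -gV => /(_ _ ga); rewrite ltxx.
have [pi piE] := balanced_perm r0 (sum_class V p) bal.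
rewrite B0 in nt; apply: (complete_isomorphic_join flagM manifoldM dimM nt r1 (ltW eps0) eps_small
  eps'_small n_large facet _ _ piE).
- by move=> u v uV vV puv; apply: ge; rewrite // /completed puv.
- move=> i; apply: leq_trans (leq_addr _ _).
  by rewrite leq_divRL // mulnC; move: nr; rewrite mulnC.
move=> i v vi; have E : #|cliquesn g (class V p i) 2%N| = #|class V p i|.
  by apply/eqP; rewrite -(eqr_nat R) -/(b i) bE.
rewrite -(class_edges_eq irr sym deg2 E vi); apply: eq_card => u.
rewrite [LHS]inE [RHS]inE; have [ui /=|//] := boolP (u \in class V p i).
have cV w : w \in class V p i -> w \in V by rewrite inE => /andP[].
by apply/idP/idP => [/eg//|]; apply: ge; apply: cV.
Qed.

Lemma coef_fpoly_cliques_le (T : finType) (e : rel T) (V : {set T}) k :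
  irreflexive e -> symmetric e -> 0 <= (fpoly R (cliques e V))`_k <= #|V|%:R ^+ k.
Proof.
by move=> irr sym; rewrite coef_fpoly ler0n -natrX ler_nat; exact: card_cliquesn_le.
Qed.

Lemma fpoly_Jcomplex n : (4 * r <= n)%N -> (0 < r)%N ->
  fpoly R (faces (Jcomplex r n)) = cycles_poly R (@balanced_size r n).
Proof.
move=> nr r0; apply: (@fpoly_join_cycles _ (@balanced_size r n)) => i.
by apply: leq_trans (leq_addr _ _); rewrite leq_divRL // mulnC; move: nr; rewrite mulnC.
Qed.

Lemma coef_cycles_poly_le n k : (4 * r <= n)%N ->
  0 <= (cycles_poly R (@balanced_size r n))`_k <= n%:R ^+ k.
Proof.
have r0 : (0 < r)%N by apply: leq_ltn_trans lr.
move=> nr; rewrite -fpoly_Jcomplex // join_cycles_cliques => [|i].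
  by have := coef_fpoly_cliques_le setT k (@join_adj_irr _ _) (@join_adj_sym _ (@balanced_size r n));
    rewrite cardsT card_join_cycles.
by apply: leq_trans (leq_addr _ _); rewrite leq_divRL // mulnC; move: nr; rewrite mulnC.
Qed.

(** The constants are chosen in the order [c], [eps], [eps']: [eps] small against [c] makes
    the parts triangle-free of maximal degree 2, [eps'] small against [eps] makes the
    completion worthwhile, and small against the density of [r]-cliques it provides a
    good facet. *)
Lemma extremal_is_join : exists n0 : R, forall (T : finType) (M : complex T),
  flag M -> homology_manifold M -> complex_dim M = r.*2%:Z - 1 -> n0 <= #|vertices M|%:R ->
  Lam (cycles_poly R (@balanced_size r #|vertices M|)) <= Lam (fpoly R (faces M)) ->
  isomorphic M (Jcomplex r #|vertices M|).
Proof.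
have r0 : (0 < r)%N by apply: leq_ltn_trans lr.
have rr : 1 <= r%:R :> R by rewrite ler1n.
have [C link] := vertex_link_bound r0.
pose S := 2 * (\sum_(i < l) `|cf i| + `|cm1|) / cf l.
have S0 : 0 <= S.
  by apply: divr_ge0; [apply: mulr_ge0 => //; rewrite addr_ge0 // sumr_ge0|exact: ltW].
pose C1 := 'C(r, l.+1)%:R * l.+1%:R + S.
have C10 : 0 <= C1 by rewrite addr_ge0 // mulr_ge0.
have lr' : (0 < l < r)%N by rewrite l0.
have [c [c1 [c0 c10 stab]]] := near_turan_stability C lr' C10.
pose eps := c / (16 * r%:R).
have eps0 : 0 < eps by rewrite divr_gt0 // mulr_gt0 //; lra.
have epsE : 16 * r%:R * eps = c by rewrite mulrC divfK // mulf_neq0 // gt_eqF //; lra.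
have eps_c : eps <= c / 2 by have := ler_wpM2r (ltW eps0) rr; move: epsE; lra.
have eps_small : 16 * r%:R * eps <= c by rewrite epsE.
have [e'0 [n1 [e'00 extremal]]] := near_turan_extremal c0 eps0 eps_small.
pose D : R := C%:R * 4 ^+ r; have D0 : 0 <= D by rewrite mulr_ge0 // exprn_ge0.
pose eps' := Num.min e'0 (Num.min (c / 2) (c1 / (D + 1))).
have eps'0 : 0 < eps' by rewrite !lt_min e'00 !divr_gt0 //; lra.
have : eps' <= eps' by []; rewrite {2}/eps' !le_min => /and3P[e'e e'c e'1].
have small : D * eps' < c1.
  by move: e'1; rewrite ler_pdivlMr; [move: eps'0; lra|lra].
have [n2 stab'] := stab eps eps' eps0 eps_c eps'0 e'c.
exists (Num.max n1 (Num.max n2 (Num.max (8 / c) (4 * r)%:R))) => T M flagM manifoldM dimM.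
set V := vertices M; set e := edge M; pose n : R := #|V|%:R.
rewrite -/n !ge_max => /and4P[nn1 nn2 n8 nr] JM.
have {}nr : (4 * r <= #|V|)%N by rewrite -(ler_nat R).
have n_large : 8 <= c * n by move: n8; rewrite ler_pdivrMr // mulrC.
have rV : (r <= #|V|)%N by apply: leq_trans nr; rewrite leq_pmull.
have n1' : 1 <= n by rewrite ler1n; apply: leq_trans rV.
have irr : irreflexive e := @edge_irr _ _.
have sym : symmetric e := @edge_sym _ _.
have links w k : w \in V -> (#|cliquesn e (ext e V [set w]) k| <= C * #|V| ^ r.-1)%N.
  by move=> wV; exact: link dimM wV k.
have ME : fpoly R (faces M) = fpoly R (cliques e V) by rewrite -flag_cliques.
(* a value not below that of the join forces almost as many l.+1-cliques as in the
   Turan graph *)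
have lead : 'C(r, l.+1)%:R * (n / r%:R) ^+ l.+1 - C1 * n ^+ l <= #|cliquesn e V l.+1|%:R.
  have := @leading_coef_ge R cf cm1 l l0 cl0 n _ _ n1' (fun k => coef_fpoly_cliques_le V k irr sym)
    (fun k => coef_cycles_poly_le k nr).
  rewrite -/S coef_fpoly -ME => /(_ JM); apply: le_trans.
  have := coef_balanced_cycles_ge R l.+1 r0 rV; rewrite /= -/n /C1 => low.
  by rewrite mulrDl opprD addrA lerD2r.
have [kr [p [B nt]]] := stab' T e V irr sym nn2 links lead.
have links' w k : w \in V -> #|cliquesn e (ext e V [set w]) k|%:R <= C%:R * n ^+ r.-1.
  by move=> wV; rewrite -natrX -natrM ler_nat links.
have [sigma facet sigma_good] := good_facet (clique_pure flagM manifoldM dimM) nt r0 n_large kr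
  (ler0n R C) small links'.
exact: (extremal eps' T M p B sigma).
Qed.

End Extremal.

Lemma fnum_functional (R : realFieldType) (c : nat -> R) (cm1 : R) l (T : finType) (K : complex T) :
  \sum_(i < l.+1) c i * (fnum K i)%:R + cm1 = face_functional c cm1 l (fpoly R (faces K)).
Proof.
rewrite /face_functional coef_fpoly; congr (_ + _).
  by apply: eq_bigr => i _; rewrite coef_fpoly.
suff -> : [set s in faces K | #|s| == 0%N] = [set set0] by rewrite cards1 mulr1.
apply/setP => s; rewrite !inE cards_eq0; apply/andP/eqP => [[_ /eqP]//|->].
by rewrite complex0 eqxx.
Qed.

Lemma isomorphic_fpoly (R : realFieldType) (T T' : finType) (K : complex T) (L : complex T') :
  isomorphic K L -> fpoly R (faces K) = fpoly R (faces L).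
Proof.
case=> f [finj <-]; apply/esym; apply: (fpoly_imset R finj) => s sK; apply/subsetP => v vs.
by rewrite inE (complexS _ sK) // sub1set.
Qed.

Theorem theorem1 (R : realType) (d : nat) (l : nat)
    (F : forall T : finType, complex T -> R) :
  (4 <= d)%N -> ~~ odd d -> (1 <= l <= d./2 - 1)%N -> face_function l F ->
  exists n0 : nat, forall (T : finType) (M : complex T) (n : nat),
    flag M -> homology_manifold M -> complex_dim M = d%:Z - 1 ->
    #|vertices M| = n -> (n0 <= n)%N ->
    F T M <= F _ (Jcomplex d./2 n) /\
    (F T M = F _ (Jcomplex d./2 n) <-> isomorphic M (Jcomplex d./2 n)).
Proof.
move=> d4 d_even /andP[l0 ld] [c [cm1 [cl0 FE]]].
set r := d./2; have dE : d = r.*2 by rewrite -{1}(odd_double_half d) (negbTE d_even).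
have r0 : (0 < r)%N by move: d4; rewrite dE; clear; lia.
have lr : (l < r)%N by move: ld r0; rewrite -/r; clear; lia.
have [n1 extremal] := @extremal_is_join R r l c cm1 l0 lr cl0.
exists (maxn (Num.bound `|n1|) (4 * r)) => T M n flagM manifoldM dimM Vn.
rewrite geq_max => /andP[nn1 nr]; rewrite !FE !fnum_functional (@fpoly_Jcomplex R r n nr r0).
have n1n : n1 <= n%:R.
  apply: le_trans (_ : (Num.bound `|n1|)%:R <= n%:R); last by rewrite ler_nat.
  by apply: le_trans (ler_norm _) _; rewrite ltW // archi_boundP.
have iso : face_functional c cm1 l (cycles_poly R (@balanced_size r n)) <=
    face_functional c cm1 l (fpoly R (faces M)) -> isomorphic M (Jcomplex r n).
  by rewrite -Vn => JM; apply: extremal => //; rewrite -?dE // Vn.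
have isoE : isomorphic M (Jcomplex r n) -> fpoly R (faces M) = cycles_poly R (@balanced_size r n).
  by move/(@isomorphic_fpoly R); rewrite (@fpoly_Jcomplex R r n nr r0).
split; last by split=> [E|/isoE -> //]; apply: iso; rewrite E.
by rewrite leNgt; apply/negP => lt; move: (lt); rewrite (isoE (iso (ltW lt))) ltxx.
Qed.
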